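(* Let $y$ be the exact solution of the boundary-value problem and let $\overline{y}=(\overline{y}_0,\ldots,\overline{y}_N)^T$ be the solution of the discrete problem $T\overline{y}=0$ on the modified Shishkin mesh. Then the discrete problem is uniformly convergent with respect to $\varepsilon$: there is a constant $C>0$, independent of $N$ and $\varepsilon$, such that $$\left|y(x_i)-\overline{y}_i\right|\leqslant C\begin{cases}(\ln^2N)/N^2,& i=0,\ldots,N/4-1,\\ 1/N^2,& i=N/4,\ldots,3N/4,\\ (\ln^2N)/N^2,& i=3N/4+1,\ldots,N.\end{cases}$$
   Context: Boundary-value problem: $\varepsilon^2y''-f(x,y)=0$ for $x\in(0,1)$, $y(0)=y(1)=0$, where $\varepsilon\in(0,1)$ is a small perturbation parameter, $f\in C^{k}([0,1]\times\mathbb{R})$ with $k\geqslant 2$, and $f_y:=\partial f/\partial y\geqslant m>0$ on $[0,1]\times\mathbb{R}$ for a constant $m$. This problem has a unique solution $y$. Modified Shishkin mesh: let $N$ be a positive multiple of $4$, $\lambda:=\min\left\{\frac{2\varepsilon\ln N}{\sqrt{m}},\frac14\right\}$, $p=32(1-4\lambda)$, and let $\psi:[0,1]\to[0,1]$ be given by $\psi(\tau)=4\lambda\tau$ for $\tau\in[0,1/4]$, $\psi(\tau)=p(\tau-1/4)^3+4\lambda\tau$ for $\tau\in[1/4,1/2]$, and $\psi(\tau)=1-\psi(1-\tau)$ for $\tau\in[1/2,1]$. The mesh points are $x_i=\psi(i/N)$, $i=0,\ldots,N$, and $h_i=x_{i+1}-x_i$, $i=0,\ldots,N-1$. Parameters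 of the scheme: $t\in[0,1]$ is a fixed number, $\gamma$ is a constant (independent of $\varepsilon$ and $N$) with $\gamma\geqslant f_y(x,y)$ for all $(x,y)\in[0,1]\times\mathbb{R}$, and $\beta=\sqrt{\gamma}/\varepsilon$. Under this condition the discrete problem below has a unique solution. Discrete operator: $T:\mathbb{R}^{N+1}\to\mathbb{R}^{N+1}$, $Tu=(Tu_0,Tu_1,\ldots,Tu_N)^T$ for $u=(u_0,\ldots,u_N)^T$, where $Tu_0=-u_0$, $Tu_N=-u_N$, and for $i=1,\ldots,N-1$, writing $f_j=f(x_j,u_j)$, $$Tu_i=\frac{\gamma}{\frac{\cosh(\beta h_{i-1})-1}{\sinh(\beta h_{i-1})}+\frac{\cosh(\beta h_i)-1}{\sinh(\beta h_i)}}\Big[\tfrac{(1-t)\cosh(\beta h_{i-1})+t}{\sinh(\beta h_{i-1})}(u_{i-1}-u_i)-\tfrac{(1-t)\cosh(\beta h_i)+t}{\sinh(\beta h_i)}(u_i-u_{i+1})$$ $$-\tfrac{(1-t)f_{i-1}+tf_i}{\gamma}\cdot\tfrac{\cosh(\beta h_{i-1})-1}{\sinh(\beta h_{i-1})}-\tfrac{tf_i+(1-t)f_{i+1}}{\gamma}\cdot\tfrac{\cosh(\beta h_i)-1}{\sinh(\beta h_i)}\Big].$$ *)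

(* Defs.v *)
From Stdlib Require Import Reals Arith.
From Coquelicot Require Import Coquelicot.
Open Scope R_scope.

Definition unit_itv (x : R) : Prop := 0 <= x <= 1.

Definition slab (p : R * R) : Prop := unit_itv (fst p).

(* C^k([0,1] x R): all (mixed) partial derivatives up to order k exist and are
   continuous on the closed set [0,1] x R.  Derivatives in x are relative to
   [0,1], hence one-sided at x = 0 and x = 1; the values of g outside
   [0,1] x R play no role. *)
Fixpoint Ck_slab (k : nat) (g : R -> R -> R) : Prop :=
  continuous_on slab (fun p : R * R => g (fst p) (snd p)) /\
  match k with
  | O => True
  | S k' =>
      exists gx gy : R -> R -> R,
        (forall x v, unit_itv x ->
           filterdiff (fun s => g s v) (within unit_itv (locally x))
             (fun d => scal d (gx x v)) /\
           is_derive (fun w => g x w) v (gy x v)) /\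
        Ck_slab k' gx /\ Ck_slab k' gy
  end.

Definition partial_y (f : R -> R -> R) (x v : R) : R := Derive (fun w => f x w) v.

(* Differentiability of y is required separately from that of [Derive y],
   because [Derive] is a total operator. *)
Definition bvp_solution (f : R -> R -> R) (eps : R) (y : R -> R) : Prop :=
  continuous_on unit_itv y /\
  (forall x, 0 < x < 1 ->
     ex_derive y x /\ ex_derive (Derive y) x /\
     eps ^ 2 * Derive_n y 2 x - f x (y x) = 0) /\
  y 0 = 0 /\ y 1 = 0.

Definition lambda (m eps : R) (N : nat) : R :=
  Rmin (2 * eps * ln (INR N) / sqrt m) (1 / 4).

Definition psi_left (lam tau : R) : R :=
  if Rle_dec tau (1 / 4) then 4 * lam * tau
  else 32 * (1 - 4 * lam) * (tau - 1 / 4) ^ 3 + 4 * lam * tau.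

Definition psi (lam tau : R) : R :=
  if Rle_dec tau (1 / 2) then psi_left lam tau
  else 1 - psi_left lam (1 - tau).

Definition mesh (m eps : R) (N i : nat) : R :=
  psi (lambda m eps N) (INR i / INR N).

(* A vector (u_0,...,u_N) is represented by a sequence of which only the
   entries of index at most N are used; x is the mesh. *)
Definition T (f : R -> R -> R) (t gamma eps : R) (N : nat) (x u : nat -> R)
    (i : nat) : R :=
  if (i =? 0)%nat then - u 0%nat
  else if (i =? N)%nat then - u N
  else
    let beta := sqrt gamma / eps in
    let h j := x (j + 1)%nat - x j in
    let F j := f (x j) (u j) in
    let a j := ((1 - t) * cosh (beta * h j) + t) / sinh (beta * h j) in
    let d j := (cosh (beta * h j) - 1) / sinh (beta * h j) in
    gamma / (d (i - 1)%nat + d i) *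
    (a (i - 1)%nat * (u (i - 1)%nat - u i) - a i * (u i - u (i + 1)%nat)
     - ((1 - t) * F (i - 1)%nat + t * F i) / gamma * d (i - 1)%nat
     - (t * F i + (1 - t) * F (i + 1)%nat) / gamma * d i).

Definition discrete_solution (f : R -> R -> R) (t gamma eps : R) (N : nat)
    (x u : nat -> R) : Prop :=
  forall i : nat, (i <= N)%nat -> T f t gamma eps N x u i = 0.

Definition error_rate (N i : nat) : R :=
  if ((N / 4 <=? i) && (i <=? 3 * N / 4))%nat%bool then 1 / INR N ^ 2
  else ln (INR N) ^ 2 / INR N ^ 2.

(* Main.v *)
Require Import Defs.
From Stdlib Require Import Reals Arith Lra Lia Psatz ClassicalEpsilon.
From Coquelicot Require Import Coquelicot.
Open Scope R_scope.

(** Put a = sqrt m / eps, E(x) = exp (-a x) + exp (-a (1 - x)) and w = y - f(x, y) / gamma, so that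
    y'' = beta^2 (y - w).

    A priori bounds.  Where f(x, y -/+ B) is extremal with the wrong sign, with B a multiple of
    E + eps^2, the first- and second-order conditions contradict the equation; hence
    |f(x, y)| <= C (eps^2 + E).  It follows that |w'|, |w''| <= C (1 + E / eps^2), and that with
    c = - f_x / f_y at x one has |w(z) - w(x) - c (z - x)| <= C (eps^2 + E + (z - x)^2), so the
    reduced solution never has to be constructed.

    Truncation.  The scheme is exact for y'' = beta^2 (y - w) with constant w.  If w is within rho
    of an affine function of slope c, comparison for the equation bounds the truncation error,
    relative to the weight D of the row, by 3 |c| |h_i - h_(i-1)| + 2 rho, for every ratio h / eps.
    The tangent of w serves in the layers and where eps > 1 / N; the slope - f_x / f_y serves in the
    middle when eps <= 1 / N.  The result is C (1 / N^2 + (H / eps)^2 E), H the fine mesh size.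

    Stability.  gamma >= f_y makes the linearised scheme an M-matrix with row sums at most
    - (m / gamma) D.  The grid function exp (- mu x), with mu a small multiple of a, is a
    supersolution up to the constant exp (- mu lambda), so the layer part of the truncation error
    contributes (H / eps)^2 exp (- mu x), which is O(1 / N^2) beyond the transition point. *)

(** * Mean value and hyperbolic function estimates *)

(** The delicate point is the absence of a logarithm in the middle range. Constant barriers would
    spread the layer part (H / eps)^2 of the truncation error, which may be of order ln^2 N / N^2,
    over the whole mesh. The decaying supersolution localises it, and its rate may be any fixed
    fraction of a: since H / eps = 4 lambda / (eps N), the factor exp (- mu lambda) only has to
    absorb (lambda / eps)^2, and u^2 exp (- u) is bounded. This leaves the freedom to take mu so
    small that the perturbation terms of a discrete row are dominated by kappa = m / gamma.

    The weight D is the sum of tanh (beta h / 2) over the two cells of a row: of size beta h on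
    resolved cells and of size 1 on coarse ones. Measuring both truncation and stability against D
    is what makes them match at every ratio h / eps. The second order comes from h_i - h_(i-1) = O(1
    / N^2), which the cubic piece of the mesh function provides. *)

Lemma MVT_interior (g g1 : R -> R) (a b : R) :
  a < b ->
  (forall x, a <= x <= b -> continuous g x) ->
  (forall x, a < x < b -> is_derive g x (g1 x)) ->
  exists c, a < c < b /\ g b - g a = g1 c * (b - a).
Proof.
  intros Hab Hc Hd.
  assert (pr : forall c, a < c < b -> derivable_pt g c).
  { intros c Hc'. exists (g1 c). apply is_derive_Reals. auto. }
  assert (pi : forall c, a < c < b -> derivable_pt id c).
  { intros c _. apply derivable_pt_id. }
  (* The Cauchy form, with the identity as second function, asks for differentiability in the open
     interval only, which is all that the boundary-value problem provides. *)
  destruct (Stdlib.Reals.MVT.MVT g id a b pr pi Hab) as [c [Hc' E]].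
  - intros c Hc'. apply continuity_pt_filterlim. apply Hc. exact Hc'.
  - intros c _. apply derivable_continuous_pt, derivable_pt_id.
  - exists c. split. exact Hc'.
    rewrite (derive_pt_eq_0 g c (g1 c) (pr c Hc')) in E.
    2: apply is_derive_Reals; auto.
    rewrite (derive_pt_eq_0 id c 1 (pi c Hc')) in E.
    2: apply derivable_pt_lim_id.
    unfold id in E. lra.
Qed.

Lemma is_derive_eq (g : R -> R) (x a b : R) : is_derive g x a -> a = b -> is_derive g x b.
Proof. intros H <-. exact H. Qed.

Lemma is_derive_Rplus (g h : R -> R) (x a b : R) :
  is_derive g x a -> is_derive h x b -> is_derive (fun u => g u + h u) x (a + b).
Proof. intros Hg Hh. exact (is_derive_plus g h x a b Hg Hh). Qed.

Lemma is_derive_Rminus (g h : R -> R) (x a b : R) :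
  is_derive g x a -> is_derive h x b -> is_derive (fun u => g u - h u) x (a - b).
Proof. intros Hg Hh. exact (is_derive_minus g h x a b Hg Hh). Qed.

Lemma is_derive_Rmult (g h : R -> R) (x a b : R) :
  is_derive g x a -> is_derive h x b ->
  is_derive (fun u => g u * h u) x (a * h x + g x * b).
Proof. intros Hg Hh. apply (is_derive_mult g h x a b Hg Hh). intros; apply Rmult_comm. Qed.

Lemma is_derive_Rconst (a x : R) : is_derive (fun _ : R => a) x 0.
Proof. exact (is_derive_const a x). Qed.

Lemma is_derive_Rid (x : R) : is_derive (fun u : R => u) x 1.
Proof. exact (is_derive_id x). Qed.

Lemma is_derive_cosh (x : R) : is_derive cosh x (sinh x).
Proof. apply is_derive_Reals, derivable_pt_lim_cosh. Qed.

Lemma is_derive_sinh (x : R) : is_derive sinh x (cosh x).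
Proof. apply is_derive_Reals, derivable_pt_lim_sinh. Qed.

Lemma cosh2_sinh2 (x : R) : cosh x * cosh x - sinh x * sinh x = 1.
Proof.
  unfold cosh, sinh.
  assert (E : exp x * exp (- x) = 1) by (rewrite <- exp_plus, <- exp_0; f_equal; ring).
  nra.
Qed.

Lemma sinh_pos (x : R) : 0 < x -> 0 < sinh x.
Proof. intros H. rewrite <- sinh_0. apply sinh_lt; exact H. Qed.

Lemma cosh_ge_1 (x : R) : 1 <= cosh x.
Proof.
  pose proof (cosh2_sinh2 x).
  assert (0 < cosh x).
  { unfold cosh. pose proof (exp_pos x). pose proof (exp_pos (- x)). lra. }
  nra.
Qed.

Lemma is_derive_continuous (g : R -> R) (x l : R) : is_derive g x l -> continuous g x.
Proof. intros H. apply (ex_derive_continuous (V := R_NormedModule)). exists l. exact H. Qed.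

Lemma increasing_ge (g g1 : R -> R) (a b : R) :
  a <= b ->
  (forall x, a <= x <= b -> continuous g x) ->
  (forall x, a < x < b -> is_derive g x (g1 x)) ->
  (forall x, a < x < b -> 0 <= g1 x) ->
  g a <= g b.
Proof.
  intros Hab Hc Hd Hp.
  destruct (Req_dec a b) as [<-|Hne]. lra.
  destruct (MVT_interior g g1 a b) as [c [Hc1 E]]; auto. lra.
  specialize (Hp c Hc1). nra.
Qed.

Lemma sinh_ge_id (x : R) : 0 <= x -> x <= sinh x.
Proof.
  intros H.
  assert (sinh 0 - 0 <= sinh x - x); [|rewrite sinh_0 in *; lra].
  apply (increasing_ge (fun u => sinh u - u) (fun u => cosh u - 1)); auto.
  - intros u _. apply (is_derive_continuous _ _ (cosh u - 1)).
    apply is_derive_Rminus. apply is_derive_sinh. apply is_derive_Rid.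
  - intros u _. apply is_derive_Rminus. apply is_derive_sinh. apply is_derive_Rid.
  - intros u _. pose proof (cosh_ge_1 u). lra.
Qed.

Lemma cosh_ge_quadratic (x : R) : 0 <= x -> 1 + x ^ 2 / 2 <= cosh x.
Proof.
  intros H.
  assert (D : forall u, is_derive (fun u => cosh u - u ^ 2 / 2) u (sinh u - u)).
  { intros u. apply is_derive_Rminus. apply is_derive_cosh. auto_derive; auto; field. }
  assert (cosh 0 - 0 ^ 2 / 2 <= cosh x - x ^ 2 / 2); [|rewrite cosh_0 in *; lra].
  apply (increasing_ge (fun u => cosh u - u ^ 2 / 2) (fun u => sinh u - u)); auto.
  - intros u _. eapply is_derive_continuous, D.
  - intros u Hu. pose proof (sinh_ge_id u). lra.
Qed.

Lemma sinh_le_id_cosh (x : R) : 0 <= x -> sinh x <= x * cosh x.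
Proof.
  intros H.
  assert (D : forall u, is_derive (fun u => u * cosh u - sinh u) u (u * sinh u)).
  { intros u. replace (u * sinh u) with ((1 * cosh u + u * sinh u) - cosh u) by ring.
    apply is_derive_Rminus. 2: apply is_derive_sinh.
    apply is_derive_Rmult. apply is_derive_Rid. apply is_derive_cosh. }
  assert (0 * cosh 0 - sinh 0 <= x * cosh x - sinh x); [|rewrite sinh_0 in *; lra].
  apply (increasing_ge (fun u => u * cosh u - sinh u) (fun u => u * sinh u)); auto.
  - intros u _. eapply is_derive_continuous, D.
  - intros u Hu. pose proof (sinh_pos u). nra.
Qed.

(* [hyp_d] is tanh (z / 2); [hyp_d] and [hyp_s] are the coefficients d and (at t = 1) a of [T]. *)
Definition hyp_d (z : R) : R := (cosh z - 1) / sinh z.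
Definition hyp_s (z : R) : R := 1 / sinh z.

Lemma hyp_s_pos (z : R) : 0 < z -> 0 < hyp_s z.
Proof. intros H. unfold hyp_s. apply Rdiv_lt_0_compat. lra. apply sinh_pos, H. Qed.

Lemma hyp_d_pos (z : R) : 0 < z -> 0 < hyp_d z.
Proof.
  intros H. unfold hyp_d. apply Rdiv_lt_0_compat.
  - pose proof (cosh_ge_quadratic z). nra.
  - apply sinh_pos, H.
Qed.

Lemma hyp_d_alt (z : R) : 0 < z -> hyp_d z = sinh z / (cosh z + 1).
Proof.
  intros H. unfold hyp_d. pose proof (sinh_pos z H). pose proof (cosh_ge_1 z).
  pose proof (cosh2_sinh2 z).
  field_simplify_eq. nra. split; lra.
Qed.

Lemma is_derive_hyp_d (z : R) : 0 < z -> is_derive hyp_d z (/ (cosh z + 1)).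
Proof.
  intros H. pose proof (sinh_pos z H). pose proof (cosh_ge_1 z).
  pose proof (cosh2_sinh2 z).
  replace (/ (cosh z + 1)) with
    ((sinh z * sinh z - (cosh z - 1) * cosh z) / sinh z ^ 2).
  - unfold hyp_d. apply (is_derive_div (fun z => cosh z - 1) sinh).
    + replace (sinh z) with (sinh z - 0) by ring.
      apply is_derive_Rminus. apply is_derive_cosh. apply is_derive_Rconst.
    + apply is_derive_sinh.
    + lra.
  - field_simplify_eq. 2: split; lra. nra.
Qed.

Lemma hyp_d_le (a b : R) : 0 < a -> a <= b -> hyp_d a <= hyp_d b.
Proof.
  intros Ha Hab. apply (increasing_ge hyp_d (fun z => / (cosh z + 1))); auto.
  - intros x Hx. eapply is_derive_continuous, is_derive_hyp_d. lra.
  - intros x Hx. apply is_derive_hyp_d. lra.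
  - intros x Hx. pose proof (cosh_ge_1 x).
    apply Rlt_le, Rinv_0_lt_compat. lra.
Qed.

(** This is cosh z - 1 >= z^2 / 2 divided by sinh z. It turns quadratic Taylor terms of a grid
    function into multiples of the row weight. *)
Lemma sq_hyp_s_le (z : R) : 0 < z -> z ^ 2 * hyp_s z <= 2 * hyp_d z.
Proof.
  intros H. unfold hyp_s, hyp_d. pose proof (sinh_pos z H).
  pose proof (cosh_ge_quadratic z).
  replace (z ^ 2 * (1 / sinh z)) with (z ^ 2 / sinh z) by (field; lra).
  replace (2 * ((cosh z - 1) / sinh z)) with ((2 * (cosh z - 1)) / sinh z) by (field; lra).
  apply Rmult_le_compat_r. apply Rlt_le, Rinv_0_lt_compat; lra. lra.
Qed.

Lemma id_hyp_s_le_1 (z : R) : 0 < z -> 0 < z * hyp_s z <= 1.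
Proof.
  intros H. pose proof (sinh_pos z H). pose proof (sinh_ge_id z).
  split. apply Rmult_lt_0_compat; auto. apply hyp_s_pos, H.
  unfold hyp_s. apply Rmult_le_reg_r with (sinh z). lra. field_simplify; lra.
Qed.

(** After multiplication by sinh z this is 1 - z <= exp (- z). *)
Lemma one_minus_id_hyp_s_le (z : R) : 0 < z -> 1 - z * hyp_s z <= hyp_d z.
Proof.
  intros H. pose proof (sinh_pos z H).
  unfold hyp_s, hyp_d. apply Rmult_le_reg_r with (sinh z). lra.
  field_simplify; try lra.
  unfold sinh, cosh. pose proof (exp_ineq1_le (- z)). lra.
Qed.

(** The derivative of z / sinh z has modulus (z cosh z - sinh z) / sinh^2 z, which is at most
    [hyp_d z] because z <= sinh z. A Lipschitz constant of the size of the row weight, rather than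
    an absolute one, keeps the comparison of neighbouring cells uniform for small scaled steps. *)
Lemma id_hyp_s_lipschitz_aux (a b : R) : 0 < a -> a <= b ->
  Rabs (b * hyp_s b - a * hyp_s a) <= hyp_d b * (b - a).
Proof.
  intros Ha Hab.
  destruct (Req_dec a b) as [<-|Hne].
  { unfold Rminus. rewrite !Rplus_opp_r, Rabs_R0. lra. }
  assert (D : forall z, a <= z <= b ->
     is_derive (fun z => z * hyp_s z) z (- ((z * cosh z - sinh z) / sinh z ^ 2))).
  { intros z Hz. pose proof (sinh_pos z).
    apply is_derive_ext with (fun z => z / sinh z).
    { intros u. unfold hyp_s, Rdiv. rewrite Rmult_1_l. reflexivity. }
    apply is_derive_eq with ((1 * sinh z - z * cosh z) / sinh z ^ 2).
    2: field; lra.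
    apply (is_derive_div (fun z => z) sinh). apply is_derive_Rid. apply is_derive_sinh. lra. }
  destruct (MVT_interior (fun z => z * hyp_s z)
     (fun z => - ((z * cosh z - sinh z) / sinh z ^ 2)) a b) as [c [Hc E]]. lra.
  { intros x Hx. eapply is_derive_continuous, D, Hx. }
  { intros x Hx. apply D. lra. }
  rewrite E. rewrite Rabs_mult, Rabs_Ropp, (Rabs_pos_eq (b - a)) by lra.
  apply Rmult_le_compat_r. lra.
  apply Rle_trans with (hyp_d c). 2: apply hyp_d_le; lra.
  pose proof (sinh_pos c). pose proof (sinh_le_id_cosh c). pose proof (sinh_ge_id c).
  pose proof (cosh_ge_1 c).
  rewrite Rabs_pos_eq.
  2:{ apply Rdiv_le_0_compat. lra. apply pow_lt. lra. }
  unfold hyp_d. apply Rmult_le_reg_r with (sinh c ^ 2). apply pow_lt; lra.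
  field_simplify; try lra. nra.
Qed.

(** The derivative is [hyp_d z] + z / (cosh z + 1), and [hyp_d z] = sinh z / (cosh z + 1) dominates
    the second term. *)
Lemma id_hyp_d_lipschitz_aux (a b : R) : 0 < a -> a <= b ->
  Rabs (b * hyp_d b - a * hyp_d a) <= 2 * hyp_d b * (b - a).
Proof.
  intros Ha Hab.
  destruct (Req_dec a b) as [<-|Hne].
  { unfold Rminus. rewrite !Rplus_opp_r, Rabs_R0. lra. }
  assert (D : forall z, a <= z <= b ->
     is_derive (fun z => z * hyp_d z) z (1 * hyp_d z + z * / (cosh z + 1))).
  { intros z Hz.
    apply is_derive_Rmult. apply is_derive_Rid. apply is_derive_hyp_d. lra.
    }
  destruct (MVT_interior (fun z => z * hyp_d z)
     (fun z => 1 * hyp_d z + z * / (cosh z + 1)) a b) as [c [Hc E]]. lra.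
  { intros x Hx. eapply is_derive_continuous, D, Hx. }
  { intros x Hx. apply D. lra. }
  rewrite E. rewrite Rabs_mult, (Rabs_pos_eq (b - a)) by lra.
  apply Rmult_le_compat_r. lra.
  apply Rle_trans with (2 * hyp_d c). 2: { pose proof (hyp_d_le c b). lra. }
  pose proof (sinh_ge_id c). pose proof (cosh_ge_1 c). pose proof (hyp_d_pos c).
  assert (0 <= c * / (cosh c + 1)).
  { apply Rmult_le_pos. lra. apply Rlt_le, Rinv_0_lt_compat. lra. }
  rewrite Rabs_pos_eq by lra.
  cut (c * / (cosh c + 1) <= hyp_d c). lra.
  rewrite hyp_d_alt by lra. apply Rmult_le_compat_r.
  apply Rlt_le, Rinv_0_lt_compat. lra. lra.
Qed.

Lemma id_hyp_s_lipschitz (a b : R) : 0 < a -> 0 < b ->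
  Rabs (b * hyp_s b - a * hyp_s a) <= (hyp_d a + hyp_d b) * Rabs (b - a).
Proof.
  intros Ha Hb. pose proof (hyp_d_pos a Ha). pose proof (hyp_d_pos b Hb).
  destruct (Rle_dec a b) as [L|L].
  - rewrite (Rabs_pos_eq (b - a)) by lra. pose proof (id_hyp_s_lipschitz_aux a b Ha L). nra.
  - rewrite Rabs_minus_sym, (Rabs_minus_sym b), (Rabs_pos_eq (a - b)) by lra.
    pose proof (id_hyp_s_lipschitz_aux b a Hb). nra.
Qed.

Lemma id_hyp_d_lipschitz (a b : R) : 0 < a -> 0 < b ->
  Rabs (b * hyp_d b - a * hyp_d a) <= 2 * (hyp_d a + hyp_d b) * Rabs (b - a).
Proof.
  intros Ha Hb. pose proof (hyp_d_pos a Ha). pose proof (hyp_d_pos b Hb).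
  destruct (Rle_dec a b) as [L|L].
  - rewrite (Rabs_pos_eq (b - a)) by lra. pose proof (id_hyp_d_lipschitz_aux a b Ha L). nra.
  - rewrite Rabs_minus_sym, (Rabs_minus_sym b), (Rabs_pos_eq (a - b)) by lra.
    pose proof (id_hyp_d_lipschitz_aux b a Hb). nra.
Qed.

(** * Truncation error for an affine source *)

Lemma is_derive_exp_lin (a x : R) : is_derive (fun u => exp (a * u)) x (a * exp (a * x)).
Proof. auto_derive; auto. ring. Qed.

(** The operator v'' - beta^2 v factors: exp (- beta s) (v' + beta v) is nondecreasing, hence v' +
    beta v >= 0, hence exp (beta s) v is nondecreasing. At [k] only continuity is asked, since [k]
    may correspond to an end point of [0, 1]. *)
Lemma ode_comparison (beta k : R) (v v1 v2 : R -> R) :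
  0 < k ->
  (forall s, 0 <= s < k -> is_derive v s (v1 s)) ->
  (forall s, 0 <= s < k -> is_derive v1 s (v2 s)) ->
  continuous v k ->
  (forall s, 0 <= s < k -> beta ^ 2 * v s <= v2 s) ->
  v 0 = 0 -> v1 0 = 0 -> 0 <= v k.
Proof.
  intros Hk D1 D2 Ck Hv H0 H1.
  assert (Du : forall s, 0 <= s < k ->
    is_derive (fun s => exp (- beta * s) * (v1 s + beta * v s)) s
      (exp (- beta * s) * (v2 s - beta ^ 2 * v s))).
  { intros s Hs. eapply is_derive_eq.
    apply is_derive_Rmult. apply is_derive_exp_lin.
    apply is_derive_Rplus. apply D2, Hs.
    apply is_derive_Rmult. apply is_derive_Rconst. apply D1, Hs.
    cbv beta. ring. }
  assert (Hu : forall s, 0 <= s < k -> 0 <= v1 s + beta * v s).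
  { intros s Hs.
    assert (E : exp (- beta * 0) * (v1 0 + beta * v 0) <= exp (- beta * s) * (v1 s + beta * v s)).
    { apply (increasing_ge (fun s => exp (- beta * s) * (v1 s + beta * v s))
        (fun s => exp (- beta * s) * (v2 s - beta ^ 2 * v s))). lra.
      - intros r Hr. eapply is_derive_continuous, Du. lra.
      - intros r Hr. apply Du. lra.
      - intros r Hr. apply Rmult_le_pos. apply Rlt_le, exp_pos.
        specialize (Hv r). lra. }
    rewrite H0, H1 in E.
    replace (exp (- beta * 0) * (0 + beta * 0)) with 0 in E by ring.
    pose proof (exp_pos (- beta * s)). nra. }
  assert (E : exp (beta * 0) * v 0 <= exp (beta * k) * v k).
  { apply (increasing_ge (fun s => exp (beta * s) * v s)
        (fun s => exp (beta * s) * (v1 s + beta * v s))). lra.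
    - intros s Hs. apply (continuous_mult (K := R_AbsRing)).
      + eapply is_derive_continuous, is_derive_exp_lin.
      + destruct (Req_dec s k) as [->|]. exact Ck.
        eapply is_derive_continuous, D1. lra.
    - intros s Hs. eapply is_derive_eq.
      apply is_derive_Rmult. apply is_derive_exp_lin. apply D1. lra. cbv beta. ring.
    - intros s Hs. apply Rmult_le_pos. apply Rlt_le, exp_pos. apply Hu. lra. }
  rewrite H0 in E. replace (exp (beta * 0) * 0) with 0 in E by ring. pose proof (exp_pos (beta * k)). nra.
Qed.

Lemma is_derive_cosh_lin (a x : R) : is_derive (fun u => cosh (a * u)) x (a * sinh (a * x)).
Proof.
  apply (is_derive_comp cosh (fun u => a * u)). apply is_derive_cosh.
  auto_derive; auto. ring.
Qed.

Lemma is_derive_sinh_lin (a x : R) : is_derive (fun u => sinh (a * u)) x (a * cosh (a * x)).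
Proof.
  apply (is_derive_comp sinh (fun u => a * u)). apply is_derive_sinh.
  auto_derive; auto. ring.
Qed.

(** [q] solves the equation with the exactly affine source and the initial data of [p]; [e] solves
    e'' = beta^2 (e + rho) with zero initial data. The comparison applies to both e - (p - q) and e
    + (p - q). *)
Lemma ode_affine_source (beta k w0 c rho : R) (p p1 p2 w : R -> R) :
  0 < beta -> 0 < k ->
  (forall s, 0 <= s < k -> is_derive p s (p1 s)) ->
  (forall s, 0 <= s < k -> is_derive p1 s (p2 s)) ->
  continuous p k ->
  (forall s, 0 <= s < k -> p2 s = beta ^ 2 * (p s - w s)) ->
  (forall s, 0 <= s < k -> Rabs (w s - w0 - c * s) <= rho) ->
  Rabs (p k - (w0 + c * k + (p 0 - w0) * cosh (beta * k) + (p1 0 - c) / beta * sinh (beta * k)))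
    <= rho * (cosh (beta * k) - 1).
Proof.
  intros Hb Hk D1 D2 Ck Hp Hw.
  set (q := fun s => w0 + c * s + (p 0 - w0) * cosh (beta * s) + (p1 0 - c) / beta * sinh (beta * s)).
  set (q1 := fun s => c + (p 0 - w0) * (beta * sinh (beta * s)) + (p1 0 - c) * cosh (beta * s)).
  set (q2 := fun s => (p 0 - w0) * (beta * (beta * cosh (beta * s))) + (p1 0 - c) * (beta * sinh (beta * s))).
  assert (Dq : forall s, is_derive q s (q1 s)).
  { intros s. unfold q, q1. eapply is_derive_eq.
    apply is_derive_Rplus. apply is_derive_Rplus. apply is_derive_Rplus.
    apply is_derive_Rconst. apply is_derive_Rmult. apply is_derive_Rconst. apply is_derive_Rid.
    apply is_derive_Rmult. apply is_derive_Rconst. apply is_derive_cosh_lin.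
    apply is_derive_Rmult. apply is_derive_Rconst. apply is_derive_sinh_lin.
    cbv beta. field. lra. }
  assert (Dq1 : forall s, is_derive q1 s (q2 s)).
  { intros s. unfold q1, q2. eapply is_derive_eq.
    apply is_derive_Rplus. apply is_derive_Rplus.
    apply is_derive_Rconst. apply is_derive_Rmult. apply is_derive_Rconst.
    apply is_derive_Rmult. apply is_derive_Rconst. apply is_derive_sinh_lin.
    apply is_derive_Rmult. apply is_derive_Rconst. apply is_derive_cosh_lin.
    cbv beta. ring. }
  set (e := fun s => rho * (cosh (beta * s) - 1)).
  set (e1 := fun s => rho * (beta * sinh (beta * s))).
  set (e2 := fun s => rho * (beta * (beta * cosh (beta * s)))).
  assert (De : forall s, is_derive e s (e1 s)).
  { intros s. unfold e, e1. eapply is_derive_eq.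
    apply is_derive_Rmult. apply is_derive_Rconst.
    apply is_derive_Rminus. apply is_derive_cosh_lin. apply is_derive_Rconst.
    cbv beta. ring. }
  assert (De1 : forall s, is_derive e1 s (e2 s)).
  { intros s. unfold e1, e2. eapply is_derive_eq.
    apply is_derive_Rmult. apply is_derive_Rconst.
    apply is_derive_Rmult. apply is_derive_Rconst. apply is_derive_sinh_lin.
    cbv beta. ring. }
  assert (Hq0 : q 0 = p 0).
  { unfold q. rewrite !Rmult_0_r, cosh_0, sinh_0. ring. }
  assert (Hq10 : q1 0 = p1 0).
  { unfold q1. rewrite !Rmult_0_r, cosh_0, sinh_0. ring. }
  assert (He0 : e 0 = 0) by (unfold e; rewrite Rmult_0_r, cosh_0; ring).
  assert (He10 : e1 0 = 0) by (unfold e1; rewrite Rmult_0_r, sinh_0; ring).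
  assert (Up : 0 <= e k - (p k - q k)).
  { apply (ode_comparison beta k (fun s => e s - (p s - q s)) (fun s => e1 s - (p1 s - q1 s))
      (fun s => e2 s - (p2 s - q2 s))); auto.
    - intros s Hs. apply is_derive_Rminus. apply De. apply is_derive_Rminus; auto.
    - intros s Hs. apply is_derive_Rminus. apply De1. apply is_derive_Rminus; auto.
    - apply (continuous_minus (V := R_NormedModule)). eapply is_derive_continuous, De.
      apply (continuous_minus (V := R_NormedModule)). exact Ck. eapply is_derive_continuous, Dq.
    - intros s Hs. rewrite Hp by auto. specialize (Hw s Hs).
      apply Rabs_le_between in Hw. unfold e, e2, q, q2.
      replace ((p1 0 - c) / beta * sinh (beta * s)) with ((p1 0 - c) * sinh (beta * s) / beta) by (field; lra).
      assert (beta ^ 2 * ((p1 0 - c) * sinh (beta * s) / beta) = beta * (p1 0 - c) * sinh (beta * s)) by (field; lra).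
      assert (0 <= beta ^ 2 * (rho + (w s - w0 - c * s))).
      { apply Rmult_le_pos. apply pow2_ge_0. lra. }
      nra.
    - rewrite Hq0, He0. ring.
    - rewrite Hq10, He10. ring. }
  assert (Lo : 0 <= e k + (p k - q k)).
  { apply (ode_comparison beta k (fun s => e s + (p s - q s)) (fun s => e1 s + (p1 s - q1 s))
      (fun s => e2 s + (p2 s - q2 s))); auto.
    - intros s Hs. apply is_derive_Rplus. apply De. apply is_derive_Rminus; auto.
    - intros s Hs. apply is_derive_Rplus. apply De1. apply is_derive_Rminus; auto.
    - apply (continuous_plus (V := R_NormedModule)). eapply is_derive_continuous, De.
      apply (continuous_minus (V := R_NormedModule)). exact Ck. eapply is_derive_continuous, Dq.
    - intros s Hs. rewrite Hp by auto. specialize (Hw s Hs).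
      apply Rabs_le_between in Hw. unfold e, e2, q, q2.
      replace ((p1 0 - c) / beta * sinh (beta * s)) with ((p1 0 - c) * sinh (beta * s) / beta) by (field; lra).
      assert (beta ^ 2 * ((p1 0 - c) * sinh (beta * s) / beta) = beta * (p1 0 - c) * sinh (beta * s)) by (field; lra).
      assert (0 <= beta ^ 2 * (rho - (w s - w0 - c * s))).
      { apply Rmult_le_pos. apply pow2_ge_0. lra. }
      nra.
    - rewrite Hq0, He0. ring.
    - rewrite Hq10, He10. ring. }
  apply Rabs_le_between. fold (q k). fold (e k). lra.
Qed.

(** After division by sinh (beta k) the unknown slope [p1 0] carries the coefficient 1 / beta
    whatever [k] is, so it cancels when the two cells at a node are added. *)
Lemma one_sided_difference (beta k w0 c rho : R) (p p1 p2 w : R -> R) :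
  0 < beta -> 0 < k ->
  (forall s, 0 <= s < k -> is_derive p s (p1 s)) ->
  (forall s, 0 <= s < k -> is_derive p1 s (p2 s)) ->
  continuous p k ->
  (forall s, 0 <= s < k -> p2 s = beta ^ 2 * (p s - w s)) ->
  (forall s, 0 <= s < k -> Rabs (w s - w0 - c * s) <= rho) ->
  Rabs (hyp_s (beta * k) * (p k - p 0)
     - ((p 0 - w0) * hyp_d (beta * k) + (p1 0 - c) / beta + c * (k * hyp_s (beta * k))))
    <= rho * hyp_d (beta * k).
Proof.
  intros Hb Hk D1 D2 Ck Hp Hw.
  pose proof (ode_affine_source beta k w0 c rho p p1 p2 w Hb Hk D1 D2 Ck Hp Hw) as H.
  assert (HZ : 0 < beta * k) by nra.
  pose proof (sinh_pos _ HZ) as Hs.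
  replace (rho * hyp_d (beta * k)) with (hyp_s (beta * k) * (rho * (cosh (beta * k) - 1)))
    by (unfold hyp_s, hyp_d; field; lra).
  match goal with |- Rabs ?A <= _ => replace A with (hyp_s (beta * k) *
    (p k - (w0 + c * k + (p 0 - w0) * cosh (beta * k) + (p1 0 - c) / beta * sinh (beta * k)))) end.
  2: { unfold hyp_s, hyp_d. field. lra. }
  rewrite Rabs_mult, (Rabs_pos_eq (hyp_s _)) by (apply Rlt_le, hyp_s_pos, HZ).
  apply Rmult_le_compat_l. apply Rlt_le, hyp_s_pos, HZ. exact H.
Qed.

(** With an exactly affine source and equal cells nothing remains. On unequal cells the slope c
    leaves the differences of z [hyp_s z] and z [hyp_d z] between the two cells; their Lipschitz
    constants supply the factors 1 and 2 that add up to 3. The part without [tau] and the part with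
    it contribute one [rho] each. *)
Lemma truncation_error (beta h k x c rho tau : R) (y y1 y2 w : R -> R) :
  0 < beta -> 0 < h -> 0 < k -> 0 <= tau <= 1 ->
  (forall s, x - h < s < x + k -> is_derive y s (y1 s)) ->
  (forall s, x - h < s < x + k -> is_derive y1 s (y2 s)) ->
  continuous y (x - h) -> continuous y (x + k) ->
  (forall s, x - h < s < x + k -> y2 s = beta ^ 2 * (y s - w s)) ->
  (forall s, x - h <= s <= x + k -> Rabs (w s - w x - c * (s - x)) <= rho) ->
  Rabs (hyp_s (beta * h) * (y (x - h) - y x) + hyp_s (beta * k) * (y (x + k) - y x)
     - (y x - w x) * (hyp_d (beta * h) + hyp_d (beta * k))
     + tau * (hyp_d (beta * h) * (w (x - h) - w x) + hyp_d (beta * k) * (w (x + k) - w x)))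
  <= (hyp_d (beta * h) + hyp_d (beta * k)) * (3 * Rabs c * Rabs (k - h) + 2 * rho).
Proof.
  intros Hb Hh Hk Ht D1 D2 Cl Cr Hy Hw.
  assert (Hz : 0 < beta * h) by nra. assert (HZ : 0 < beta * k) by nra.
  pose proof (hyp_d_pos _ Hz) as Pd. pose proof (hyp_d_pos _ HZ) as PD.
  assert (R1 := one_sided_difference beta k (w x) c rho (fun s => y (x + s)) (fun s => y1 (x + s))
     (fun s => y2 (x + s)) (fun s => w (x + s)) Hb Hk).
  (* The left cell is a right cell for the reflected function, with slope - c. *)
  assert (R2 := one_sided_difference beta h (w x) (- c) rho (fun s => y (x - s)) (fun s => - y1 (x - s))
     (fun s => y2 (x - s)) (fun s => w (x - s)) Hb Hh).
  cbv beta in R1, R2. rewrite Rplus_0_r in R1. rewrite Rminus_0_r in R2.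
  lapply R1; [clear R1; intros R1|].
  2: { intros s Hs. eapply is_derive_eq.
       apply (is_derive_comp y (fun s => x + s)). apply D1; lra.
       apply is_derive_Rplus. apply is_derive_Rconst. apply is_derive_Rid.
       unfold scal; simpl; unfold mult; simpl; ring. }
  lapply R1; [clear R1; intros R1|].
  2: { intros s Hs. eapply is_derive_eq.
       apply (is_derive_comp y1 (fun s => x + s)). apply D2; lra.
       apply is_derive_Rplus. apply is_derive_Rconst. apply is_derive_Rid.
       unfold scal; simpl; unfold mult; simpl; ring. }
  lapply R1; [clear R1; intros R1|].
  2: { apply (continuous_comp (fun s => x + s) y). 2: exact Cr.
       apply (continuous_plus (V := R_NormedModule)). apply continuous_const. apply continuous_id. }
  lapply R1; [clear R1; intros R1|].
  2: { intros s Hs. apply Hy. lra. }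
  lapply R1; [clear R1; intros R1|].
  2: { intros s Hs. replace (c * s) with (c * (x + s - x)) by ring. apply Hw. lra. }
  lapply R2; [clear R2; intros R2|].
  2: { intros s Hs. eapply is_derive_eq.
       apply (is_derive_comp y (fun s => x - s)). apply D1; lra.
       apply is_derive_Rminus. apply is_derive_Rconst. apply is_derive_Rid.
       unfold scal; simpl; unfold mult; simpl; ring. }
  lapply R2; [clear R2; intros R2|].
  2: { intros s Hs. eapply is_derive_eq.
       apply (is_derive_opp (V := R_NormedModule)).
       apply (is_derive_comp y1 (fun s => x - s)). apply D2; lra.
       apply is_derive_Rminus. apply is_derive_Rconst. apply is_derive_Rid.
       unfold opp, scal; simpl; unfold mult; simpl; ring. }
  lapply R2; [clear R2; intros R2|].
  2: { apply (continuous_comp (fun s => x - s) y). 2: exact Cl.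
       apply (continuous_minus (V := R_NormedModule)). apply continuous_const. apply continuous_id. }
  lapply R2; [clear R2; intros R2|].
  2: { intros s Hs. apply Hy. lra. }
  lapply R2; [clear R2; intros R2|].
  2: { intros s Hs. replace (- c * s) with (c * (x - s - x)) by ring. apply Hw. lra. }
  pose proof (Hw (x - h)) as Wl. pose proof (Hw (x + k)) as Wr.
  replace (x - h - x) with (- h) in Wl by ring. replace (x + k - x) with k in Wr by ring.
  assert (Wl' := Wl ltac:(lra)). assert (Wr' := Wr ltac:(lra)). clear Wl Wr.
  pose proof (id_hyp_s_lipschitz _ _ Hz HZ) as Ls.
  pose proof (id_hyp_d_lipschitz _ _ Hz HZ) as Ld.
  set (s := hyp_s (beta * h)) in *. set (S := hyp_s (beta * k)) in *.
  set (d := hyp_d (beta * h)) in *. set (D := hyp_d (beta * k)) in *.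
  assert (Ls' : Rabs (k * S - h * s) <= (d + D) * Rabs (k - h)).
  { apply Rmult_le_reg_l with beta; auto.
    rewrite <- (Rabs_pos_eq beta) at 1 by lra. rewrite <- Rabs_mult.
    replace (beta * (k * S - h * s)) with (beta * k * S - beta * h * s) by ring.
    eapply Rle_trans. exact Ls.
    replace (beta * k - beta * h) with (beta * (k - h)) by ring.
    rewrite Rabs_mult, (Rabs_pos_eq beta) by lra. apply Req_le. ring. }
  assert (Ld' : Rabs (k * D - h * d) <= 2 * (d + D) * Rabs (k - h)).
  { apply Rmult_le_reg_l with beta; auto.
    rewrite <- (Rabs_pos_eq beta) at 1 by lra. rewrite <- Rabs_mult.
    replace (beta * (k * D - h * d)) with (beta * k * D - beta * h * d) by ring.
    eapply Rle_trans. exact Ld.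
    replace (beta * k - beta * h) with (beta * (k - h)) by ring.
    rewrite Rabs_mult, (Rabs_pos_eq beta) by lra. apply Req_le. ring. }
  clear Ls Ld.
  assert (C1 : Rabs (c * (k * S - h * s)) <= Rabs c * ((d + D) * Rabs (k - h))).
  { rewrite Rabs_mult. apply Rmult_le_compat_l. apply Rabs_pos. exact Ls'. }
  assert (C2 : Rabs (c * (k * D - h * d)) <= Rabs c * (2 * (d + D) * Rabs (k - h))).
  { rewrite Rabs_mult. apply Rmult_le_compat_l. apply Rabs_pos. exact Ld'. }
  assert (T1 : Rabs (d * (w (x - h) - w x - c * - h)) <= d * rho).
  { rewrite Rabs_mult, (Rabs_pos_eq d) by lra. apply Rmult_le_compat_l; lra. }
  assert (T2 : Rabs (D * (w (x + k) - w x - c * k)) <= D * rho).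
  { rewrite Rabs_mult, (Rabs_pos_eq D) by lra. apply Rmult_le_compat_l; lra. }
  assert (First : Rabs (s * (y (x - h) - y x) + S * (y (x + k) - y x) - (y x - w x) * (d + D))
     <= (d + D) * (Rabs c * Rabs (k - h) + rho)).
  { replace ((d + D) * (Rabs c * Rabs (k - h) + rho)) with
      (rho * d + rho * D + Rabs c * ((d + D) * Rabs (k - h))) by ring.
    replace ((- y1 x - - c) / beta) with (- ((y1 x - c) / beta)) in R2 by (field; lra).
    apply Rabs_le_between in R1. apply Rabs_le_between in R2. apply Rabs_le_between in C1.
    apply Rabs_le_between. lra. }
  assert (Second : Rabs (d * (w (x - h) - w x) + D * (w (x + k) - w x))
     <= (d + D) * (2 * Rabs c * Rabs (k - h) + rho)).
  { apply Rabs_le_between in T1. apply Rabs_le_between in T2. apply Rabs_le_between in C2.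
    apply Rabs_le_between. lra. }
  assert (Third : Rabs (tau * (d * (w (x - h) - w x) + D * (w (x + k) - w x)))
     <= (d + D) * (2 * Rabs c * Rabs (k - h) + rho)).
  { rewrite Rabs_mult, (Rabs_pos_eq tau) by lra.
    pose proof (Rabs_pos (d * (w (x - h) - w x) + D * (w (x + k) - w x))). nra. }
  apply Rabs_le_between in First. apply Rabs_le_between in Third.
  apply Rabs_le_between. lra.
Qed.

(** * Functions on the slab *)

(** The hypotheses are relative to the closed interval. Composition with this 1-Lipschitz retraction
    gives globally continuous functions that agree with the given ones on [0, 1], and the ordinary
    theorems apply to them. *)
Definition clamp (x : R) : R := Rmax 0 (Rmin x 1).

Lemma clamp_unit (x : R) : unit_itv (clamp x).
Proof.
  unfold unit_itv, clamp. split. apply Rmax_l.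
  apply Rmax_lub. lra. apply Rmin_r.
Qed.

Lemma clamp_id (x : R) : unit_itv x -> clamp x = x.
Proof.
  unfold unit_itv, clamp. intros H. rewrite Rmin_left, Rmax_right; lra.
Qed.

Lemma clamp_lipschitz (x z : R) : Rabs (clamp z - clamp x) <= Rabs (z - x).
Proof.
  unfold clamp, Rmax, Rmin.
  repeat destruct Rle_dec; unfold Rabs; repeat destruct Rcase_abs; lra.
Qed.

Lemma clamp_continuous (x : R) : continuous clamp x.
Proof.
  apply filterlim_locally. intros eps. exists eps. intros z Hz.
  eapply Rle_lt_trans. apply clamp_lipschitz. exact Hz.
Qed.

Lemma continuous_on_unit_clamp (y : R -> R) :
  continuous_on unit_itv y -> forall x, continuous (fun s => y (clamp s)) x.
Proof.
  intros H x. unfold continuous.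
  apply (filterlim_comp _ _ _ clamp y _ (within unit_itv (locally (clamp x)))).
  2: apply H, clamp_unit.
  intros P HP. pose proof (clamp_continuous x _ HP) as Q.
  change (locally x (fun s => P (clamp s))). revert Q.
  apply (filter_imp (F := locally x)). intros s Hs. apply Hs, clamp_unit.
Qed.

Lemma continuous_on_slab_clamp (g : R -> R -> R) :
  continuous_on slab (fun p : R * R => g (fst p) (snd p)) ->
  forall p : R * R, continuous (fun p : R * R => g (clamp (fst p)) (snd p)) p.
Proof.
  intros H p. unfold continuous.
  apply (filterlim_comp _ _ _ (fun p : R * R => (clamp (fst p), snd p))
     (fun p : R * R => g (fst p) (snd p)) _ (within slab (locally (clamp (fst p), snd p)))).
  2: apply (H (clamp (fst p), snd p)), clamp_unit.
  intros P HP.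
  assert (C : continuous (fun p : R * R => (clamp (fst p), snd p)) p).
  { apply filterlim_locally. intros eps. exists eps. intros q [H1 H2]. split; simpl.
    eapply Rle_lt_trans. apply clamp_lipschitz. exact H1. exact H2. }
  specialize (C _ HP).
  change (locally p (fun q : R * R => P (clamp (fst q), snd q))). revert C.
  apply (filter_imp (F := locally p)). intros s Hs. apply Hs. apply clamp_unit.
Qed.

Lemma continuous_slab_path (g : R -> R -> R) (z v : R -> R) (s : R) :
  continuous_on slab (fun p : R * R => g (fst p) (snd p)) ->
  (forall r, unit_itv (z r)) ->
  continuous z s -> continuous v s -> continuous (fun r => g (z r) (v r)) s.
Proof.
  intros Hg Hz Cz Cv.
  apply (continuous_ext (fun r => g (clamp (z r)) (v r))).
  { intros r. rewrite clamp_id; auto. }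
  apply (continuous_comp_2 z v (fun a b => g (clamp a) b) s Cz Cv).
  apply (continuous_on_slab_clamp g Hg).
Qed.

(** Compactness bounds the radii of a gauge from below at suitable tags. Capping the radius at a
    point by 1 / (|g| + 1) turns this lower bound d into the upper bound 1 / d for |g| at the tags,
    and within one radius g varies by less than 1. *)
Lemma slab_bounded (g : R -> R -> R) (Y : R) :
  continuous_on slab (fun p : R * R => g (fst p) (snd p)) ->
  exists M, 0 < M /\ forall x v, unit_itv x -> - Y <= v <= Y -> Rabs (g x v) <= M.
Proof.
  intros Hg.
  pose proof (continuous_on_slab_clamp g Hg) as C.
  assert (L : forall u v : R, {d : posreal | forall x z, Rabs (x - u) < d -> Rabs (z - v) < d ->
     Rabs (g (clamp x) z - g (clamp u) v) < 1}).
  { intros u v. apply constructive_indefinite_description.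
    specialize (C (u, v)). apply (proj1 (filterlim_locally _ _)) with (eps := mkposreal 1 Rlt_0_1) in C.
    destruct C as [d Hd]. exists d. intros x z Hx Hz. apply (Hd (x, z)). split; assumption. }
  assert (P : forall u v, 0 < Rmin (proj1_sig (L u v)) (/ (Rabs (g (clamp u) v) + 1))).
  { intros u v. apply Rmin_glb_lt. apply cond_pos. apply Rinv_0_lt_compat.
    pose proof (Rabs_pos (g (clamp u) v)). lra. }
  destruct (compactness_value_2d 0 1 (- Y) Y (fun u v => mkposreal _ (P u v))) as [d Hd].
  exists (/ d + 1). split.
  { pose proof (Rinv_0_lt_compat d (cond_pos d)). lra. }
  intros x v Hx Hv. apply NNPP. intros N.
  apply (Hd x v Hx Hv). intros (u & z & Hu & Hz & H1 & H2 & H3). apply N. simpl in H1, H2, H3.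
  destruct (L u z) as [r B]. simpl in H1, H2, H3. specialize (B x v).
  rewrite (clamp_id x Hx), (clamp_id u Hu) in B. rewrite (clamp_id u Hu) in H1, H2, H3.
  pose proof (Rmin_l r (/ (Rabs (g u z) + 1))).
  pose proof (Rmin_r r (/ (Rabs (g u z) + 1))).
  assert (B' := B ltac:(lra) ltac:(lra)).
  assert (Rabs (g u z) + 1 <= / d).
  { rewrite <- (Rinv_inv (Rabs (g u z) + 1)). apply Rinv_le_contravar. apply cond_pos. lra. }
  pose proof (Rabs_triang_inv (g x v) (g u z)). lra.
Qed.

(** One order of [Ck_slab] in the form used for calculus: the x-derivative is two-sided, hence
    confined to the open strip, while all three functions stay continuous up to the boundary. *)
Record C1_slab (g gx gy : R -> R -> R) : Prop := {
  C1_cont : continuous_on slab (fun p : R * R => g (fst p) (snd p));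
  C1_dx : forall x v, 0 < x < 1 -> is_derive (fun s => g s v) x (gx x v);
  C1_dy : forall x v, unit_itv x -> is_derive (fun w => g x w) v (gy x v);
  C1_cont_x : continuous_on slab (fun p : R * R => gx (fst p) (snd p));
  C1_cont_y : continuous_on slab (fun p : R * R => gy (fst p) (snd p)) }.

Lemma locally_unit_itv (x : R) : 0 < x < 1 -> locally x (fun s => 0 < s < 1).
Proof.
  intros H. assert (P : 0 < Rmin x (1 - x)) by (apply Rmin_glb_lt; lra).
  exists (mkposreal _ P). intros s Hs.
  change (Rabs (s - x) < Rmin x (1 - x)) in Hs.
  pose proof (Rmin_l x (1 - x)). pose proof (Rmin_r x (1 - x)).
  apply Rabs_lt_between in Hs. lra.
Qed.

Lemma is_derive_of_within (g : R -> R) (x l : R) : 0 < x < 1 ->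
  filterdiff g (within unit_itv (locally x)) (fun d => scal d l) -> is_derive g x l.
Proof.
  intros Hx [Hl Hd]. split. exact Hl.
  intros z Hz.
  assert (E : x = z) by (apply (is_filter_lim_locally_unique _ _ Hz)).
  subst z. intros eps.
  assert (L : is_filter_lim (within unit_itv (locally x)) x).
  { intros P HP. unfold within. revert HP. apply filter_imp. auto. }
  specialize (Hd x L eps).
  unfold within in Hd. pose proof (locally_unit_itv x Hx) as U.
  generalize (filter_and _ _ Hd U). apply filter_imp.
  intros s [Hs Hu]. apply Hs. unfold unit_itv. lra.
Qed.

Lemma Ck_slab_cont (k : nat) (g : R -> R -> R) :
  Ck_slab k g -> continuous_on slab (fun p : R * R => g (fst p) (snd p)).
Proof. destruct k; intros [H _]; exact H. Qed.

Lemma Ck_slab_S (k : nat) (g : R -> R -> R) :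
  Ck_slab (S k) g -> exists gx gy, C1_slab g gx gy /\ Ck_slab k gx /\ Ck_slab k gy.
Proof.
  intros [Hc (gx & gy & Hd & Hx & Hy)]. exists gx, gy. split; [|split; assumption].
  constructor.
  - exact Hc.
  - intros x v H. apply is_derive_of_within. exact H. apply Hd. unfold unit_itv; lra.
  - intros x v H. apply Hd, H.
  - exact (Ck_slab_cont k gx Hx).
  - exact (Ck_slab_cont k gy Hy).
Qed.

(** The x-partial on a neighbourhood, continuous at the point, together with the y-partial at the
    point gives a total differential, to which the chain rule applies. *)
Lemma C1_slab_chain (g gx gy : R -> R -> R) (z v : R -> R) (s z1 v1 : R) :
  C1_slab g gx gy -> 0 < z s < 1 ->
  is_derive z s z1 -> is_derive v s v1 ->
  is_derive (fun r => g (z r) (v r)) s (gx (z s) (v s) * z1 + gy (z s) (v s) * v1).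
Proof.
  intros Hg Hz Dz Dv.
  assert (F : filterdiff (fun u : R * R => g (fst u) (snd u)) (locally (z s, v s))
     (fun u : R * R => plus (scal (fst u) (gx (z s) (v s))) (scal (snd u) (gy (z s) (v s))))).
  { apply is_derive_filterdiff.
    - destruct (locally_unit_itv _ Hz) as [d Hd]. exists d. intros u [Hu _].
      apply (C1_dx _ _ _ Hg). apply Hd. exact Hu.
    - apply (C1_dy _ _ _ Hg). unfold unit_itv. lra.
    - pose proof (continuous_on_slab_clamp gx (C1_cont_x _ _ _ Hg) (z s, v s)) as C.
      unfold continuous in *. simpl in *. rewrite clamp_id in C by (unfold unit_itv; lra).
      apply filterlim_ext_loc with (2 := C).
      destruct (locally_unit_itv _ Hz) as [d Hd]. exists d. intros u [Hu _].
      destruct (Hd _ Hu) as [A B]. rewrite clamp_id. reflexivity.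
      split; apply Rlt_le; assumption. }
  pose proof (filterdiff_comp'_2 z v g s _ _
    (fun a b : R => plus (scal a (gx (z s) (v s))) (scal b (gy (z s) (v s)))) Dz Dv F) as H.
  unfold is_derive. eapply filterdiff_ext_lin. exact H.
  intros u. simpl. unfold plus, scal; simpl; unfold mult; simpl. ring.
Qed.

(** * A priori bounds *)

(** If [g2] were positive, [g1] would be positive just to the right of [x], and the mean value
    theorem would make g larger there. [g1] is differentiated at [x] alone. *)
Lemma second_derivative_test (g g1 : R -> R) (a b x g2 : R) :
  a < x < b ->
  (forall s, a < s < b -> is_derive g s (g1 s)) ->
  is_derive g1 x g2 ->
  (forall s, a < s < b -> g s <= g x) ->
  g1 x = 0 /\ g2 <= 0.
Proof.
  intros Hx D1 D2 Hmax.
  assert (Z : g1 x = 0).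
  { pose proof (D1 x Hx) as D. apply is_derive_Reals in D.
    rewrite <- (derive_pt_eq_0 g x (g1 x) (exist _ (g1 x) D) D).
    apply deriv_maximum with a b; try lra. intros s Hs1 Hs2. apply Hmax. lra. }
  split. exact Z.
  apply Rnot_lt_le. intros P.
  apply is_derive_Reals in D2.
  destruct (D2 (g2 / 2)) as [d Hd]. lra.
  set (r := Rmin (d / 2) ((b - x) / 2)).
  assert (Hr : 0 < r).
  { apply Rmin_glb_lt. pose proof (cond_pos d). lra. lra. }
  pose proof (Rmin_l (d / 2) ((b - x) / 2)). pose proof (Rmin_r (d / 2) ((b - x) / 2)).
  fold r in H, H0. pose proof (cond_pos d).
  destruct (MVT_interior g g1 x (x + r)) as [c [Hc E]]. lra.
  { intros s Hs. eapply is_derive_continuous, D1. lra. }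
  { intros s Hs. apply D1. lra. }
  assert (g (x + r) <= g x) by (apply Hmax; lra).
  specialize (Hd (c - x)). rewrite Z in Hd.
  replace (x + (c - x)) with c in Hd by ring.
  assert (Hd' := Hd ltac:(lra) ltac:(rewrite Rabs_pos_eq; lra)). clear Hd.
  apply Rabs_lt_between in Hd'.
  assert (E1 : (g1 c - 0) / (c - x) * (c - x) = g1 c) by (field; lra).
  assert (0 < g1 c) by (rewrite <- E1; apply Rmult_lt_0_compat; lra).
  assert (0 < g1 c * (x + r - x)) by (apply Rmult_lt_0_compat; lra).
  lra.
Qed.

Lemma continuous_has_max (g : R -> R) (a b : R) : a <= b ->
  (forall x, a <= x <= b -> continuous g x) ->
  exists x, a <= x <= b /\ forall s, a <= s <= b -> g s <= g x.
Proof.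
  intros Hab Hc. destruct (continuity_ab_maj g a b Hab) as [x [Hx Hx']].
  - intros s Hs. apply continuity_pt_filterlim, Hc, Hs.
  - exists x. auto.
Qed.

Lemma MVT_unordered (g g1 : R -> R) (a b : R) :
  a <> b ->
  (forall x, Rmin a b <= x <= Rmax a b -> continuous g x) ->
  (forall x, Rmin a b < x < Rmax a b -> is_derive g x (g1 x)) ->
  exists c, Rmin a b < c < Rmax a b /\ g b - g a = g1 c * (b - a).
Proof.
  intros Hne Hc Hd. destruct (Rlt_dec a b) as [L|L].
  - rewrite Rmin_left, Rmax_right in * by lra. apply MVT_interior; auto.
  - rewrite Rmin_right, Rmax_left in * by lra.
    destruct (MVT_interior g g1 b a) as [c [H E]]; auto. lra.
    exists c. split. exact H. lra.
Qed.

(** * Layer functions and the extended solution *)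

Definition layer (a x : R) : R := exp (- a * x) + exp (- a * (1 - x)).

Lemma layer_pos (a x : R) : 0 < layer a x.
Proof. unfold layer. pose proof (exp_pos (- a * x)). pose proof (exp_pos (- a * (1 - x))). lra. Qed.

Lemma exp_le_1 (x : R) : x <= 0 -> exp x <= 1.
Proof. intros H. rewrite <- exp_0. destruct H as [H| ->]. left; apply exp_increasing, H. right; reflexivity. Qed.

Lemma exp_le (x z : R) : x <= z -> exp x <= exp z.
Proof. intros [H| ->]. left; apply exp_increasing, H. right; reflexivity. Qed.

Lemma layer_le_2 (a x : R) : 0 <= a -> 0 <= x <= 1 -> layer a x <= 2.
Proof.
  intros Ha Hx. unfold layer.
  pose proof (exp_le_1 (- a * x)). pose proof (exp_le_1 (- a * (1 - x))).
  assert (- a * x <= 0) by nra. assert (- a * (1 - x) <= 0) by nra. lra.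
Qed.

(** The factor exp (a r) is a constant in both uses: r = eps, where a eps = sqrt m, and r = H, where
    a H <= 8. *)
Lemma layer_shift (a x z r : R) : 0 <= a -> Rabs (z - x) <= r ->
  layer a z <= exp (a * r) * layer a x.
Proof.
  intros Ha H. apply Rabs_le_between in H. unfold layer.
  rewrite Rmult_plus_distr_l, <- !exp_plus.
  apply Rplus_le_compat; apply exp_le; nra.
Qed.

Definition layer1 (a x : R) : R := - a * exp (- a * x) + a * exp (- a * (1 - x)).

Lemma is_derive_exp_reflected (a x : R) :
  is_derive (fun u => exp (- a * (1 - u))) x (a * exp (- a * (1 - x))).
Proof.
  eapply is_derive_eq. apply (is_derive_comp exp (fun u => - a * (1 - u))).
  apply is_derive_exp. apply is_derive_Rmult. apply is_derive_Rconst.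
  apply is_derive_Rminus. apply is_derive_Rconst. apply is_derive_Rid.
  unfold scal; simpl; unfold mult; simpl. ring.
Qed.

Lemma is_derive_layer (a x : R) : is_derive (layer a) x (layer1 a x).
Proof. apply is_derive_Rplus. apply is_derive_exp_lin. apply is_derive_exp_reflected. Qed.

Lemma is_derive_layer1 (a x : R) : is_derive (layer1 a) x (a ^ 2 * layer a x).
Proof.
  eapply is_derive_eq. apply is_derive_Rplus.
  apply is_derive_Rmult. apply is_derive_Rconst. apply is_derive_exp_lin.
  apply is_derive_Rmult. apply is_derive_Rconst. apply is_derive_exp_reflected.
  unfold layer. cbv beta. ring.
Qed.

(* [y] is extended by constants outside [0, 1], which makes it continuous on all of R. *)
Record extended_solution (f : R -> R -> R) (eps : R) (y y1 : R -> R) : Prop := {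
  es_cont : forall x, continuous y x;
  es_d1 : forall x, 0 < x < 1 -> is_derive y x (y1 x);
  es_d2 : forall x, 0 < x < 1 -> is_derive y1 x (f x (y x) / eps ^ 2);
  es_0 : y 0 = 0;
  es_1 : y 1 = 0 }.

Lemma bvp_extended_solution (f : R -> R -> R) (eps : R) (y : R -> R) :
  0 < eps -> bvp_solution f eps y ->
  extended_solution f eps (fun x => y (clamp x)) (Derive y).
Proof.
  intros He (Hc & Hd & H0 & H1).
  assert (Loc : forall x, 0 < x < 1 -> locally x (fun s => y s = y (clamp s))).
  { intros x Hx. generalize (locally_unit_itv x Hx). apply filter_imp.
    intros s Hs. rewrite clamp_id. reflexivity. unfold unit_itv. lra. }
  constructor.
  - apply continuous_on_unit_clamp, Hc.
  - intros x Hx. apply (is_derive_ext_loc y). apply Loc, Hx.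
    apply Derive_correct, Hd, Hx.
  - intros x Hx. destruct (Hd x Hx) as (_ & D & E).
    rewrite clamp_id by (unfold unit_itv; lra).
    replace (f x (y x) / eps ^ 2) with (Derive (Derive y) x).
    apply Derive_correct, D.
    change (Derive_n y 2 x) with (Derive (Derive y) x) in E.
    apply Rmult_eq_reg_l with (eps ^ 2). 2: nra. field_simplify; nra.
  - rewrite clamp_id; auto. unfold unit_itv; lra.
  - rewrite clamp_id; auto. unfold unit_itv; lra.
Qed.

Section Apriori.

(** [Y] is such that |f(x, 0)| <= m Y, which by monotonicity confines the zeros of f(x, .), and then
    every solution, to [- Y, Y]. The bounds by [L] hold on this compact strip only, whereas those on
    f_y are global. *)
Context (f fx fy fxx fxy fyx fyy : R -> R -> R) (m gamma Y L : R).
Context (Hf : C1_slab f fx fy) (Hfx : C1_slab fx fxx fxy) (Hfy : C1_slab fy fyx fyy).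
Context (Hm : 0 < m) (HY : 0 <= Y) (HL : 0 <= L).
Context (Hfy_lo : forall x v, unit_itv x -> m <= fy x v).
Context (Hfy_hi : forall x v, unit_itv x -> fy x v <= gamma).
Context (Hf0 : forall x, unit_itv x -> Rabs (f x 0) <= m * Y).
Context (Bx : forall x v, unit_itv x -> - Y <= v <= Y -> Rabs (fx x v) <= L).
Context (Bxx : forall x v, unit_itv x -> - Y <= v <= Y -> Rabs (fxx x v) <= L).
Context (Bxy : forall x v, unit_itv x -> - Y <= v <= Y -> Rabs (fxy x v) <= L).
Context (Byx : forall x v, unit_itv x -> - Y <= v <= Y -> Rabs (fyx x v) <= L).
Context (Byy : forall x v, unit_itv x -> - Y <= v <= Y -> Rabs (fyy x v) <= L).

Lemma unit_interior (x : R) : 0 < x < 1 -> unit_itv x.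
Proof. unfold unit_itv. lra. Qed.

Lemma f_increments (x v1 v2 : R) : unit_itv x -> v1 <= v2 ->
  m * (v2 - v1) <= f x v2 - f x v1 <= gamma * (v2 - v1).
Proof.
  intros Hx [Hv| ->]. 2: lra.
  destruct (MVT_interior (f x) (fy x) v1 v2 Hv) as [c [_ E]].
  - intros v _. eapply is_derive_continuous, (C1_dy _ _ _ Hf x v Hx).
  - intros v _. apply (C1_dy _ _ _ Hf x v Hx).
  - rewrite E. pose proof (Hfy_lo x c Hx). pose proof (Hfy_hi x c Hx).
    split; apply Rmult_le_compat_r; lra.
Qed.

Lemma f_increments_abs (x v1 v2 : R) : unit_itv x ->
  m * Rabs (v2 - v1) <= Rabs (f x v2 - f x v1).
Proof.
  intros Hx. destruct (Rle_dec v1 v2) as [L1|L1].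
  - pose proof (f_increments x v1 v2 Hx L1). rewrite !Rabs_pos_eq; nra.
  - pose proof (f_increments x v2 v1 Hx). rewrite !Rabs_left1; nra.
Qed.

Lemma f_pos_gt (x v : R) : unit_itv x -> 0 < f x v -> - Y < v.
Proof.
  intros Hx H. apply Rnot_le_lt. intros N.
  pose proof (f_increments x v 0 Hx). pose proof (Hf0 x Hx) as B.
  apply Rabs_le_between in B. nra.
Qed.

Lemma f_neg_lt (x v : R) : unit_itv x -> f x v < 0 -> v < Y.
Proof.
  intros Hx H. apply Rnot_le_lt. intros N.
  pose proof (f_increments x 0 v Hx). pose proof (Hf0 x Hx) as B.
  apply Rabs_le_between in B. nra.
Qed.

Lemma f_nonpos_le (x v : R) : unit_itv x -> f x v <= 0 -> v <= Y.
Proof.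
  intros Hx H. apply Rnot_lt_le. intros N.
  pose proof (f_increments x 0 v Hx). pose proof (Hf0 x Hx) as B.
  apply Rabs_le_between in B. nra.
Qed.

Lemma f_nonneg_ge (x v : R) : unit_itv x -> 0 <= f x v -> - Y <= v.
Proof.
  intros Hx H. apply Rnot_lt_le. intros N.
  pose proof (f_increments x v 0 Hx). pose proof (Hf0 x Hx) as B.
  apply Rabs_le_between in B. nra.
Qed.

Lemma along_curve_d1 (v v1 : R -> R) (s : R) : 0 < s < 1 ->
  is_derive v s (v1 s) ->
  is_derive (fun r => f r (v r)) s (fx s (v s) + fy s (v s) * v1 s).
Proof.
  intros Hs Dv. eapply is_derive_eq.
  apply (C1_slab_chain f fx fy (fun r => r) v s 1 (v1 s) Hf Hs). apply is_derive_Rid. exact Dv.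
  ring.
Qed.

Lemma along_curve_d2 (v v1 : R -> R) (s v2 : R) : 0 < s < 1 ->
  is_derive v s (v1 s) -> is_derive v1 s v2 ->
  is_derive (fun r => fx r (v r) + fy r (v r) * v1 r) s
    (fxx s (v s) + (fxy s (v s) + fyx s (v s)) * v1 s + fyy s (v s) * v1 s ^ 2 + fy s (v s) * v2).
Proof.
  intros Hs Dv Dv1. eapply is_derive_eq.
  apply is_derive_Rplus.
  apply (C1_slab_chain fx fxx fxy (fun r => r) v s 1 (v1 s) Hfx Hs). apply is_derive_Rid. exact Dv.
  apply is_derive_Rmult. 2: exact Dv1.
  apply (C1_slab_chain fy fyx fyy (fun r => r) v s 1 (v1 s) Hfy Hs). apply is_derive_Rid. exact Dv.
  cbv beta. ring.
Qed.

(** At an interior maximum y'' <= 0, so f <= 0 there and monotonicity in y puts the value below [Y].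
    The minimum is symmetric. *)
Lemma solution_bounded (eps : R) (y y1 : R -> R) : 0 < eps ->
  extended_solution f eps y y1 -> forall x, unit_itv x -> - Y <= y x <= Y.
Proof.
  intros He [Hc D1 D2 H0 H1].
  assert (He2 : 0 < eps ^ 2) by nra.
  destruct (continuous_has_max y 0 1) as [p [Hp Hmax]]. lra. auto.
  destruct (continuous_has_max (fun x => - y x) 0 1) as [q [Hq Hmin]]. lra.
  { intros x _. apply (continuous_opp (V := R_NormedModule)). apply Hc. }
  assert (A : y p <= Y).
  { destruct (Req_dec p 0) as [->|Np]. lra. destruct (Req_dec p 1) as [->|Np1]. lra.
    assert (Ip : 0 < p < 1) by lra.
    destruct (second_derivative_test y y1 0 1 p _ Ip D1 (D2 p Ip)) as [_ T].
    { intros s Hs. apply Hmax. lra. }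
    apply (f_nonpos_le p). apply unit_interior, Ip.
    apply Rmult_le_reg_r with (/ eps ^ 2). apply Rinv_0_lt_compat, He2. unfold Rdiv in T. lra. }
  assert (B : - Y <= y q).
  { destruct (Req_dec q 0) as [->|Np]. lra. destruct (Req_dec q 1) as [->|Np1]. lra.
    assert (Ip : 0 < q < 1) by lra.
    destruct (second_derivative_test (fun x => - y x) (fun x => - y1 x) 0 1 q
       (- (f q (y q) / eps ^ 2)) Ip) as [_ T].
    { intros s Hs. apply (is_derive_opp (V := R_NormedModule)). apply D1, Hs. }
    { apply (is_derive_opp (V := R_NormedModule)). apply D2, Ip. }
    { intros s Hs. apply Hmin. lra. }
    apply (f_nonneg_ge q). apply unit_interior, Ip.
    apply Rmult_le_reg_r with (/ eps ^ 2). apply Rinv_0_lt_compat, He2. unfold Rdiv in T. lra. }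
  intros x Hx. pose proof (Hmax x Hx). pose proof (Hmin x Hx). lra.
Qed.

(** L (1 + L / m)^2 bounds the second derivative of f along a curve of slope at most L / m, apart
    from the term f_y v''. Division by m <= f_y turns it into a bound on v'' at a maximum. *)
Definition source_bound : R := L * (1 + L / m) ^ 2 / m.

Lemma source_bound_pos : 0 <= source_bound.
Proof.
  unfold source_bound, Rdiv. apply Rmult_le_pos.
  apply Rmult_le_pos. exact HL. apply pow2_ge_0. apply Rlt_le, Rinv_0_lt_compat, Hm.
Qed.

(** Since eps^2 a^2 = m, this function B solves m B = eps^2 (B'' + [source_bound]), and B >= Y at
    both end points. *)
Definition barrier (eps x : R) : R :=
  Y * layer (sqrt m / eps) x + source_bound * eps ^ 2 / m.

Lemma abs_le_of_fy (x v a : R) : unit_itv x -> Rabs (fy x v * a) <= L -> Rabs a <= L / m.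
Proof.
  intros Hx H. apply Rmult_le_reg_l with m. exact Hm.
  replace (m * (L / m)) with L by (field; lra).
  eapply Rle_trans. 2: exact H.
  rewrite Rabs_mult. pose proof (Hfy_lo x v Hx). rewrite (Rabs_pos_eq (fy x v)) by lra.
  apply Rmult_le_compat_r. apply Rabs_pos. assumption.
Qed.

(* At an interior maximum of [sg * f (x, v x)] the first-order condition bounds v' and the
   second-order condition then bounds v'', so no derivative of the reduced solution is needed. *)
Lemma critical_curvature (sg x v v1 v2 : R) : unit_itv x -> - Y <= v <= Y ->
  sg = 1 \/ sg = -1 ->
  sg * (fx x v + fy x v * v1) = 0 ->
  sg * (fxx x v + (fxy x v + fyx x v) * v1 + fyy x v * v1 ^ 2 + fy x v * v2) <= 0 ->
  sg * v2 <= source_bound.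
Proof.
  intros Hx Hv Hsg E1 E2.
  pose proof (Bx x v Hx Hv) as X. pose proof (Bxx x v Hx Hv) as XX. pose proof (Bxy x v Hx Hv) as XY.
  pose proof (Byx x v Hx Hv) as YX. pose proof (Byy x v Hx Hv) as YY.
  pose proof (Hfy_lo x v Hx) as Fy.
  assert (V1 : Rabs v1 <= L / m).
  { apply (abs_le_of_fy x v). exact Hx.
    replace (fy x v * v1) with (- fx x v). rewrite Rabs_Ropp. exact X.
    destruct Hsg as [-> | ->]; lra. }
  set (p := L / m) in *.
  assert (Hp : 0 <= p) by (pose proof (Rabs_pos v1); lra).
  set (r := fxx x v + (fxy x v + fyx x v) * v1 + fyy x v * v1 ^ 2) in *.
  assert (Hr : Rabs r <= L * (1 + p) ^ 2).
  { unfold r. eapply Rle_trans. apply Rabs_triang.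
    eapply Rle_trans. apply Rplus_le_compat_r, Rabs_triang.
    rewrite !Rabs_mult, <- RPow_abs.
    pose proof (Rabs_triang (fxy x v) (fyx x v)). pose proof (Rabs_pos v1).
    pose proof (Rabs_pos (fyy x v)). pose proof (Rabs_pos (fxy x v + fyx x v)).
    assert (Rabs (fxy x v + fyx x v) * Rabs v1 <= 2 * L * p).
    { apply Rmult_le_compat; lra. }
    assert (Rabs (fyy x v) * Rabs v1 ^ 2 <= L * p ^ 2).
    { apply Rmult_le_compat; try lra. apply pow2_ge_0. apply pow_incr. lra. }
    nra. }
  assert (Hs : fy x v * (sg * v2) <= L * (1 + p) ^ 2).
  { apply Rabs_le_between in Hr. destruct Hsg as [-> | ->]; nra. }
  unfold source_bound. fold p.
  destruct (Rle_dec (sg * v2) 0) as [N|P].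
  - pose proof source_bound_pos as SP. unfold source_bound in SP. fold p in SP. lra.
  - apply Rmult_le_reg_l with m. exact Hm.
    replace (m * (L * (1 + p) ^ 2 / m)) with (L * (1 + p) ^ 2) by (field; lra).
    eapply Rle_trans. 2: exact Hs. apply Rmult_le_compat_r; lra.
Qed.

(** At a positive maximum p the curvature bound gives sg f(p, y) <= eps^2 ([source_bound] + B'') = m
    B. Shifting the argument of f by B changes f by at least m B, so the shifted value has sg f <= 0
    after all. *)
Lemma barrier_comparison (eps sg : R) (y y1 : R -> R) : 0 < eps -> sg = 1 \/ sg = -1 ->
  extended_solution f eps y y1 ->
  forall x, unit_itv x -> sg * f x (y x - sg * barrier eps x) <= 0.
Proof.
  intros He Hsg Hsol. pose proof (solution_bounded eps y y1 He Hsol) as Yb.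
  destruct Hsol as [Hc D1 D2 H0 H1].
  assert (He2 : 0 < eps ^ 2) by nra.
  set (a := sqrt m / eps).
  assert (Ha0 : 0 < a) by (apply Rdiv_lt_0_compat; [apply sqrt_lt_R0|]; assumption).
  assert (Ha : eps ^ 2 * a ^ 2 = m).
  { unfold a. rewrite <- (pow2_sqrt m) at 2 by lra. field. lra. }
  set (B := barrier eps). set (B1 := fun x => Y * layer1 a x).
  set (B2 := fun x => Y * (a ^ 2 * layer a x)).
  assert (DB : forall s, is_derive B s (B1 s)).
  { intros s. eapply is_derive_eq. apply is_derive_Rplus.
    apply is_derive_Rmult. apply is_derive_Rconst. apply is_derive_layer.
    apply is_derive_Rconst. unfold B1. fold a. cbv beta. ring. }
  assert (DB1 : forall s, is_derive B1 s (B2 s)).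
  { intros s. eapply is_derive_eq.
    apply is_derive_Rmult. apply is_derive_Rconst. apply is_derive_layer1.
    unfold B2. cbv beta. ring. }
  pose proof source_bound_pos as HS.
  assert (HB : forall x, m * B x = eps ^ 2 * (source_bound + B2 x)).
  { intros x. unfold B2.
    replace (eps ^ 2 * (source_bound + Y * (a ^ 2 * layer a x))) with
      (eps ^ 2 * source_bound + eps ^ 2 * a ^ 2 * (Y * layer a x)) by ring.
    rewrite Ha. unfold B, barrier. fold a. field. lra. }
  assert (Bpos : forall x, 0 <= B x).
  { intros x. unfold B, barrier. pose proof (layer_pos (sqrt m / eps) x).
    assert (0 <= source_bound * eps ^ 2 / m).
    { unfold Rdiv. apply Rmult_le_pos. nra. apply Rlt_le, Rinv_0_lt_compat, Hm. }
    nra. }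
  assert (Bends : forall x, x = 0 \/ x = 1 -> Y <= B x).
  { intros x Hx. unfold B, barrier, layer. fold a.
    assert (0 <= source_bound * eps ^ 2 / m).
    { unfold Rdiv. apply Rmult_le_pos. nra. apply Rlt_le, Rinv_0_lt_compat, Hm. }
    assert (1 <= exp (- a * x) + exp (- a * (1 - x))).
    { destruct Hx as [-> | ->].
      replace (- a * 0) with 0 by ring. rewrite exp_0. pose proof (exp_pos (- a * (1 - 0))). lra.
      replace (- a * (1 - 1)) with 0 by ring. rewrite exp_0. pose proof (exp_pos (- a * 1)). lra. }
    nra. }
  set (v := fun x => y x - sg * B x). set (v1 := fun x => y1 x - sg * B1 x).
  destruct (continuous_has_max (fun x => sg * f (clamp x) (v x)) 0 1) as [p [Hp Hmax]]. lra.
  { intros x _. apply (continuous_mult (K := R_AbsRing)). apply continuous_const.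
    apply continuous_slab_path. apply (C1_cont _ _ _ Hf). apply clamp_unit.
    apply clamp_continuous. apply (continuous_minus (V := R_NormedModule)). apply Hc.
    apply (continuous_mult (K := R_AbsRing)). apply continuous_const.
    eapply is_derive_continuous, DB. }
  assert (Hmax' : forall s, 0 <= s <= 1 -> sg * f s (v s) <= sg * f p (v p)).
  { intros s Hs. specialize (Hmax s Hs). rewrite !clamp_id in Hmax; assumption. }
  assert (Main : sg * f p (v p) <= 0).
  { apply Rnot_lt_le. intros P.
    (* The assumed sign of f bounds [v p] on one side; the bound on y and B >= 0 bound it on the
       other. This places [v p] in the strip where the derivatives of f are controlled. *)
    assert (V : - Y <= v p <= Y).
    { pose proof (Yb p Hp). pose proof (Bpos p). destruct Hsg as [E|E]; rewrite E in P; unfold v; rewrite E.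
      - pose proof (f_pos_gt p (v p) Hp ltac:(lra)) as Q. unfold v in Q. rewrite E in Q. lra.
      - pose proof (f_neg_lt p (v p) Hp ltac:(lra)) as Q. unfold v in Q. rewrite E in Q. lra. }
    (* At an end point y = 0 and B >= Y, so [v p] would lie on the side excluded by the sign of
       f. *)
    assert (Ip : 0 < p < 1).
    { assert (N : ~ (p = 0 \/ p = 1)).
      { intros N. pose proof (Bends p N). assert (y p = 0) by (destruct N as [-> | ->]; assumption).
        destruct Hsg as [E|E]; rewrite E in P.
        - pose proof (f_pos_gt p (v p) Hp ltac:(lra)) as Q. unfold v in Q. rewrite E in Q. lra.
        - pose proof (f_neg_lt p (v p) Hp ltac:(lra)) as Q. unfold v in Q. rewrite E in Q. lra. }
      lra. }
    assert (Dv : forall s, 0 < s < 1 -> is_derive v s (v1 s)).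
    { intros s Hs. eapply is_derive_eq. apply is_derive_Rminus. apply D1, Hs.
      apply is_derive_Rmult. apply is_derive_Rconst. apply DB. unfold v1. cbv beta. ring. }
    assert (Dv1 : is_derive v1 p (f p (y p) / eps ^ 2 - sg * B2 p)).
    { eapply is_derive_eq. apply is_derive_Rminus. apply D2, Ip.
      apply is_derive_Rmult. apply is_derive_Rconst. apply DB1. cbv beta. ring. }
    destruct (second_derivative_test (fun x => sg * f x (v x))
       (fun x => sg * (fx x (v x) + fy x (v x) * v1 x)) 0 1 p
       (sg * (fxx p (v p) + (fxy p (v p) + fyx p (v p)) * v1 p + fyy p (v p) * v1 p ^ 2
           + fy p (v p) * (f p (y p) / eps ^ 2 - sg * B2 p))) Ip) as [T1 T2].
    { intros s Hs. eapply is_derive_eq. apply is_derive_Rmult. apply is_derive_Rconst.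
      apply along_curve_d1. exact Hs. apply Dv, Hs. cbv beta. ring. }
    { eapply is_derive_eq. apply is_derive_Rmult. apply is_derive_Rconst.
      apply along_curve_d2. exact Ip. apply Dv, Ip. exact Dv1. cbv beta. ring. }
    { intros s Hs. apply Hmax'. lra. }
    pose proof (critical_curvature sg p (v p) (v1 p) _ Hp V Hsg T1 T2) as K.
    assert (F : m * B p + sg * f p (v p) <= sg * f p (y p)).
    { pose proof (Bpos p). destruct Hsg as [E|E]; rewrite E.
      - pose proof (f_increments p (v p) (y p) Hp) as I. unfold v in I |- *. rewrite E in *.
        assert (I' := I ltac:(lra)). lra.
      - pose proof (f_increments p (y p) (v p) Hp) as I. unfold v in I |- *. rewrite E in *.
        assert (I' := I ltac:(lra)). lra. }
    assert (Q : sg * f p (y p) <= eps ^ 2 * (source_bound + B2 p)).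
    { assert (S2 : sg * sg = 1) by (destruct Hsg as [-> | ->]; ring).
      replace (sg * f p (y p)) with
        (eps ^ 2 * (sg * (f p (y p) / eps ^ 2 - sg * B2 p) + sg * sg * B2 p)) by (field; lra).
      rewrite S2. apply Rmult_le_compat_l; lra. }
    rewrite <- HB in Q. lra. }
  intros x Hx. specialize (Hmax' x Hx). fold B. fold (v x). lra.
Qed.

(** The values of f at the two shifted arguments have known signs, and undoing a shift by B changes
    f by at most gamma B. *)
Lemma source_layer_bound : exists C, 0 < C /\ forall eps y y1, 0 < eps ->
  extended_solution f eps y y1 ->
  forall x, unit_itv x -> Rabs (f x (y x)) <= C * (eps ^ 2 + layer (sqrt m / eps) x).
Proof.
  assert (Hg : 0 < gamma).
  { pose proof (Hfy_lo 0 0 ltac:(unfold unit_itv; lra)).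
    pose proof (Hfy_hi 0 0 ltac:(unfold unit_itv; lra)). lra. }
  pose proof source_bound_pos as HS.
  assert (Hq : 0 <= source_bound / m).
  { unfold Rdiv. apply Rmult_le_pos. exact HS. apply Rlt_le, Rinv_0_lt_compat, Hm. }
  exists (gamma * (Y + source_bound / m + 1)). split. apply Rmult_lt_0_compat; lra.
  intros eps y y1 He Hsol x Hx.
  pose proof (barrier_comparison eps 1 y y1 He (or_introl eq_refl) Hsol x Hx) as U.
  pose proof (barrier_comparison eps (-1) y y1 He (or_intror eq_refl) Hsol x Hx) as D.
  assert (HB : barrier eps x <= (Y + source_bound / m + 1) * (eps ^ 2 + layer (sqrt m / eps) x)).
  { unfold barrier. pose proof (layer_pos (sqrt m / eps) x).
    replace (source_bound * eps ^ 2 / m) with (source_bound / m * eps ^ 2) by (field; lra).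
    pose proof (pow2_ge_0 eps). nra. }
  assert (Bp : 0 <= barrier eps x).
  { unfold barrier. pose proof (layer_pos (sqrt m / eps) x).
    replace (source_bound * eps ^ 2 / m) with (source_bound / m * eps ^ 2) by (field; lra).
    pose proof (pow2_ge_0 eps). nra. }
  pose proof (f_increments x (y x - 1 * barrier eps x) (y x) Hx ltac:(lra)).
  pose proof (f_increments x (y x) (y x - -1 * barrier eps x) Hx ltac:(lra)).
  apply Rabs_le_between. nra.
Qed.

Lemma gamma_pos : 0 < gamma.
Proof.
  pose proof (Hfy_lo 0 0 ltac:(unfold unit_itv; lra)).
  pose proof (Hfy_hi 0 0 ltac:(unfold unit_itv; lra)). lra.
Qed.

Lemma f_lipschitz_x (x z v : R) : unit_itv x -> unit_itv z -> - Y <= v <= Y ->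
  Rabs (f z v - f x v) <= L * Rabs (z - x).
Proof.
  intros Hx Hz Hv. destruct (Req_dec x z) as [->|Hne].
  { unfold Rminus. rewrite !Rplus_opp_r, Rabs_R0. lra. }
  assert (Cl : Rmin x z = x /\ Rmax x z = z \/ Rmin x z = z /\ Rmax x z = x).
  { unfold Rmin, Rmax. destruct Rle_dec; lra. }
  unfold unit_itv in Hx, Hz.
  destruct (MVT_unordered (fun s => f (clamp s) v) (fun s => fx s v) x z Hne) as [c [Hc E]].
  - intros s _. apply (continuous_slab_path f clamp (fun _ => v)).
    apply (C1_cont _ _ _ Hf). apply clamp_unit. apply clamp_continuous. apply continuous_const.
  - intros s Hs. assert (Is : 0 < s < 1) by lra.
    apply (is_derive_ext_loc (fun s => f s v)).
    + generalize (locally_unit_itv s Is). apply filter_imp. intros r Hr.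
      rewrite clamp_id. reflexivity. unfold unit_itv; lra.
    + apply (C1_dx _ _ _ Hf). exact Is.
  - rewrite !clamp_id in E by (unfold unit_itv; lra). rewrite E, Rabs_mult.
    apply Rmult_le_compat_r. apply Rabs_pos. apply Bx. unfold unit_itv; lra. exact Hv.
Qed.

Lemma increment_bound (eps : R) (y y1 : R -> R) (x z : R) : 0 < eps ->
  extended_solution f eps y y1 -> unit_itv x -> unit_itv z ->
  m * Rabs (y z - y x) <= Rabs (f z (y z) - f x (y x)) + L * Rabs (z - x).
Proof.
  intros He Hsol Hx Hz. pose proof (solution_bounded eps y y1 He Hsol x Hx) as Yb.
  eapply Rle_trans. apply (f_increments_abs z); exact Hz.
  pose proof (f_lipschitz_x x z (y x) Hx Hz Yb).
  replace (f z (y z) - f z (y x)) with ((f z (y z) - f x (y x)) + - (f z (y x) - f x (y x))) by ring.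
  eapply Rle_trans. apply Rabs_triang. rewrite Rabs_Ropp. lra.
Qed.

(** Interpolation on the scale eps: the increment of y over a length eps / 2 bounds y' at some point
    c, and y'' = f / eps^2 carries this bound from c to x. Over such a distance the layer function
    grows at most by the factor [K]. *)
Lemma first_derivative_bound : exists C, 0 < C /\ forall eps y y1, 0 < eps < 1 ->
  extended_solution f eps y y1 ->
  forall x, 0 < x < 1 -> Rabs (y1 x) <= C * (1 + layer (sqrt m / eps) x / eps).
Proof.
  destruct source_layer_bound as [C [HC HF]].
  set (K := exp (sqrt m)).
  assert (HK : 1 <= K).
  { unfold K. rewrite <- exp_0. apply exp_le, sqrt_pos. }
  exists (4 * C * K / m + L / m + 2 * C * K). split.
  { assert (0 < C * K) by nra.
    assert (0 < C * K / m) by (apply Rdiv_lt_0_compat; assumption).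
    assert (0 <= L / m) by (apply Rmult_le_pos; [|apply Rlt_le, Rinv_0_lt_compat]; assumption).
    replace (4 * C * K / m) with (4 * (C * K / m)) by (field; lra). lra. }
  intros eps y y1 He Hsol x Hx. assert (He0 : 0 < eps) by lra.
  pose proof Hsol as [Hc D1 D2 _ _].
  set (a := sqrt m / eps).
  assert (Ha0 : 0 < a) by (apply Rdiv_lt_0_compat; [apply sqrt_lt_R0|]; assumption).
  assert (Hae : a * eps = sqrt m) by (unfold a; field; lra).
  set (E := layer a x). assert (HE : 0 < E) by apply layer_pos.
  assert (Shift : forall s, Rabs (s - x) <= eps -> layer a s <= K * E).
  { intros s Hs. unfold K, E. rewrite <- Hae. apply layer_shift; lra. }
  (* The second point is taken towards the middle of [0, 1]; it stays inside because eps < 1. *)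
  assert (Hz : exists z, unit_itv z /\ Rabs (z - x) = eps / 2 /\ z <> x).
  { destruct (Rle_dec x (1 / 2)) as [A|A].
    - exists (x + eps / 2). unfold unit_itv. split. lra. split. rewrite Rabs_pos_eq; lra. lra.
    - exists (x - eps / 2). unfold unit_itv. split. lra. split. rewrite Rabs_left; lra. lra. }
  destruct Hz as (z & Uz & Az & Nz).
  assert (Cl : Rmin x z = x /\ Rmax x z = z /\ z - x = eps / 2 \/
               Rmin x z = z /\ Rmax x z = x /\ z - x = - (eps / 2)).
  { unfold Rmin, Rmax. destruct Rle_dec; [left|right].
    rewrite Rabs_pos_eq in Az by lra. lra. rewrite Rabs_left in Az by lra. lra. }
  assert (Iz : unit_itv z) by exact Uz. unfold unit_itv in Uz.
  destruct (MVT_unordered y y1 x z) as [c [Hcc E1]]. auto.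
  { intros s _. apply Hc. }
  { intros s Hs. apply D1. lra. }
  assert (Hcx : c <> x) by lra.
  assert (Cl2 : Rmin c x = x /\ Rmax c x = c /\ c <= z \/ Rmin c x = c /\ Rmax c x = x /\ z <= c).
  { unfold Rmin, Rmax. destruct Rle_dec; [right|left]; lra. }
  destruct (MVT_unordered y1 (fun s => f s (y s) / eps ^ 2) c x) as [r [Hr E2]]. auto.
  { intros s Hs. eapply is_derive_continuous, D2. lra. }
  { intros s Hs. apply D2. lra. }
  pose proof (increment_bound eps y y1 x z He0 Hsol (unit_interior x Hx) Iz) as I.
  pose proof (HF eps y y1 He0 Hsol x (unit_interior x Hx)) as Fx.
  pose proof (HF eps y y1 He0 Hsol z Iz) as Fz.
  pose proof (HF eps y y1 He0 Hsol r ltac:(unfold unit_itv; lra)) as Fr.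
  fold a in Fx, Fz, Fr. fold E in Fx.
  pose proof (Shift z ltac:(lra)) as Sz.
  assert (Hrx : Rabs (r - x) <= eps) by (apply Rabs_le_between; lra).
  pose proof (Shift r Hrx) as Sr.
  assert (Hcx' : Rabs (x - c) <= eps) by (apply Rabs_le_between; lra).
  assert (HKE : E <= K * E) by nra.
  assert (He2 : 0 < eps ^ 2) by nra.
  assert (HeK : eps ^ 2 <= K * eps ^ 2) by nra.
  assert (Big : m * Rabs (y z - y x) <= 2 * C * K * (eps ^ 2 + E) + L * (eps / 2)).
  { rewrite Az in I. eapply Rle_trans. exact I.
    pose proof (Rabs_triang (f z (y z)) (- f x (y x))) as Tr. rewrite Rabs_Ropp in Tr.
    unfold Rminus at 1.
    assert (C * (eps ^ 2 + E) <= C * (K * (eps ^ 2 + E))) by (apply Rmult_le_compat_l; lra).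
    assert (C * (eps ^ 2 + layer a z) <= C * (K * (eps ^ 2 + E))) by (apply Rmult_le_compat_l; lra).
    lra. }
  assert (P1 : Rabs (y1 c) <= 4 * C * K / m * (1 + E / eps) + L / m).
  { apply Rmult_le_reg_l with (m * (eps / 2)). nra.
    replace (m * (eps / 2) * Rabs (y1 c)) with (m * (Rabs (y1 c) * (eps / 2))) by ring.
    rewrite <- Az, <- Rabs_mult, <- E1, Az.
    eapply Rle_trans. exact Big.
    replace (m * (eps / 2) * (4 * C * K / m * (1 + E / eps) + L / m)) with
      (2 * C * K * (eps + E) + L * (eps / 2)) by (field; lra).
    assert (0 < C * K) by nra. assert (eps ^ 2 <= eps) by nra.
    assert (2 * C * K * (eps ^ 2 + E) <= 2 * C * K * (eps + E)) by (apply Rmult_le_compat_l; lra).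
    lra. }
  assert (P2 : Rabs (y1 x - y1 c) <= 2 * C * K * (1 + E / eps)).
  { rewrite E2, Rabs_mult. unfold Rdiv. rewrite Rabs_mult, (Rabs_pos_eq (/ eps ^ 2)).
    2: apply Rlt_le, Rinv_0_lt_compat, He2.
    apply Rle_trans with (C * (K * (eps ^ 2 + E)) * / eps ^ 2 * eps).
    - apply Rmult_le_compat. apply Rmult_le_pos. apply Rabs_pos.
      apply Rlt_le, Rinv_0_lt_compat, He2. apply Rabs_pos. 2: exact Hcx'.
      apply Rmult_le_compat_r. apply Rlt_le, Rinv_0_lt_compat, He2.
      eapply Rle_trans. exact Fr. apply Rmult_le_compat_l; lra.
    - replace (C * (K * (eps ^ 2 + E)) * / eps ^ 2 * eps) with (C * K * (eps + E / eps)) by (field; lra).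
      assert (0 < C * K) by nra. assert (0 < E / eps) by (apply Rdiv_lt_0_compat; lra).
      assert (C * K * (eps + E / eps) <= C * K * (2 * (1 + E / eps))) by (apply Rmult_le_compat_l; lra).
      lra. }
  replace (y1 x) with (y1 c + (y1 x - y1 c)) by ring.
  eapply Rle_trans. apply Rabs_triang.
  assert (0 < E / eps) by (apply Rdiv_lt_0_compat; lra).
  assert (0 <= L / m) by (apply Rmult_le_pos; [|apply Rlt_le, Rinv_0_lt_compat]; assumption).
  fold E. set (q := E / eps) in *.
  assert (0 <= L / m * q) by (apply Rmult_le_pos; lra). lra.
Qed.

(* Since [eps ^ 2 * y'' = f], the equation reads y'' = beta^2 (y - w): the truncation error of the
   scheme depends on w only. *)
Definition w_of (y : R -> R) (x : R) : R := y x - f x (y x) / gamma.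

Lemma w_derivatives_bound : exists C, 0 < C /\ forall eps y y1, 0 < eps < 1 ->
  extended_solution f eps y y1 -> exists w1 w2 : R -> R, forall x, 0 < x < 1 ->
    is_derive (w_of y) x (w1 x) /\ is_derive w1 x (w2 x) /\
    Rabs (w1 x) <= C * (1 + layer (sqrt m / eps) x / eps ^ 2) /\
    Rabs (w2 x) <= C * (1 + layer (sqrt m / eps) x / eps ^ 2).
Proof.
  destruct source_layer_bound as [CF [HCF HF]].
  destruct first_derivative_bound as [C1 [HC1 HD]].
  pose proof gamma_pos as Hg.
  set (A1 := C1 + (L + gamma * C1) / gamma).
  set (A2 := CF + (L + 2 * L * C1 + 4 * L * C1 ^ 2 + gamma * CF) / gamma).
  assert (0 <= L * C1) by nra. assert (0 <= L * C1 ^ 2) by nra. assert (0 < gamma * C1) by nra.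
  assert (0 < gamma * CF) by nra.
  assert (HA1 : 0 < A1).
  { unfold A1. assert (0 < (L + gamma * C1) / gamma) by (apply Rdiv_lt_0_compat; nra). lra. }
  assert (HA2 : 0 < A2).
  { unfold A2.
    assert (0 < (L + 2 * L * C1 + 4 * L * C1 ^ 2 + gamma * CF) / gamma)
      by (apply Rdiv_lt_0_compat; nra). lra. }
  exists (A1 + A2). split. lra.
  intros eps y y1 He Hsol. assert (He0 : 0 < eps) by lra. assert (He2 : 0 < eps ^ 2) by nra.
  pose proof Hsol as [Hc D1 D2 _ _].
  exists (fun x => y1 x - (fx x (y x) + fy x (y x) * y1 x) / gamma).
  exists (fun x => f x (y x) / eps ^ 2 -
    (fxx x (y x) + (fxy x (y x) + fyx x (y x)) * y1 x + fyy x (y x) * y1 x ^ 2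
      + fy x (y x) * (f x (y x) / eps ^ 2)) / gamma).
  intros x Hx. pose proof (unit_interior x Hx) as Ux.
  set (a := sqrt m / eps).
  assert (Ha0 : 0 < a) by (apply Rdiv_lt_0_compat; [apply sqrt_lt_R0|]; assumption).
  pose proof (layer_pos a x) as HE. pose proof (layer_le_2 a x ltac:(lra) Ux) as HE2.
  pose proof (HF eps y y1 He0 Hsol x Ux) as F. pose proof (HD eps y y1 He Hsol x Hx) as D.
  fold a in F, D. set (E := layer a x) in *. set (q := E / eps ^ 2).
  assert (Hq : 0 < q) by (apply Rdiv_lt_0_compat; lra).
  assert (Eq : E = q * eps ^ 2) by (unfold q; field; lra).
  assert (Eq1 : E / eps = q * eps) by (unfold q; field; lra).
  rewrite Eq1 in D. clearbody q.
  assert (Hqe : q * eps <= q) by nra.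
  assert (Y1 : Rabs (y1 x) <= C1 * (1 + q)).
  { eapply Rle_trans. exact D. apply Rmult_le_compat_l; lra. }
  (* E <= 2 makes the square of E / eps at most 2 E / eps^2, so the term f_yy y'^2 is of no higher
     order than f_y y''. *)
  assert (Y2 : Rabs (y1 x) ^ 2 <= 4 * C1 ^ 2 * (1 + q)).
  { apply Rle_trans with ((C1 * (1 + q * eps)) ^ 2).
    apply pow_incr. split. apply Rabs_pos. exact D.
    assert ((1 + q * eps) ^ 2 <= 4 * (1 + q)).
    { assert (q * (q * eps ^ 2) <= q * 2) by (apply Rmult_le_compat_l; lra). nra. }
    rewrite Rpow_mult_distr.
    replace (4 * C1 ^ 2 * (1 + q)) with (C1 ^ 2 * (4 * (1 + q))) by ring.
    apply Rmult_le_compat_l. apply pow2_ge_0. assumption. }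
  assert (G : Rabs (f x (y x) / eps ^ 2) <= CF * (1 + q)).
  { unfold Rdiv. rewrite Rabs_mult, (Rabs_pos_eq (/ eps ^ 2)).
    2: apply Rlt_le, Rinv_0_lt_compat, He2.
    apply Rmult_le_reg_r with (eps ^ 2). exact He2.
    replace (Rabs (f x (y x)) * / eps ^ 2 * eps ^ 2) with (Rabs (f x (y x))) by (field; lra).
    rewrite Eq in F. lra. }
  pose proof (solution_bounded eps y y1 He0 Hsol x Ux) as Yb.
  pose proof (Bx x _ Ux Yb) as X. pose proof (Bxx x _ Ux Yb) as XX. pose proof (Bxy x _ Ux Yb) as XY.
  pose proof (Byx x _ Ux Yb) as YX. pose proof (Byy x _ Ux Yb) as YY.
  pose proof (Hfy_lo x (y x) Ux) as Fl. pose proof (Hfy_hi x (y x) Ux) as Fh.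
  assert (Fy : Rabs (fy x (y x)) <= gamma) by (rewrite Rabs_pos_eq; lra).
  assert (Step : forall u v A B, Rabs u <= A * (1 + q) -> Rabs v <= B * (1 + q) ->
     Rabs (u - v / gamma) <= (A + B / gamma) * (1 + q)).
  { intros u v A B Hu Hv. unfold Rminus. eapply Rle_trans. apply Rabs_triang.
    rewrite Rabs_Ropp. unfold Rdiv. rewrite Rabs_mult, (Rabs_pos_eq (/ gamma)).
    2: apply Rlt_le, Rinv_0_lt_compat, Hg.
    assert (Rabs v * / gamma <= B * (1 + q) * / gamma).
    { apply Rmult_le_compat_r. apply Rlt_le, Rinv_0_lt_compat, Hg. exact Hv. }
    lra. }
  pose proof (Rabs_pos (y1 x)) as Py1.
  split; [|split; [|split]].
  - eapply is_derive_eq. apply is_derive_Rminus. apply D1, Hx.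
    apply is_derive_Rmult. apply along_curve_d1. exact Hx. apply D1, Hx. apply is_derive_Rconst.
    cbv beta. field. lra.
  - eapply is_derive_eq. apply is_derive_Rminus. apply D2, Hx.
    apply is_derive_Rmult. apply along_curve_d2. exact Hx. apply D1, Hx. apply D2, Hx.
    apply is_derive_Rconst. cbv beta. field. lra.
  - apply Rle_trans with (A1 * (1 + q)). 2: apply Rmult_le_compat_r; lra.
    apply Step. exact Y1.
    eapply Rle_trans. apply Rabs_triang. rewrite Rabs_mult.
    assert (Rabs (fy x (y x)) * Rabs (y1 x) <= gamma * (C1 * (1 + q))).
    { apply Rmult_le_compat; try apply Rabs_pos; assumption. }
    nra.
  - apply Rle_trans with (A2 * (1 + q)). 2: apply Rmult_le_compat_r; lra.
    apply Step. exact G.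
    eapply Rle_trans. apply Rabs_triang.
    eapply Rle_trans. apply Rplus_le_compat_r, Rabs_triang.
    eapply Rle_trans. apply Rplus_le_compat_r, Rplus_le_compat_r, Rabs_triang.
    rewrite !(Rabs_mult (fy x (y x))), (Rabs_mult (fyy x (y x))), (Rabs_mult (_ + _)), <- RPow_abs.
    pose proof (Rabs_triang (fxy x (y x)) (fyx x (y x))).
    assert (Rabs (fxy x (y x) + fyx x (y x)) * Rabs (y1 x) <= 2 * L * (C1 * (1 + q))).
    { apply Rmult_le_compat; try apply Rabs_pos; lra. }
    assert (Rabs (fyy x (y x)) * Rabs (y1 x) ^ 2 <= L * (4 * C1 ^ 2 * (1 + q))).
    { apply Rmult_le_compat; try assumption. apply Rabs_pos. apply pow_le, Py1. }
    assert (Rabs (fy x (y x)) * Rabs (f x (y x) / eps ^ 2) <= gamma * (CF * (1 + q))).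
    { apply Rmult_le_compat; try apply Rabs_pos; assumption. }
    nra.
Qed.

(** Taylor's formula along the chord from (x, y x) to (z, y z) reads dF = f_x dx + f_y dy + R.
    Solving for dy makes the increment of w equal to c dx + (dF - R) / f_y - dF / gamma, where |dF|
    is at most the sum of |f| at the two ends. Since the chord is used instead of the graph, the
    behaviour of y between x and z does not enter. *)
Lemma w_affine_bound : exists C, 0 < C /\ forall eps y y1, 0 < eps < 1 ->
  extended_solution f eps y y1 -> forall x, 0 < x < 1 ->
  exists c, Rabs c <= C /\ forall z, unit_itv z ->
    Rabs (w_of y z - w_of y x - c * (z - x))
      <= C * (Rabs (f x (y x)) + Rabs (f z (y z)) + (z - x) ^ 2).
Proof.
  destruct source_layer_bound as [CF [HCF HF]].
  pose proof gamma_pos as Hg.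
  (* [Q (|dF| + dx ^ 2)] bounds the second-order Taylor remainder of f along the chord. *)
  set (Q := 2 * L * (1 + 2 * (6 * CF + L ^ 2) / m ^ 2)).
  assert (Hm2 : 0 < m ^ 2) by nra.
  assert (HQ : 0 <= Q).
  { unfold Q. assert (0 <= 2 * (6 * CF + L ^ 2) / m ^ 2).
    { apply Rdiv_le_0_compat. nra. exact Hm2. } nra. }
  assert (Hgi : 0 < / gamma) by (apply Rinv_0_lt_compat; lra).
  assert (Hmi : 0 < / m) by (apply Rinv_0_lt_compat; lra).
  assert (HLm : 0 <= L / m) by (apply Rmult_le_pos; lra).
  exists (L / m + (1 + Q) / m + / gamma + 1).
  assert (HQm : 0 <= (1 + Q) / m) by (apply Rmult_le_pos; lra).
  split. lra.
  intros eps y y1 He Hsol x Hx. assert (He0 : 0 < eps) by lra.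
  pose proof (unit_interior x Hx) as Ux.
  pose proof (solution_bounded eps y y1 He0 Hsol) as Yb.
  pose proof (Hfy_lo x (y x) Ux) as Fl.
  assert (Fsmall : forall s, unit_itv s -> Rabs (f s (y s)) <= 3 * CF).
  { intros s Hs. eapply Rle_trans. apply (HF eps y y1 He0 Hsol s Hs).
    pose proof (layer_le_2 (sqrt m / eps) s). assert (0 < sqrt m / eps).
    { apply Rdiv_lt_0_compat. apply sqrt_lt_R0, Hm. exact He0. }
    unfold unit_itv in Hs. assert (eps ^ 2 <= 1) by nra.
    rewrite (Rmult_comm 3). apply Rmult_le_compat_l; lra. }
  set (c := - (fx x (y x) / fy x (y x))).
  exists c. split.
  { assert (Rabs c <= L / m). 2: lra.
    apply (abs_le_of_fy x (y x)). exact Ux.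
    replace (fy x (y x) * c) with (- fx x (y x)) by (unfold c; field; lra).
    rewrite Rabs_Ropp. apply Bx. exact Ux. apply Yb, Ux. }
  intros z Uz.
  set (dx := z - x). set (dy := y z - y x). set (dF := f z (y z) - f x (y x)).
  pose proof (increment_bound eps y y1 x z He0 Hsol Ux Uz) as I. fold dx dy dF in I.
  assert (HdF : Rabs dF <= Rabs (f x (y x)) + Rabs (f z (y z))).
  { unfold dF, Rminus. eapply Rle_trans. apply Rabs_triang. rewrite Rabs_Ropp. lra. }
  (* This crude bound gives |dF|^2 <= 6 CF |dF|, so that the squared increment of y becomes linear
     in |dF|. *)
  assert (HdF6 : Rabs dF <= 6 * CF).
  { pose proof (Fsmall x Ux). pose proof (Fsmall z Uz). lra. }
  pose proof (Rabs_pos dF) as PF. pose proof (Rabs_pos dx) as Pdx. pose proof (Rabs_pos dy) as Pdy.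
  assert (Hdy2 : Rabs dy ^ 2 <= 2 * (6 * CF + L ^ 2) / m ^ 2 * (Rabs dF + Rabs dx ^ 2)).
  { apply Rmult_le_reg_l with (m ^ 2). exact Hm2.
    replace (m ^ 2 * (2 * (6 * CF + L ^ 2) / m ^ 2 * (Rabs dF + Rabs dx ^ 2))) with
      (2 * (6 * CF + L ^ 2) * (Rabs dF + Rabs dx ^ 2)) by (field; lra).
    replace (m ^ 2 * Rabs dy ^ 2) with ((m * Rabs dy) ^ 2) by ring.
    apply Rle_trans with ((Rabs dF + L * Rabs dx) ^ 2).
    { apply pow_incr. split. apply Rmult_le_pos; lra. exact I. }
    apply Rle_trans with (2 * (Rabs dF ^ 2 + L ^ 2 * Rabs dx ^ 2)).
    { pose proof (pow2_ge_0 (Rabs dF - L * Rabs dx)). nra. }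
    pose proof (pow2_ge_0 L). pose proof (pow2_ge_0 (Rabs dx)). nra. }
  set (vv := fun t => y x + t * dy). set (zz := fun t => x + t * dx).
  assert (Hvv : forall t, 0 <= t <= 1 -> - Y <= vv t <= Y).
  { intros t Ht. pose proof (Yb x Ux). pose proof (Yb z Uz). unfold vv, dy. nra. }
  (* The value 1 is excluded because z may be an end point, where no two-sided x-derivative is
     available; continuity suffices there. *)
  assert (Hzz : forall t, 0 <= t < 1 -> 0 < zz t < 1).
  { intros t Ht. unfold unit_itv in Uz. unfold zz, dx. nra. }
  set (p1 := fun t => fx (zz t) (vv t) * dx + fy (zz t) (vv t) * dy).
  set (p2 := fun t => (fxx (zz t) (vv t) * dx + fxy (zz t) (vv t) * dy) * dx
                    + (fyx (zz t) (vv t) * dx + fyy (zz t) (vv t) * dy) * dy).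
  assert (Dz : forall t, is_derive zz t dx).
  { intros t. eapply is_derive_eq. apply is_derive_Rplus. apply is_derive_Rconst.
    apply is_derive_Rmult. apply is_derive_Rid. apply is_derive_Rconst. cbv beta. ring. }
  assert (Dv : forall t, is_derive vv t dy).
  { intros t. eapply is_derive_eq. apply is_derive_Rplus. apply is_derive_Rconst.
    apply is_derive_Rmult. apply is_derive_Rid. apply is_derive_Rconst. cbv beta. ring. }
  assert (Dp : forall t, 0 <= t < 1 -> is_derive (fun t => f (zz t) (vv t)) t (p1 t)).
  { intros t Ht. apply (C1_slab_chain f fx fy zz vv t dx dy Hf). apply Hzz, Ht. apply Dz. apply Dv. }
  assert (Dp1 : forall t, 0 <= t < 1 -> is_derive p1 t (p2 t)).
  { intros t Ht. eapply is_derive_eq. apply is_derive_Rplus.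
    apply is_derive_Rmult. apply (C1_slab_chain fx fxx fxy zz vv t dx dy Hfx). apply Hzz, Ht.
    apply Dz. apply Dv. apply is_derive_Rconst.
    apply is_derive_Rmult. apply (C1_slab_chain fy fyx fyy zz vv t dx dy Hfy). apply Hzz, Ht.
    apply Dz. apply Dv. apply is_derive_Rconst.
    unfold p2. cbv beta. ring. }
  assert (HR : Rabs (dF - fx x (y x) * dx - fy x (y x) * dy) <= Q * (Rabs dF + Rabs dx ^ 2)).
  { destruct (MVT_interior (fun t => f (clamp (zz t)) (vv t)) p1 0 1) as [t1 [Ht1 E1]]. lra.
    { intros t _. apply (continuous_slab_path f (fun t => clamp (zz t)) vv).
      apply (C1_cont _ _ _ Hf). intros; apply clamp_unit.
      apply (continuous_comp zz clamp). eapply is_derive_continuous, Dz. apply clamp_continuous.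
      eapply is_derive_continuous, Dv. }
    { intros t Ht. apply (is_derive_ext_loc (fun t => f (zz t) (vv t))).
      2: apply Dp; lra.
      generalize (locally_unit_itv t Ht). apply filter_imp. intros s Hs.
      pose proof (Hzz s ltac:(lra)). rewrite clamp_id. reflexivity. unfold unit_itv. lra. }
    assert (Z0 : zz 0 = x) by (unfold zz; ring). assert (V0 : vv 0 = y x) by (unfold vv; ring).
    assert (Z1 : zz 1 = z) by (unfold zz, dx; ring). assert (V1 : vv 1 = y z) by (unfold vv, dy; ring).
    rewrite Z0, Z1, V0, V1, !clamp_id in E1 by assumption.
    destruct (MVT_interior p1 p2 0 t1) as [t2 [Ht2 E2]]. lra.
    { intros t Ht. eapply is_derive_continuous, Dp1. lra. }
    { intros t Ht. apply Dp1. lra. }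
    assert (E0 : p1 0 = fx x (y x) * dx + fy x (y x) * dy) by (unfold p1; rewrite Z0, V0; reflexivity).
    replace (dF - fx x (y x) * dx - fy x (y x) * dy) with (p2 t2 * t1).
    2: { unfold dF. rewrite E1. rewrite E0 in E2. lra. }
    pose proof (Hzz t2 ltac:(lra)) as Iz. pose proof (unit_interior _ Iz) as Uz2.
    pose proof (Hvv t2 ltac:(lra)) as Iv.
    pose proof (Bxx _ _ Uz2 Iv). pose proof (Bxy _ _ Uz2 Iv).
    pose proof (Byx _ _ Uz2 Iv). pose proof (Byy _ _ Uz2 Iv).
    assert (P2 : Rabs (p2 t2) <= L * (Rabs dx + Rabs dy) ^ 2).
    { unfold p2. eapply Rle_trans. apply Rabs_triang. rewrite !Rabs_mult.
      eapply Rle_trans. apply Rplus_le_compat; apply Rmult_le_compat_r; try apply Rabs_pos; apply Rabs_triang.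
      rewrite !Rabs_mult.
      replace (L * (Rabs dx + Rabs dy) ^ 2) with
       ((L * Rabs dx + L * Rabs dy) * Rabs dx + (L * Rabs dx + L * Rabs dy) * Rabs dy) by ring.
      apply Rplus_le_compat; (apply Rmult_le_compat_r; [apply Rabs_pos|]);
      apply Rplus_le_compat; (apply Rmult_le_compat_r; [apply Rabs_pos|assumption]). }
    rewrite Rabs_mult, (Rabs_pos_eq t1) by lra.
    apply Rle_trans with (L * (Rabs dx + Rabs dy) ^ 2).
    { pose proof (Rabs_pos (p2 t2)). nra. }
    apply Rle_trans with (2 * L * (Rabs dx ^ 2 + Rabs dy ^ 2)).
    { pose proof (pow2_ge_0 (Rabs dx - Rabs dy)). nra. }
    unfold Q. rewrite (Rmult_assoc (2 * L)). apply Rmult_le_compat_l. lra.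
    assert (0 <= 2 * (6 * CF + L ^ 2) / m ^ 2) by (apply Rdiv_le_0_compat; [nra|exact Hm2]).
    rewrite Rmult_plus_distr_r. lra. }
  set (Rm := dF - fx x (y x) * dx - fy x (y x) * dy) in *.
  assert (Ew : w_of y z - w_of y x - c * dx = (dF - Rm) * / fy x (y x) - dF * / gamma).
  { unfold w_of, c, Rm. unfold dF. replace (y z) with (y x + dy) at 1 by (unfold dy; ring).
    field. split; lra. }
  rewrite Ew.
  eapply Rle_trans. unfold Rminus at 1. apply Rabs_triang. rewrite Rabs_Ropp, !Rabs_mult.
  assert (Hfi : 0 < / fy x (y x) <= / m).
  { split. apply Rinv_0_lt_compat; lra. apply Rinv_le_contravar; lra. }
  rewrite (Rabs_pos_eq (/ fy x (y x))), (Rabs_pos_eq (/ gamma)) by lra.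
  assert (Rabs (dF - Rm) <= (1 + Q) * (Rabs dF + Rabs dx ^ 2)).
  { unfold Rminus. eapply Rle_trans. apply Rabs_triang. rewrite Rabs_Ropp.
    pose proof (pow2_ge_0 (Rabs dx)). lra. }
  assert (Rabs (dF - Rm) * / fy x (y x) <= (1 + Q) / m * (Rabs dF + Rabs dx ^ 2)).
  { unfold Rdiv. replace ((1 + Q) * / m * (Rabs dF + Rabs dx ^ 2)) with
     ((1 + Q) * (Rabs dF + Rabs dx ^ 2) * / m) by ring.
    apply Rmult_le_compat; try lra. apply Rabs_pos. }
  rewrite <- (pow2_abs dx). pose proof (pow2_ge_0 (Rabs dx)). set (d2 := Rabs dx ^ 2) in *.
  set (S := Rabs (f x (y x)) + Rabs (f z (y z))) in *.
  assert ((1 + Q) / m * (Rabs dF + d2) <= (1 + Q) / m * (S + d2)) by (apply Rmult_le_compat_l; lra).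
  assert (Rabs dF * / gamma <= / gamma * (S + d2)) by (rewrite Rmult_comm; apply Rmult_le_compat_l; lra).
  assert (0 <= (L / m + 1) * (S + d2)) by (apply Rmult_le_pos; lra).
  lra.
Qed.

End Apriori.

Definition apriori_bounds (f : R -> R -> R) (m gamma C eps : R) (y y1 w1 w2 : R -> R) : Prop :=
  extended_solution f eps y y1 /\
  (forall x, unit_itv x -> Rabs (f x (y x)) <= C * (eps ^ 2 + layer (sqrt m / eps) x)) /\
  (forall x, 0 < x < 1 ->
     is_derive (w_of f gamma y) x (w1 x) /\ is_derive w1 x (w2 x) /\
     Rabs (w1 x) <= C * (1 + layer (sqrt m / eps) x / eps ^ 2) /\
     Rabs (w2 x) <= C * (1 + layer (sqrt m / eps) x / eps ^ 2)) /\
  (forall x, 0 < x < 1 -> exists c, Rabs c <= C /\ forall z, unit_itv z ->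
     Rabs (w_of f gamma y z - w_of f gamma y x - c * (z - x))
       <= C * (Rabs (f x (y x)) + Rabs (f z (y z)) + (z - x) ^ 2)).

Lemma Ck_slab_C1 (k : nat) (f : R -> R -> R) (m gamma : R) :
  (2 <= k)%nat -> Ck_slab k f ->
  (forall x v : R, 0 <= x <= 1 -> m <= partial_y f x v) ->
  (forall x v : R, 0 <= x <= 1 -> partial_y f x v <= gamma) ->
  exists fx fy fxx fxy fyx fyy,
    C1_slab f fx fy /\ C1_slab fx fxx fxy /\ C1_slab fy fyx fyy /\
    (forall x v, unit_itv x -> m <= fy x v) /\ (forall x v, unit_itv x -> fy x v <= gamma).
Proof.
  intros Hk HC Hlo Hhi.
  destruct k as [|[|k]]; try lia.
  destruct (Ck_slab_S _ _ HC) as (fx & fy & H & Hx & Hy).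
  destruct (Ck_slab_S _ _ Hx) as (fxx & fxy & Hx' & _).
  destruct (Ck_slab_S _ _ Hy) as (fyx & fyy & Hy' & _).
  exists fx, fy, fxx, fxy, fyx, fyy. repeat (split; try assumption).
  - intros x v Ux. rewrite <- (is_derive_unique _ _ _ (C1_dy _ _ _ H x v Ux)). apply Hlo, Ux.
  - intros x v Ux. rewrite <- (is_derive_unique _ _ _ (C1_dy _ _ _ H x v Ux)). apply Hhi, Ux.
Qed.

Lemma apriori (k : nat) (f : R -> R -> R) (m gamma : R) :
  (2 <= k)%nat -> Ck_slab k f -> 0 < m ->
  (forall x v : R, 0 <= x <= 1 -> m <= partial_y f x v) ->
  (forall x v : R, 0 <= x <= 1 -> partial_y f x v <= gamma) ->
  (forall x v1 v2, unit_itv x -> v1 <= v2 ->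
     m * (v2 - v1) <= f x v2 - f x v1 <= gamma * (v2 - v1)) /\
  (forall p : R * R, continuous (fun p : R * R => f (clamp (fst p)) (snd p)) p) /\
  exists C, 0 < C /\ forall eps y y1, 0 < eps < 1 -> extended_solution f eps y y1 ->
    exists w1 w2, apriori_bounds f m gamma C eps y y1 w1 w2.
Proof.
  intros Hk HC Hm Hlo Hhi.
  destruct (Ck_slab_C1 k f m gamma Hk HC Hlo Hhi)
    as (fx & fy & fxx & fxy & fyx & fyy & Hf & Hfx & Hfy & Lo & Hi).
  split. { intros. apply (f_increments f fx fy); assumption. }
  split. { apply continuous_on_slab_clamp, (C1_cont _ _ _ Hf). }
  (* Half-width 0 bounds f(x, 0); this fixes the strip [- Y, Y] before the derivatives are bounded
     on it. *)
  destruct (slab_bounded f 0 (C1_cont _ _ _ Hf)) as [M [HM BM]].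
  set (Y := M / m).
  assert (HY : 0 <= Y) by (apply Rlt_le, Rdiv_lt_0_compat; assumption).
  assert (Hf0 : forall x, unit_itv x -> Rabs (f x 0) <= m * Y).
  { intros x Hx. replace (m * Y) with M by (unfold Y; field; lra). apply BM. exact Hx. lra. }
  destruct (slab_bounded fx Y (C1_cont_x _ _ _ Hf)) as [L1 [P1 B1]].
  destruct (slab_bounded fxx Y (C1_cont_x _ _ _ Hfx)) as [L2 [P2 B2]].
  destruct (slab_bounded fxy Y (C1_cont_y _ _ _ Hfx)) as [L3 [P3 B3]].
  destruct (slab_bounded fyx Y (C1_cont_x _ _ _ Hfy)) as [L4 [P4 B4]].
  destruct (slab_bounded fyy Y (C1_cont_y _ _ _ Hfy)) as [L5 [P5 B5]].
  set (L := L1 + L2 + L3 + L4 + L5).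
  assert (HL : 0 <= L) by (unfold L; lra).
  assert (Up : forall (g : R -> R -> R) B, B <= L ->
     (forall x v, unit_itv x -> - Y <= v <= Y -> Rabs (g x v) <= B) ->
     forall x v, unit_itv x -> - Y <= v <= Y -> Rabs (g x v) <= L).
  { intros g B HB H x v Hx Hv. specialize (H x v Hx Hv). lra. }
  assert (Bx := Up fx L1 ltac:(unfold L; lra) B1). assert (Bxx := Up fxx L2 ltac:(unfold L; lra) B2).
  assert (Bxy := Up fxy L3 ltac:(unfold L; lra) B3). assert (Byx := Up fyx L4 ltac:(unfold L; lra) B4).
  assert (Byy := Up fyy L5 ltac:(unfold L; lra) B5).
  destruct (source_layer_bound f fx fy fxx fxy fyx fyy m gamma Y L) as [C1 [Q1 H1]]; auto.
  destruct (w_derivatives_bound f fx fy fxx fxy fyx fyy m gamma Y L) as [C2 [Q2 H2]]; auto.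
  destruct (w_affine_bound f fx fy fxx fxy fyx fyy m gamma Y L) as [C3 [Q3 H3]]; auto.
  exists (C1 + C2 + C3). split. lra.
  intros eps y y1 He Hsol. assert (He0 : 0 < eps) by lra.
  destruct (H2 eps y y1 He Hsol) as (w1 & w2 & H2'). exists w1, w2.
  assert (He2 : 0 < eps ^ 2) by nra.
  assert (Lp : forall x, 0 < layer (sqrt m / eps) x) by (intros; apply layer_pos).
  split; [exact Hsol|split; [|split]].
  - intros x Hx. eapply Rle_trans. apply (H1 eps y y1 He0 Hsol x Hx).
    apply Rmult_le_compat_r. specialize (Lp x). lra. lra.
  - intros x Hx. destruct (H2' x Hx) as (A & B & D & E).
    assert (0 < layer (sqrt m / eps) x / eps ^ 2) by (apply Rdiv_lt_0_compat; auto).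
    split; [exact A|split; [exact B|split]].
    + eapply Rle_trans. apply D. apply Rmult_le_compat_r; lra.
    + eapply Rle_trans. apply E. apply Rmult_le_compat_r; lra.
  - intros x Hx. destruct (H3 eps y y1 He Hsol x Hx) as [c [Hc Hz]].
    exists c. split. lra. intros z Uz. eapply Rle_trans. apply (Hz z Uz).
    apply Rmult_le_compat_r. 2: lra.
    pose proof (Rabs_pos (f x (y x))). pose proof (Rabs_pos (f z (y z))).
    pose proof (pow2_ge_0 (z - x)). lra.
Qed.

(** * Truncation error along the exact solution *)

Lemma taylor_quadratic (g g1 g2 : R -> R) (a b x z M : R) :
  a < x < b -> a <= z <= b ->
  (forall s, a <= s <= b -> continuous g s) ->
  (forall s, a < s < b -> is_derive g s (g1 s)) ->
  (forall s, a < s < b -> is_derive g1 s (g2 s)) ->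
  (forall s, a < s < b -> Rabs (g2 s) <= M) ->
  Rabs (g z - g x - g1 x * (z - x)) <= M * (z - x) ^ 2.
Proof.
  intros Hx Hz Cg D1 D2 B.
  destruct (Req_dec x z) as [->|Hne].
  { replace (g z - g z - g1 z * (z - z)) with 0 by ring. rewrite Rabs_R0.
    replace (M * (z - z) ^ 2) with 0 by ring. lra. }
  assert (Cl : Rmin x z = x /\ Rmax x z = z /\ x < z \/ Rmin x z = z /\ Rmax x z = x /\ z < x).
  { unfold Rmin, Rmax. destruct Rle_dec; lra. }
  destruct (MVT_unordered g g1 x z Hne) as [c [Hc E1]].
  { intros s Hs. apply Cg. lra. }
  { intros s Hs. apply D1. lra. }
  assert (Hcx : x <> c) by lra.
  assert (Cl2 : Rmin x c = x /\ Rmax x c = c /\ x < c \/ Rmin x c = c /\ Rmax x c = x /\ c < x).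
  { unfold Rmin, Rmax. destruct Rle_dec; lra. }
  destruct (MVT_unordered g1 g2 x c Hcx) as [r [Hr E2]].
  { intros s Hs. eapply is_derive_continuous, D2. lra. }
  { intros s Hs. apply D2. lra. }
  replace (g z - g x - g1 x * (z - x)) with (g2 r * ((c - x) * (z - x))).
  2: { rewrite E1. replace (g1 c) with (g1 x + g2 r * (c - x)) by lra. ring. }
  rewrite Rabs_mult. apply Rmult_le_compat; try apply Rabs_pos. apply B. lra.
  apply Rabs_le_between. nra.
Qed.

(* Slope w'(x): accurate when the mesh resolves the layer, or eps > 1 / N. *)
Lemma truncation_by_derivatives (f : R -> R -> R) (m gamma C eps x h k tau E : R) (y y1 w1 w2 : R -> R) :
  (forall p : R * R, continuous (fun p : R * R => f (clamp (fst p)) (snd p)) p) ->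
  0 < gamma -> 0 < eps -> 0 < C -> 0 < h -> 0 < k -> 0 <= x - h -> x + k <= 1 -> 0 <= tau <= 1 ->
  apriori_bounds f m gamma C eps y y1 w1 w2 ->
  (forall s, x - h <= s <= x + k -> layer (sqrt m / eps) s <= E) ->
  let w := w_of f gamma y in let beta := sqrt gamma / eps in
  Rabs (hyp_s (beta * h) * (y (x - h) - y x) + hyp_s (beta * k) * (y (x + k) - y x)
     - (y x - w x) * (hyp_d (beta * h) + hyp_d (beta * k))
     + tau * (hyp_d (beta * h) * (w (x - h) - w x) + hyp_d (beta * k) * (w (x + k) - w x)))
  <= (hyp_d (beta * h) + hyp_d (beta * k)) *
     (3 * C * (1 + E / eps ^ 2) * (Rabs (k - h) + (h + k) ^ 2)).
Proof.
  intros Cf Hg He HC Hh Hk Hl Hr Ht (Hsol & HF & Hw & _) HE w beta.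
  pose proof Hsol as [Hc D1 D2 _ _].
  assert (He2 : 0 < eps ^ 2) by nra.
  assert (Hb : 0 < beta) by (apply Rdiv_lt_0_compat; [apply sqrt_lt_R0|]; assumption).
  assert (Hb2 : beta ^ 2 = gamma / eps ^ 2).
  { unfold beta. rewrite <- (pow2_sqrt gamma) at 2 by lra. field. lra. }
  assert (Pz : 0 < beta * h) by (apply Rmult_lt_0_compat; lra).
  assert (PZ : 0 < beta * k) by (apply Rmult_lt_0_compat; lra).
  pose proof (hyp_d_pos _ Pz). pose proof (hyp_d_pos _ PZ).
  assert (HE0 : 0 < E) by (eapply Rlt_le_trans; [apply layer_pos|apply (HE x); lra]).
  set (q := E / eps ^ 2). assert (Hq : 0 < q) by (apply Rdiv_lt_0_compat; lra).
  assert (Lq : forall s, x - h < s < x + k -> layer (sqrt m / eps) s / eps ^ 2 <= q).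
  { intros s Hs. apply Rmult_le_compat_r. apply Rlt_le, Rinv_0_lt_compat, He2. apply HE. lra. }
  assert (B1 : forall s, x - h < s < x + k -> Rabs (w1 s) <= C * (1 + q)).
  { intros s Hs. destruct (Hw s ltac:(lra)) as (_ & _ & B & _). specialize (Lq s Hs).
    eapply Rle_trans. apply B. apply Rmult_le_compat_l; lra. }
  assert (B2 : forall s, x - h < s < x + k -> Rabs (w2 s) <= C * (1 + q)).
  { intros s Hs. destruct (Hw s ltac:(lra)) as (_ & _ & _ & B). specialize (Lq s Hs).
    eapply Rle_trans. apply B. apply Rmult_le_compat_l; lra. }
  assert (HCq : 0 < C * (1 + q)) by (apply Rmult_lt_0_compat; lra).
  eapply Rle_trans.
  { apply (truncation_error beta h k x (w1 x) (C * (1 + q) * (h + k) ^ 2) tau y y1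
      (fun s => f s (y s) / eps ^ 2) w); auto.
    - intros s Hs. apply D1. lra.
    - intros s Hs. apply D2. lra.
    - intros s Hs. rewrite Hb2. unfold w, w_of. field. lra.
    - intros s Hs.
      (* [g] equals w on [0, 1] and is continuous also at 0 and 1, which the first and last stencils
         reach. *)
      set (g := fun s => y s - f (clamp s) (y s) / gamma).
      assert (T : Rabs (g s - g x - w1 x * (s - x)) <= C * (1 + q) * (s - x) ^ 2).
      { apply (taylor_quadratic g w1 w2 (x - h) (x + k)); try lra.
        - intros r Hr'. apply (continuous_minus (V := R_NormedModule)). apply Hc.
          apply (continuous_mult (K := R_AbsRing)). 2: apply continuous_const.
          apply (continuous_comp_2 (fun r => r) y (fun a b => f (clamp a) b)).
          apply continuous_id. apply Hc. apply Cf.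
        - intros r Hr'. apply (is_derive_ext_loc w). 2: apply Hw; lra.
          generalize (locally_unit_itv r ltac:(lra)). apply filter_imp. intros u Hu.
          unfold w, w_of, g. rewrite clamp_id. reflexivity. unfold unit_itv; lra.
        - intros r Hr'. apply Hw. lra.
        - exact B2. }
      unfold g in T. rewrite !clamp_id in T by (unfold unit_itv; lra).
      unfold w, w_of. eapply Rle_trans. exact T.
      apply Rmult_le_compat_l. lra. rewrite <- (pow2_abs (s - x)). apply pow_incr.
      split. apply Rabs_pos. apply Rabs_le_between. lra. }
  apply Rmult_le_compat_l. lra.
  pose proof (B1 x ltac:(lra)). pose proof (Rabs_pos (k - h)).
  assert (Rabs (w1 x) * Rabs (k - h) <= C * (1 + q) * Rabs (k - h)) by (apply Rmult_le_compat_r; lra).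
  assert (0 <= C * (1 + q) * (h + k) ^ 2) by (apply Rmult_le_pos; [lra|apply pow2_ge_0]).
  lra.
Qed.

(* Slope - f_x / f_y, that of the reduced solution: accurate outside the layers when eps <= 1 / N. *)
Lemma truncation_by_reduced_slope (f : R -> R -> R) (m gamma C eps x h k tau E : R) (y y1 w1 w2 : R -> R) :
  0 < gamma -> 0 < eps -> 0 < C -> 0 < h -> 0 < k -> 0 <= x - h -> x + k <= 1 -> 0 <= tau <= 1 ->
  apriori_bounds f m gamma C eps y y1 w1 w2 ->
  (forall s, x - h <= s <= x + k -> layer (sqrt m / eps) s <= E) ->
  let w := w_of f gamma y in let beta := sqrt gamma / eps in
  Rabs (hyp_s (beta * h) * (y (x - h) - y x) + hyp_s (beta * k) * (y (x + k) - y x)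
     - (y x - w x) * (hyp_d (beta * h) + hyp_d (beta * k))
     + tau * (hyp_d (beta * h) * (w (x - h) - w x) + hyp_d (beta * k) * (w (x + k) - w x)))
  <= (hyp_d (beta * h) + hyp_d (beta * k)) *
     (3 * C * Rabs (k - h) + 2 * C * (2 * C * (eps ^ 2 + E) + (h + k) ^ 2)).
Proof.
  intros Hg He HC Hh Hk Hl Hr Ht (Hsol & HF & _ & Hw) HE w beta.
  pose proof Hsol as [Hc D1 D2 _ _].
  assert (He2 : 0 < eps ^ 2) by nra.
  assert (Hb : 0 < beta) by (apply Rdiv_lt_0_compat; [apply sqrt_lt_R0|]; assumption).
  assert (Hb2 : beta ^ 2 = gamma / eps ^ 2).
  { unfold beta. rewrite <- (pow2_sqrt gamma) at 2 by lra. field. lra. }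
  assert (Pz : 0 < beta * h) by (apply Rmult_lt_0_compat; lra).
  assert (PZ : 0 < beta * k) by (apply Rmult_lt_0_compat; lra).
  pose proof (hyp_d_pos _ Pz). pose proof (hyp_d_pos _ PZ).
  destruct (Hw x ltac:(lra)) as [c [Bc Hz]].
  assert (HF' : forall s, x - h <= s <= x + k -> Rabs (f s (y s)) <= C * (eps ^ 2 + E)).
  { intros s Hs. eapply Rle_trans. apply HF. unfold unit_itv; lra.
    specialize (HE s Hs). apply Rmult_le_compat_l; lra. }
  eapply Rle_trans.
  { apply (truncation_error beta h k x c (C * (2 * C * (eps ^ 2 + E) + (h + k) ^ 2)) tau y y1
      (fun s => f s (y s) / eps ^ 2) w); auto.
    - intros s Hs. apply D1. lra.
    - intros s Hs. apply D2. lra.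
    - intros s Hs. rewrite Hb2. unfold w, w_of. field. lra.
    - intros s Hs. eapply Rle_trans. apply Hz. unfold unit_itv; lra.
      apply Rmult_le_compat_l. lra.
      pose proof (HF' x ltac:(lra)). pose proof (HF' s Hs).
      assert ((s - x) ^ 2 <= (h + k) ^ 2).
      { rewrite <- (pow2_abs (s - x)). apply pow_incr.
        split. apply Rabs_pos. apply Rabs_le_between. lra. }
      lra. }
  apply Rmult_le_compat_l. lra.
  pose proof (Rabs_pos (k - h)).
  assert (Rabs c * Rabs (k - h) <= C * Rabs (k - h)) by (apply Rmult_le_compat_r; lra).
  lra.
Qed.

(** * The mesh *)

(** The truncated cube is C^2, so stencils across the transition point 1 / 4 obey the same
    second-difference bound as the others. *)
Definition cube_pos (s : R) : R := Rmax s 0 ^ 3.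

Lemma psi_left_cube_pos (lam tau : R) :
  psi_left lam tau = 4 * lam * tau + 32 * (1 - 4 * lam) * cube_pos (tau - 1 / 4).
Proof.
  unfold psi_left, cube_pos. destruct Rle_dec.
  - rewrite Rmax_right by lra. ring.
  - rewrite Rmax_left by lra. ring.
Qed.

(** 3 / 16 is the derivative of the cube at 1 / 4. *)
Lemma cube_pos_incr (a b : R) : a <= b -> b <= 1 / 4 ->
  0 <= cube_pos b - cube_pos a <= 3 / 16 * (b - a).
Proof.
  intros H Hb. unfold cube_pos.
  assert (A : 0 <= Rmax a 0) by apply Rmax_r.
  assert (B : Rmax a 0 <= Rmax b 0) by (apply Rle_max_compat_r; exact H).
  assert (C : Rmax b 0 <= 1 / 4) by (apply Rmax_lub; lra).
  assert (D : Rmax b 0 - Rmax a 0 <= b - a).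
  { unfold Rmax. repeat destruct Rle_dec; lra. }
  set (u := Rmax a 0) in *. set (v := Rmax b 0) in *.
  replace (v ^ 3 - u ^ 3) with ((v - u) * (v ^ 2 + v * u + u ^ 2)) by ring.
  assert (0 <= v ^ 2 + v * u + u ^ 2 <= 3 / 16) by nra.
  split; nra.
Qed.

Lemma cube_pos_second_difference (s d : R) : 0 < d -> s + d <= 1 / 4 ->
  Rabs (cube_pos (s + d) - 2 * cube_pos s + cube_pos (s - d)) <= 2 * d ^ 2.
Proof.
  intros Hd Hs. unfold cube_pos, Rmax.
  repeat destruct Rle_dec; try lra; apply Rabs_le_between; try nra.
  assert (0 <= (s + d) ^ 2 <= d ^ 2) by nra.
  replace ((s + d) ^ 3) with ((s + d) * (s + d) ^ 2) by ring. nra.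
Qed.

Section Psi.

Context (lam : R) (Hlam : 0 < lam <= 1 / 4).

Lemma psi_left_incr (a b : R) : a < b -> b <= 1 / 2 ->
  0 < psi_left lam b - psi_left lam a <= 7 * (b - a).
Proof.
  intros H Hb. rewrite !psi_left_cube_pos.
  pose proof (cube_pos_incr (a - 1 / 4) (b - 1 / 4)).
  assert (0 < lam * (b - a)) by nra. nra.
Qed.

Lemma psi_left_half : psi_left lam (1 / 2) = 1 / 2.
Proof. unfold psi_left. destruct Rle_dec; lra. Qed.

Lemma psi_reflect (tau : R) : psi lam (1 - tau) = 1 - psi lam tau.
Proof.
  unfold psi. destruct (Rle_dec tau (1 / 2)) as [A|A], (Rle_dec (1 - tau) (1 / 2)) as [B|B]; try lra.
  - assert (tau = 1 / 2) as -> by lra. replace (1 - 1 / 2) with (1 / 2) by lra.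
    rewrite psi_left_half. lra.
  - replace (1 - (1 - tau)) with tau by ring. reflexivity.
Qed.

Lemma psi_incr (a b : R) : a < b -> 0 < psi lam b - psi lam a <= 7 * (b - a).
Proof.
  intros H. unfold psi.
  destruct (Rle_dec a (1 / 2)) as [A|A], (Rle_dec b (1 / 2)) as [B|B]; try lra.
  - apply psi_left_incr; lra.
  - pose proof psi_left_half as P.
    destruct (Req_dec a (1 / 2)) as [->|Na].
    + pose proof (psi_left_incr (1 - b) (1 / 2)). lra.
    + pose proof (psi_left_incr (1 - b) (1 / 2)). pose proof (psi_left_incr a (1 / 2)). lra.
  - pose proof (psi_left_incr (1 - b) (1 - a)). lra.
Qed.

Lemma psi_fine (tau : R) : tau <= 1 / 4 -> psi lam tau = 4 * lam * tau.
Proof. intros H. unfold psi, psi_left. repeat destruct Rle_dec; lra. Qed.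

Lemma psi_second_difference_left (tau d : R) : 0 < d -> tau + d <= 1 / 2 ->
  Rabs (psi lam (tau + d) - 2 * psi lam tau + psi lam (tau - d)) <= 64 * d ^ 2.
Proof.
  intros Hd Ht. unfold psi.
  destruct (Rle_dec (tau + d) (1 / 2)); try lra.
  destruct (Rle_dec tau (1 / 2)); try lra.
  destruct (Rle_dec (tau - d) (1 / 2)); try lra.
  rewrite !psi_left_cube_pos.
  pose proof (cube_pos_second_difference (tau - 1 / 4) d Hd ltac:(lra)) as C.
  replace (tau + d - 1 / 4) with (tau - 1 / 4 + d) by ring.
  replace (tau - d - 1 / 4) with (tau - 1 / 4 - d) by ring.
  set (c := cube_pos (tau - 1 / 4 + d) - 2 * cube_pos (tau - 1 / 4) + cube_pos (tau - 1 / 4 - d)) in *.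
  match goal with |- Rabs ?A <= _ => replace A with (32 * (1 - 4 * lam) * c) by (unfold c; ring) end.
  rewrite Rabs_mult, Rabs_pos_eq by lra.
  pose proof (Rabs_pos c). nra.
Qed.

(** The second derivative of [psi] may jump at 1 / 2. A stencil centred there has second difference
    0 by symmetry, and on a uniform grid with an even number of cells no other stencil crosses 1 /
    2. *)
Lemma psi_second_difference (tau d : R) : 0 < d ->
  tau + d <= 1 / 2 \/ tau = 1 / 2 \/ 1 / 2 <= tau - d ->
  Rabs (psi lam (tau + d) - 2 * psi lam tau + psi lam (tau - d)) <= 64 * d ^ 2.
Proof.
  intros Hd [H|[->|H]].
  - apply psi_second_difference_left; assumption.
  - replace (1 / 2 + d) with (1 - (1 / 2 - d)) by lra. rewrite psi_reflect.
    assert (P : psi lam (1 / 2) = 1 / 2).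
    { unfold psi. destruct Rle_dec; try lra. apply psi_left_half. }
    rewrite P. match goal with |- Rabs ?A <= _ => replace A with 0 by lra end.
    rewrite Rabs_R0. nra.
  - pose proof (psi_second_difference_left (1 - tau) d Hd ltac:(lra)) as L.
    replace (1 - tau + d) with (1 - (tau - d)) in L by ring.
    replace (1 - tau - d) with (1 - (tau + d)) in L by ring.
    rewrite !psi_reflect in L. rewrite <- Rabs_Ropp.
    match goal with |- Rabs ?A <= _ => match type of L with Rabs ?B <= _ =>
      replace A with B by ring end end. exact L.
Qed.

End Psi.

(** The properties on which the error analysis rests. With 4 n cells the nodes n and 3 n are the
    transition points; 7 bounds the slope of [psi], and 64 its second differences divided by the
    squared increment. *)
Record shishkin_mesh (n : nat) (lam H : R) (x : nat -> R) : Prop := {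
  sm_0 : x 0%nat = 0;
  sm_N : x (4 * n)%nat = 1;
  sm_incr : forall i, (i < 4 * n)%nat -> x i < x (i + 1)%nat;
  sm_step : forall i, (i < 4 * n)%nat -> x (i + 1)%nat - x i <= 7 / INR (4 * n);
  sm_left : forall i, (i < n)%nat -> x (i + 1)%nat - x i = H;
  sm_right : forall i, (3 * n <= i < 4 * n)%nat -> x (i + 1)%nat - x i = H;
  sm_ge : forall i, (n <= i <= 4 * n)%nat -> lam <= x i;
  sm_le : forall i, (i <= 3 * n)%nat -> x i <= 1 - lam;
  sm_smooth : forall i, (1 <= i < 4 * n)%nat ->
    Rabs ((x (i + 1)%nat - x i) - (x i - x (i - 1)%nat)) <= 64 / INR (4 * n) ^ 2 }.

Lemma psi_shishkin_mesh (n : nat) (lam : R) : (0 < n)%nat -> 0 < lam <= 1 / 4 ->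
  shishkin_mesh n lam (4 * lam / INR (4 * n)) (fun i => psi lam (INR i / INR (4 * n))).
Proof.
  intros Hn Hl. assert (Pn : 0 < INR n) by (apply lt_0_INR; exact Hn).
  set (M := INR (4 * n)). assert (EM : M = 4 * INR n) by (unfold M; rewrite mult_INR; simpl; ring).
  assert (PM : 0 < M) by lra.
  assert (P1 : forall i, INR (i + 1) / M = INR i / M + 1 / M).
  { intros i. rewrite plus_INR. simpl. field. lra. }
  assert (Le : forall i j, (i <= j)%nat -> INR i / M <= INR j / M).
  { intros i j Hij. apply Rmult_le_compat_r. apply Rlt_le, Rinv_0_lt_compat, PM. apply le_INR, Hij. }
  assert (Pi : 0 < 1 / M) by (apply Rdiv_lt_0_compat; lra).
  assert (Q1 : INR n / M = 1 / 4) by (rewrite EM; field; lra).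
  assert (Q2 : INR (2 * n) / M = 1 / 2) by (rewrite mult_INR, EM; simpl; field; lra).
  assert (Q3 : INR (3 * n) / M = 3 / 4) by (rewrite mult_INR, EM; simpl; field; lra).
  assert (Q4 : INR (4 * n) / M = 1) by (fold M; field; lra).
  assert (F1 : psi lam (1 / 4) = lam) by (rewrite psi_fine by lra; lra).
  assert (F3 : psi lam (3 / 4) = 1 - lam).
  { replace (3 / 4) with (1 - 1 / 4) by lra. rewrite psi_reflect, F1 by exact Hl. ring. }
  assert (Mono : forall a b, a <= b -> psi lam a <= psi lam b).
  { intros a b [H| ->]. pose proof (psi_incr lam Hl a b H). lra. lra. }
  constructor; fold M.
  - rewrite psi_fine. simpl. field. lra. simpl. unfold Rdiv. lra.
  - replace (M / M) with (1 - 0) by (field; lra). rewrite psi_reflect, psi_fine by lra. ring.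
  - intros i Hi. rewrite P1.
    pose proof (psi_incr lam Hl (INR i / M) (INR i / M + 1 / M) ltac:(lra)). lra.
  - intros i Hi. rewrite P1.
    pose proof (psi_incr lam Hl (INR i / M) (INR i / M + 1 / M) ltac:(lra)). lra.
  - intros i Hi. pose proof (Le (i + 1)%nat n ltac:(lia)) as H. rewrite P1 in H |- *.
    rewrite !psi_fine by lra. field. lra.
  - intros i Hi. pose proof (Le (3 * n)%nat i ltac:(lia)). rewrite P1.
    assert (Fr : forall u, 3 / 4 <= u -> psi lam u = 1 - 4 * lam * (1 - u)).
    { intros u Hu. replace u with (1 - (1 - u)) at 1 by ring.
      rewrite psi_reflect, psi_fine by lra. reflexivity. }
    rewrite !Fr by lra. field. lra.
  - intros i Hi. rewrite <- F1 at 1. apply Mono. pose proof (Le n i ltac:(lia)). lra.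
  - intros i Hi. rewrite <- F3. apply Mono. pose proof (Le i (3 * n)%nat ltac:(lia)). lra.
  - intros i Hi.
    assert (Em : INR (i - 1) / M = INR i / M - 1 / M).
    { rewrite minus_INR by lia. simpl. field. lra. }
    rewrite P1, Em.
    replace (64 / M ^ 2) with (64 * (1 / M) ^ 2) by (field; lra).
    match goal with |- Rabs ?A <= _ => replace A with
      (psi lam (INR i / M + 1 / M) - 2 * psi lam (INR i / M) + psi lam (INR i / M - 1 / M)) by ring end.
    apply psi_second_difference. exact Hl. exact Pi.
    destruct (lt_eq_lt_dec i (2 * n)) as [[L|E]|G].
    + left. rewrite <- P1. pose proof (Le (i + 1)%nat (2 * n)%nat ltac:(lia)). lra.
    + right. left. rewrite E. exact Q2.
    + right. right. rewrite <- Em. pose proof (Le (2 * n)%nat (i - 1)%nat ltac:(lia)). lra.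
Qed.

Lemma shishkin_mesh_unit (n : nat) (lam H : R) (x : nat -> R) : shishkin_mesh n lam H x ->
  forall j, (j <= 4 * n)%nat -> unit_itv (x j).
Proof.
  intros Hx.
  assert (Mono : forall d j, (j + d <= 4 * n)%nat -> x j <= x (j + d)%nat).
  { induction d as [|d IH]; intros j Hj. rewrite Nat.add_0_r. lra.
    pose proof (IH j ltac:(lia)). pose proof (sm_incr _ _ _ _ Hx (j + d)%nat ltac:(lia)).
    replace (j + S d)%nat with (j + d + 1)%nat by lia. lra. }
  intros j Hj. unfold unit_itv. rewrite <- (sm_0 _ _ _ _ Hx), <- (sm_N _ _ _ _ Hx). split.
  - apply (Mono j 0%nat). lia.
  - replace (4 * n)%nat with (j + (4 * n - j))%nat by lia. apply Mono. lia.
Qed.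

(** * Rows of the linearised scheme *)

Lemma finite_argmin (u : nat -> R) (N : nat) :
  exists j, (j <= N)%nat /\ forall i, (i <= N)%nat -> u j <= u i.
Proof.
  induction N as [|N [j [Hj Hm]]].
  - exists 0%nat. split. lia. intros i Hi. replace i with 0%nat by lia. lra.
  - destruct (Rle_dec (u j) (u (S N))) as [A|A].
    + exists j. split. lia. intros i Hi. destruct (Nat.eq_dec i (S N)) as [->|]. exact A. apply Hm. lia.
    + exists (S N). split. lia. intros i Hi. destruct (Nat.eq_dec i (S N)) as [->|]. lra.
      assert (u j <= u i) by (apply Hm; lia). lra.
Qed.

(** At a negative minimum u_j the row is at least (P + Q - S) u_j, which is positive by strict
    dominance. *)
Lemma discrete_max_principle (N : nat) (u P Q S : nat -> R) :
  (forall i, (1 <= i < N)%nat -> 0 <= P i /\ 0 <= Q i /\ P i + Q i < S i /\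
     P i * u (i - 1)%nat + Q i * u (i + 1)%nat - S i * u i <= 0) ->
  0 <= u 0%nat -> 0 <= u N -> forall i, (i <= N)%nat -> 0 <= u i.
Proof.
  intros H H0 HN i Hi. destruct (finite_argmin u N) as [j [Hj Hm]].
  cut (0 <= u j). { intros A. specialize (Hm i Hi). lra. }
  destruct (Nat.eq_dec j 0) as [->|]. exact H0.
  destruct (Nat.eq_dec j N) as [->|]. exact HN.
  apply Rnot_lt_le. intros Neg.
  destruct (H j ltac:(lia)) as (A & B & C & D).
  pose proof (Hm (j - 1)%nat ltac:(lia)). pose proof (Hm (j + 1)%nat ltac:(lia)).
  assert (P j * u j <= P j * u (j - 1)%nat) by (apply Rmult_le_compat_l; assumption).
  assert (Q j * u j <= Q j * u (j + 1)%nat) by (apply Rmult_le_compat_l; assumption).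
  assert ((P j + Q j - S j) * u j > 0) by nra. lra.
Qed.

(* The row of the linearized scheme: [z1], [z2] are the scaled mesh sizes left and right of the
   node and [q1], [q], [q2] the difference quotients of f / gamma at the three nodes. *)
Definition row_weight (t z q : R) : R := hyp_s z + (1 - t) * hyp_d z * (1 - q).
Definition row_diag (t z1 z2 q : R) : R :=
  hyp_s z1 + hyp_s z2 + (1 - t) * (hyp_d z1 + hyp_d z2) * (1 - q) + q * (hyp_d z1 + hyp_d z2).
Definition row (t z1 z2 q1 q q2 e1 e e2 : R) : R :=
  row_weight t z1 q1 * e1 + row_weight t z2 q2 * e2 - row_diag t z1 z2 q * e.

Lemma row_swap (t z1 z2 q1 q q2 e1 e e2 : R) :
  row t z1 z2 q1 q q2 e1 e e2 = row t z2 z1 q2 q q1 e2 e e1.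
Proof. unfold row, row_diag. ring. Qed.

(** This is where gamma >= f_y acts: q <= 1 keeps the off-diagonal entries positive for every t in
    [0, 1]. *)
Lemma row_weight_pos (t z q : R) : 0 < z -> 0 <= t <= 1 -> q <= 1 -> 0 < row_weight t z q.
Proof.
  intros Hz Ht Hq. unfold row_weight. pose proof (hyp_s_pos z Hz). pose proof (hyp_d_pos z Hz).
  assert (0 <= (1 - t) * hyp_d z * (1 - q)).
  { apply Rmult_le_pos. apply Rmult_le_pos; lra. lra. }
  lra.
Qed.

(** The [hyp_s] terms cancel, and the sum equals - (1 - t) (d1 q1 + d2 q2) - t q (d1 + d2), where d1
    and d2 are the values of [hyp_d]. *)
Lemma row_sum_le (t z1 z2 q1 q q2 kappa : R) : 0 < z1 -> 0 < z2 -> 0 <= t <= 1 ->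
  kappa <= q1 -> kappa <= q -> kappa <= q2 ->
  row_weight t z1 q1 + row_weight t z2 q2 - row_diag t z1 z2 q <= - kappa * (hyp_d z1 + hyp_d z2).
Proof.
  intros Z1 Z2 Ht H1 H H2. unfold row_weight, row_diag.
  pose proof (hyp_d_pos z1 Z1) as D1. pose proof (hyp_d_pos z2 Z2) as D2.
  set (d1 := hyp_d z1) in *. set (d2 := hyp_d z2) in *.
  assert (0 <= (1 - t) * d1 * (q1 - kappa)).
  { apply Rmult_le_pos. apply Rmult_le_pos; lra. lra. }
  assert (0 <= (1 - t) * d2 * (q2 - kappa)).
  { apply Rmult_le_pos. apply Rmult_le_pos; lra. lra. }
  assert (0 <= t * (d1 + d2) * (q - kappa)).
  { apply Rmult_le_pos. apply Rmult_le_pos; lra. lra. }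
  lra.
Qed.

(** * Action of the rows on exponential grid functions *)

Lemma exp_ge_quadratic (a : R) : 0 <= a -> 1 + a + a ^ 2 / 2 <= exp a.
Proof.
  intros H.
  assert (D : forall u, is_derive (fun u => exp u - u - u ^ 2 / 2) u (exp u - 1 - u)).
  { intros u. auto_derive; auto. field. }
  assert (exp 0 - 0 - 0 ^ 2 / 2 <= exp a - a - a ^ 2 / 2); [|rewrite exp_0 in *; lra].
  apply (increasing_ge (fun u => exp u - u - u ^ 2 / 2) (fun u => exp u - 1 - u)); auto.
  - intros u _. eapply is_derive_continuous, D.
  - intros u Hu. pose proof (exp_ineq1_le u). lra.
Qed.

Lemma exp_neg_le_quadratic (a : R) : 0 <= a -> exp (- a) <= 1 - a + a ^ 2 / 2.
Proof.
  intros H.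
  assert (D : forall u, is_derive (fun u => 1 - u + u ^ 2 / 2 - exp (- u)) u (- 1 + u + exp (- u))).
  { intros u. auto_derive; auto. field. }
  assert (1 - 0 + 0 ^ 2 / 2 - exp (- 0) <= 1 - a + a ^ 2 / 2 - exp (- a)).
  2: { rewrite Ropp_0, exp_0 in *. lra. }
  apply (increasing_ge (fun u => 1 - u + u ^ 2 / 2 - exp (- u)) (fun u => - 1 + u + exp (- u))); auto.
  - intros u _. eapply is_derive_continuous, D.
  - intros u Hu. pose proof (exp_ineq1_le (- u)). lra.
Qed.

Lemma exp_sub_1_le (a : R) : 0 <= a -> exp a - 1 <= a + a ^ 2 / 2 * exp a.
Proof.
  intros H.
  assert (D : forall u, is_derive (fun u => u + u ^ 2 / 2 * exp u - exp u + 1) u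
     (1 + u * exp u + u ^ 2 / 2 * exp u - exp u)).
  { intros u. auto_derive; auto. field. }
  assert (G : 0 + 0 ^ 2 / 2 * exp 0 - exp 0 + 1 <= a + a ^ 2 / 2 * exp a - exp a + 1).
  2: { rewrite exp_0 in G. lra. }
  apply (increasing_ge (fun u => u + u ^ 2 / 2 * exp u - exp u + 1)
    (fun u => 1 + u * exp u + u ^ 2 / 2 * exp u - exp u)); auto.
  - intros u _. eapply is_derive_continuous, D.
  - intros u Hu. pose proof (exp_ineq1_le (- u)).
    assert (J : exp u * exp (- u) = 1) by (rewrite <- exp_plus, <- exp_0; f_equal; ring).
    pose proof (exp_pos u). nra.
Qed.

(** On unequal cells the first-order terms theta (z1 s1 - z2 s2), with s1 and s2 the values of
    [hyp_s], do not cancel. They are at most theta d2 because z1 s1 <= 1 and 1 - z2 s2 <= d2, which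
    a small theta makes harmless against kappa. The last term of the bound is kept apart, being
    small only on a resolved cell. *)
Lemma row_exponential (t z1 z2 q1 q q2 kappa theta b : R) :
  0 < z1 -> 0 < z2 -> 0 <= t <= 1 -> 0 < theta -> 0 < b -> 0 < kappa ->
  kappa <= q1 <= 1 -> kappa <= q <= 1 -> kappa <= q2 <= 1 ->
  row t z1 z2 q1 q q2 (b * exp (theta * z1)) b (b * exp (- (theta * z2)))
   <= (hyp_d z1 + hyp_d z2) * ((theta + theta ^ 2 - kappa) * b + theta ^ 2 * (b * exp (theta * z1)))
      + hyp_d z1 * (b * exp (theta * z1) - b).
Proof.
  intros Z1 Z2 Ht Hth Hb Hk H1 H H2.
  pose proof (hyp_d_pos z1 Z1) as D1. pose proof (hyp_d_pos z2 Z2) as D2.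
  pose proof (hyp_s_pos z1 Z1) as S1. pose proof (hyp_s_pos z2 Z2) as S2.
  pose proof (row_sum_le t z1 z2 q1 q q2 kappa Z1 Z2 Ht) as RS.
  assert (RS' := RS ltac:(lra) ltac:(lra) ltac:(lra)). clear RS.
  pose proof (sq_hyp_s_le z1 Z1) as Q1. pose proof (sq_hyp_s_le z2 Z2) as Q2.
  pose proof (id_hyp_s_le_1 z1 Z1) as I1.
  pose proof (one_minus_id_hyp_s_le z2 Z2) as I2.
  assert (A1 : 0 <= theta * z1) by nra. assert (A2 : 0 <= theta * z2) by nra.
  pose proof (exp_sub_1_le _ A1) as E1. pose proof (exp_neg_le_quadratic _ A2) as E2.
  set (x1 := exp (theta * z1)) in *. set (x2 := exp (- (theta * z2))) in *.
  assert (X1 : 1 <= x1) by (unfold x1; pose proof (exp_ineq1_le (theta * z1)); lra).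
  assert (X2 : x2 <= 1).
  { unfold x2. apply exp_le_1. lra. }
  unfold row_weight in RS'. unfold row, row_weight.
  set (d1 := hyp_d z1) in *. set (d2 := hyp_d z2) in *.
  set (s1 := hyp_s z1) in *. set (s2 := hyp_s z2) in *.
  set (S := row_diag t z1 z2 q) in *.
  replace ((s1 + (1 - t) * d1 * (1 - q1)) * (b * x1) + (s2 + (1 - t) * d2 * (1 - q2)) * (b * x2) - S * b)
   with (b * (s1 * (x1 - 1) + s2 * (x2 - 1)
         + (1 - t) * (1 - q1) * (d1 * (x1 - 1)) + (1 - t) * (1 - q2) * d2 * (x2 - 1)
         + (s1 + (1 - t) * d1 * (1 - q1) + (s2 + (1 - t) * d2 * (1 - q2)) - S))) by ring.
  replace ((d1 + d2) * ((theta + theta ^ 2 - kappa) * b + theta ^ 2 * (b * x1)) + d1 * (b * x1 - b))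
   with (b * ((d1 + d2) * (theta + theta ^ 2 - kappa + theta ^ 2 * x1) + d1 * (x1 - 1))) by ring.
  apply Rmult_le_compat_l. lra.
  assert (T1 : s1 * (x1 - 1) <= theta * (z1 * s1) + theta ^ 2 * (d1 * x1)).
  { apply Rle_trans with (s1 * (theta * z1 + (theta * z1) ^ 2 / 2 * x1)).
    apply Rmult_le_compat_l; lra.
    replace (s1 * (theta * z1 + (theta * z1) ^ 2 / 2 * x1)) with
      (theta * (z1 * s1) + theta ^ 2 * (z1 ^ 2 * s1 / 2 * x1)) by field.
    apply Rplus_le_compat_l. apply Rmult_le_compat_l. apply pow2_ge_0.
    apply Rmult_le_compat_r; lra. }
  assert (T2 : s2 * (x2 - 1) <= - theta * (z2 * s2) + theta ^ 2 * d2).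
  { apply Rle_trans with (s2 * (- (theta * z2) + (theta * z2) ^ 2 / 2)).
    apply Rmult_le_compat_l; lra.
    replace (s2 * (- (theta * z2) + (theta * z2) ^ 2 / 2)) with
      (- theta * (z2 * s2) + theta ^ 2 * (z2 ^ 2 * s2 / 2)) by field.
    apply Rplus_le_compat_l. apply Rmult_le_compat_l. apply pow2_ge_0. lra. }
  assert (T3 : theta * (z1 * s1) - theta * (z2 * s2) <= theta * d2).
  { rewrite <- Rmult_minus_distr_l. apply Rmult_le_compat_l; lra. }
  assert (T4 : (1 - t) * (1 - q1) * (d1 * (x1 - 1)) <= d1 * (x1 - 1)).
  { rewrite <- (Rmult_1_l (d1 * (x1 - 1))) at 2. apply Rmult_le_compat_r.
    apply Rmult_le_pos; lra. nra. }
  assert (T5 : (1 - t) * (1 - q2) * d2 * (x2 - 1) <= 0).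
  { assert (0 <= (1 - t) * (1 - q2) * d2 * (1 - x2)).
    { apply Rmult_le_pos. apply Rmult_le_pos. apply Rmult_le_pos; lra. lra. lra. }
    lra. }
  assert (U1 : theta * d2 <= theta * (d1 + d2)) by (apply Rmult_le_compat_l; lra).
  assert (0 <= theta ^ 2) by apply pow2_ge_0.
  assert (U2 : theta ^ 2 * d2 <= theta ^ 2 * (d1 + d2)) by (apply Rmult_le_compat_l; lra).
  assert (U3 : theta ^ 2 * (d1 * x1) <= theta ^ 2 * ((d1 + d2) * x1)).
  { apply Rmult_le_compat_l. lra. apply Rmult_le_compat_r; lra. }
  lra.
Qed.

(* The factor 1 / 64 makes the perturbation terms of [row_exponential] consume at most half of [kappa]. *)
Lemma row_exponential_resolved (t z1 z2 q1 q q2 kappa theta b : R) :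
  0 < z1 -> 0 < z2 -> 0 <= t <= 1 -> 0 < b -> 0 < kappa <= 1 -> 0 < theta <= kappa / 64 ->
  kappa <= q1 <= 1 -> kappa <= q <= 1 -> kappa <= q2 <= 1 -> theta * z1 <= kappa / 8 ->
  row t z1 z2 q1 q q2 (b * exp (theta * z1)) b (b * exp (- (theta * z2)))
   <= - (kappa / 2) * ((hyp_d z1 + hyp_d z2) * b).
Proof.
  intros Z1 Z2 Ht Hb Hk Hth H1 H H2 Hz.
  eapply Rle_trans. apply (row_exponential t z1 z2 q1 q q2 kappa theta b); tauto || lra.
  pose proof (hyp_d_pos z1 Z1) as D1. pose proof (hyp_d_pos z2 Z2) as D2.
  assert (A1 : 0 <= theta * z1) by nra.
  assert (X : exp (theta * z1) <= 1 + kappa / 4).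
  { pose proof (exp_neg_le_quadratic _ A1). pose proof (exp_ineq1_le (- (theta * z1))).
    assert (J : exp (theta * z1) * exp (- (theta * z1)) = 1)
      by (rewrite <- exp_plus, <- exp_0; f_equal; ring).
    pose proof (exp_pos (theta * z1)). nra. }
  assert (X1 : 1 <= exp (theta * z1)) by (pose proof (exp_ineq1_le (theta * z1)); lra).
  set (x := exp (theta * z1)) in *. set (d1 := hyp_d z1) in *. set (d2 := hyp_d z2) in *.
  replace ((d1 + d2) * ((theta + theta ^ 2 - kappa) * b + theta ^ 2 * (b * x)) + d1 * (b * x - b))
   with (b * ((d1 + d2) * (theta + theta ^ 2 - kappa + theta ^ 2 * x) + d1 * (x - 1))) by ring.
  replace (- (kappa / 2) * ((d1 + d2) * b)) with (b * ((d1 + d2) * (- (kappa / 2)))) by ring.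
  apply Rmult_le_compat_l. lra.
  apply Rle_trans with ((d1 + d2) * (theta + theta ^ 2 - kappa + theta ^ 2 * x + (x - 1))).
  - assert (d1 * (x - 1) <= (d1 + d2) * (x - 1)) by (apply Rmult_le_compat_r; lra). lra.
  - apply Rmult_le_compat_l. lra.
    assert (theta ^ 2 <= kappa / 64) by nra.
    assert (theta ^ 2 * x <= kappa / 64 * 2) by (apply Rmult_le_compat; try lra; apply pow2_ge_0).
    lra.
Qed.

(** With theta z1 arbitrary the exponential need not be a supersolution. Everything is charged to
    its larger neighbouring value, which beyond the transition point is itself at most exp (- mu
    lambda). *)
Lemma row_exponential_coarse (t z1 z2 q1 q q2 kappa theta b : R) :
  0 < z1 -> 0 < z2 -> 0 <= t <= 1 -> 0 < b -> 0 < kappa <= 1 -> 0 < theta <= kappa / 64 ->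
  kappa <= q1 <= 1 -> kappa <= q <= 1 -> kappa <= q2 <= 1 ->
  row t z1 z2 q1 q q2 (b * exp (theta * z1)) b (b * exp (- (theta * z2)))
   <= 3 * ((hyp_d z1 + hyp_d z2) * (b * exp (theta * z1))).
Proof.
  intros Z1 Z2 Ht Hb Hk Hth H1 H H2.
  eapply Rle_trans. apply (row_exponential t z1 z2 q1 q q2 kappa theta b); tauto || lra.
  pose proof (hyp_d_pos z1 Z1) as D1. pose proof (hyp_d_pos z2 Z2) as D2.
  assert (A1 : 0 <= theta * z1) by nra.
  assert (X1 : 1 <= exp (theta * z1)) by (pose proof (exp_ineq1_le (theta * z1)); lra).
  set (x := exp (theta * z1)) in *. set (d1 := hyp_d z1) in *. set (d2 := hyp_d z2) in *.
  replace ((d1 + d2) * ((theta + theta ^ 2 - kappa) * b + theta ^ 2 * (b * x)) + d1 * (b * x - b))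
   with (b * ((d1 + d2) * (theta + theta ^ 2 - kappa + theta ^ 2 * x) + d1 * (x - 1))) by ring.
  replace (3 * ((d1 + d2) * (b * x))) with (b * ((d1 + d2) * (3 * x))) by ring.
  apply Rmult_le_compat_l. lra.
  apply Rle_trans with ((d1 + d2) * (theta + theta ^ 2 - kappa + theta ^ 2 * x + (x - 1))).
  - assert (d1 * (x - 1) <= (d1 + d2) * (x - 1)) by (apply Rmult_le_compat_r; lra). lra.
  - apply Rmult_le_compat_l. lra.
    assert (0 <= theta ^ 2 <= 1) by nra. assert (theta ^ 2 * x <= 1 * x) by (apply Rmult_le_compat_r; lra).
    lra.
Qed.

(** * Stability of the scheme *)

Definition step (x : nat -> R) (j : nat) : R := x (j + 1)%nat - x j.

Definition row_at (t beta : R) (x q e : nat -> R) (i : nat) : R :=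
  row t (beta * step x (i - 1)) (beta * step x i)
    (q (i - 1)%nat) (q i) (q (i + 1)%nat) (e (i - 1)%nat) (e i) (e (i + 1)%nat).

Definition row_d (beta : R) (x : nat -> R) (i : nat) : R :=
  hyp_d (beta * step x (i - 1)) + hyp_d (beta * step x i).

Definition decay_left (mu : R) (x : nat -> R) (i : nat) : R := exp (- (mu * x i)).
Definition decay_right (mu : R) (x : nat -> R) (i : nat) : R := exp (- (mu * (1 - x i))).

Section Stability.

(** [theta] is the decay rate in the scaled variable beta x, and [mu] the one in x. The identity for
    theta beta and a H <= 8 give theta beta H <= kappa / 8, the condition for a resolved cell. *)
Context (n : nat) (lam H : R) (x : nat -> R) (a beta kappa theta t : R) (q : nat -> R).
Context (Hx : shishkin_mesh n lam H x).
Context (Hb : 0 < beta) (Hk : 0 < kappa <= 1) (Hth : 0 < theta <= kappa / 64).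
Context (Hmu : theta * beta = kappa / 64 * a) (HaH : a * H <= 8) (Ht : 0 <= t <= 1).
Context (Hq : forall i, (i <= 4 * n)%nat -> kappa <= q i <= 1).

Let mu := theta * beta.
Let G := exp (- (mu * lam)).

Lemma step_pos (i : nat) : (i < 4 * n)%nat -> 0 < step x i.
Proof. intros Hi. unfold step. pose proof (sm_incr _ _ _ _ Hx i Hi). lra. Qed.

Lemma step_pred (i : nat) : (1 <= i)%nat -> step x (i - 1) = x i - x (i - 1)%nat.
Proof. intros Hi. unfold step. replace (i - 1 + 1)%nat with i by lia. reflexivity. Qed.

(** The exponential grows to the left, so only the left cell has to be fine, which holds up to i = n
    inclusive. For i > n both x_(i-1) and x_i are at least [lam]; 4 G then absorbs the coarse bound
    3 G and the term kappa / 2 times the value, at most G / 2. *)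
Lemma row_decay_left (i : nat) : (1 <= i < 4 * n)%nat ->
  row_at t beta x q (decay_left mu x) i
    <= row_d beta x i * (- (kappa / 2) * decay_left mu x i + 4 * G).
Proof.
  intros Hi.
  pose proof (step_pos (i - 1) ltac:(lia)) as P1. pose proof (step_pos i ltac:(lia)) as P2.
  assert (Z1 : 0 < beta * step x (i - 1)) by (apply Rmult_lt_0_compat; assumption).
  assert (Z2 : 0 < beta * step x i) by (apply Rmult_lt_0_compat; assumption).
  pose proof (hyp_d_pos _ Z1). pose proof (hyp_d_pos _ Z2).
  assert (E1 : decay_left mu x (i - 1) = decay_left mu x i * exp (theta * (beta * step x (i - 1)))).
  { unfold decay_left. rewrite <- exp_plus. f_equal. rewrite step_pred by lia. unfold mu. ring. }
  assert (E2 : decay_left mu x (i + 1) = decay_left mu x i * exp (- (theta * (beta * step x i)))).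
  { unfold decay_left. rewrite <- exp_plus. f_equal. unfold step, mu. ring. }
  assert (B : 0 < decay_left mu x i) by apply exp_pos.
  assert (PG : 0 < G) by apply exp_pos.
  unfold row_at, row_d. rewrite E1, E2.
  destruct (le_lt_dec i n) as [L|L].
  - eapply Rle_trans.
    { apply (row_exponential_resolved _ _ _ _ _ _ kappa theta); try (apply Hq; lia); auto.
      replace (step x (i - 1)) with H by (symmetry; apply (sm_left _ _ _ _ Hx); lia).
      rewrite <- Rmult_assoc, Hmu. nra. }
    nra.
  - eapply Rle_trans.
    { apply (row_exponential_coarse _ _ _ _ _ _ kappa theta); try (apply Hq; lia); auto. }
    rewrite <- E1.
    assert (Mu0 : 0 < mu) by (unfold mu; apply Rmult_lt_0_compat; lra).
    assert (D1 : decay_left mu x (i - 1) <= G).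
    { apply exp_le. pose proof (sm_ge _ _ _ _ Hx (i - 1)%nat ltac:(lia)). nra. }
    assert (D2 : decay_left mu x i <= G).
    { apply exp_le. pose proof (sm_ge _ _ _ _ Hx i ltac:(lia)). nra. }
    set (d := hyp_d (beta * step x (i - 1)) + hyp_d (beta * step x i)) in *.
    replace (3 * (d * decay_left mu x (i - 1))) with (d * (3 * decay_left mu x (i - 1))) by ring.
    apply Rmult_le_compat_l. unfold d; lra. nra.
Qed.

Lemma row_decay_right (i : nat) : (1 <= i < 4 * n)%nat ->
  row_at t beta x q (decay_right mu x) i
    <= row_d beta x i * (- (kappa / 2) * decay_right mu x i + 4 * G).
Proof.
  intros Hi.
  pose proof (step_pos (i - 1) ltac:(lia)) as P1. pose proof (step_pos i ltac:(lia)) as P2.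
  assert (Z1 : 0 < beta * step x (i - 1)) by (apply Rmult_lt_0_compat; assumption).
  assert (Z2 : 0 < beta * step x i) by (apply Rmult_lt_0_compat; assumption).
  pose proof (hyp_d_pos _ Z1). pose proof (hyp_d_pos _ Z2).
  assert (E1 : decay_right mu x (i - 1) = decay_right mu x i * exp (- (theta * (beta * step x (i - 1))))).
  { unfold decay_right. rewrite <- exp_plus. f_equal. rewrite step_pred by lia. unfold mu. ring. }
  assert (E2 : decay_right mu x (i + 1) = decay_right mu x i * exp (theta * (beta * step x i))).
  { unfold decay_right. rewrite <- exp_plus. f_equal. unfold step, mu. ring. }
  assert (B : 0 < decay_right mu x i) by apply exp_pos.
  assert (PG : 0 < G) by apply exp_pos.
  unfold row_at, row_d. rewrite row_swap, E1, E2.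
  rewrite (Rplus_comm (hyp_d (beta * step x (i - 1)))).
  (* Here the right cell decides, and it is fine from i = 3 n on. *)
  destruct (le_lt_dec (3 * n) i) as [L|L].
  - eapply Rle_trans.
    { apply (row_exponential_resolved _ _ _ _ _ _ kappa theta); try (apply Hq; lia); auto.
      replace (step x i) with H by (symmetry; apply (sm_right _ _ _ _ Hx); lia).
      rewrite <- Rmult_assoc, Hmu. nra. }
    nra.
  - eapply Rle_trans.
    { apply (row_exponential_coarse _ _ _ _ _ _ kappa theta); try (apply Hq; lia); auto. }
    rewrite <- E2.
    assert (Mu0 : 0 < mu) by (unfold mu; apply Rmult_lt_0_compat; lra).
    assert (D1 : decay_right mu x (i + 1) <= G).
    { apply exp_le. pose proof (sm_le _ _ _ _ Hx (i + 1)%nat ltac:(lia)). nra. }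
    assert (D2 : decay_right mu x i <= G).
    { apply exp_le. pose proof (sm_le _ _ _ _ Hx i ltac:(lia)). nra. }
    set (d := hyp_d (beta * step x i) + hyp_d (beta * step x (i - 1))) in *.
    replace (3 * (d * decay_right mu x (i + 1))) with (d * (3 * decay_right mu x (i + 1))) by ring.
    apply Rmult_le_compat_l. unfold d; lra. nra.
Qed.

(** The constant 8 / kappa G contributes at most - 8 G D to a row with weight D, which cancels the
    surplus 4 G D of each of the two exponentials. The remaining rate kappa / 2 produces the factor
    2 / kappa. *)
Lemma error_le_barrier (A B K : R) (e : nat -> R) :
  0 <= A -> 0 <= B -> 0 <= K -> e 0%nat = 0 -> e (4 * n)%nat = 0 ->
  (forall i, (1 <= i < 4 * n)%nat -> Rabs (row_at t beta x q e i)
     <= K * row_d beta x i * (A + B * (decay_left mu x i + decay_right mu x i))) ->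
  forall i, (i <= 4 * n)%nat -> Rabs (e i)
     <= 2 * K / kappa * (A + B * (decay_left mu x i + decay_right mu x i + 8 / kappa * G)).
Proof.
  intros HA HB HK H0 HN Hr.
  set (V := 2 * K / kappa).
  assert (HV : 0 <= V).
  { unfold V. apply Rdiv_le_0_compat; lra. }
  assert (PG : 0 < G) by apply exp_pos.
  assert (Hc : 0 < 8 / kappa * G) by (apply Rmult_lt_0_compat; [apply Rdiv_lt_0_compat|]; lra).
  set (v := fun i => V * (A + B * (decay_left mu x i + decay_right mu x i + 8 / kappa * G))).
  assert (Vpos : forall i, 0 <= v i).
  { intros i. unfold v. apply Rmult_le_pos. exact HV.
    assert (0 < decay_left mu x i) by apply exp_pos. assert (0 < decay_right mu x i) by apply exp_pos.
    assert (0 <= B * (decay_left mu x i + decay_right mu x i + 8 / kappa * G)).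
    { apply Rmult_le_pos; lra. } lra. }
  assert (Rv : forall i, (1 <= i < 4 * n)%nat -> row_at t beta x q v i
     <= - (K * row_d beta x i * (A + B * (decay_left mu x i + decay_right mu x i)))).
  { intros i Hi.
    pose proof (row_decay_left i Hi) as RL. pose proof (row_decay_right i Hi) as RR.
    pose proof (step_pos (i - 1) ltac:(lia)) as P1. pose proof (step_pos i ltac:(lia)) as P2.
    assert (Z1 : 0 < beta * step x (i - 1)) by (apply Rmult_lt_0_compat; assumption).
    assert (Z2 : 0 < beta * step x i) by (apply Rmult_lt_0_compat; assumption).
    pose proof (hyp_d_pos _ Z1). pose proof (hyp_d_pos _ Z2).
    pose proof (row_sum_le t _ _ (q (i - 1)%nat) (q i) (q (i + 1)%nat) kappa Z1 Z2 Ht) as RS.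
    assert (RS' := RS ltac:(apply Hq; lia) ltac:(apply Hq; lia) ltac:(apply Hq; lia)). clear RS.
    fold (row_d beta x i) in RS'.
    assert (Pd : 0 < row_d beta x i) by (unfold row_d; lra).
    set (W := row_weight t (beta * step x (i - 1)) (q (i - 1)%nat) +
       row_weight t (beta * step x i) (q (i + 1)%nat) -
       row_diag t (beta * step x (i - 1)) (beta * step x i) (q i)) in *.
    assert (Lin : row_at t beta x q v i = V * (A * W + B * (row_at t beta x q (decay_left mu x) i
        + row_at t beta x q (decay_right mu x) i + 8 / kappa * G * W))).
    { unfold row_at, row, v, W. ring. }
    rewrite Lin. set (d := row_d beta x i) in *.
    set (bl := decay_left mu x i) in *. set (br := decay_right mu x i) in *.
    assert (0 < bl) by apply exp_pos. assert (0 < br) by apply exp_pos.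
    assert (I1 : 8 / kappa * G * W <= 8 / kappa * G * (- kappa * d)) by (apply Rmult_le_compat_l; lra).
    replace (8 / kappa * G * (- kappa * d)) with (- (8 * G * d)) in I1 by (field; lra).
    assert (I2 : A * W <= A * (- kappa * d)) by (apply Rmult_le_compat_l; lra).
    assert (I3 : B * (row_at t beta x q (decay_left mu x) i + row_at t beta x q (decay_right mu x) i
          + 8 / kappa * G * W) <= B * (- (kappa / 2) * d * (bl + br))) by (apply Rmult_le_compat_l; lra).
    apply Rle_trans with (V * (- (kappa / 2) * d * (A + B * (bl + br)))).
    - apply Rmult_le_compat_l. exact HV.
      assert (0 <= A * (kappa / 2 * d)) by (apply Rmult_le_pos; nra). lra.
    - apply Req_le. unfold V. field. lra. }
  assert (Main : forall sg, sg = 1 \/ sg = -1 -> forall i, (i <= 4 * n)%nat -> 0 <= v i - sg * e i).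
  { intros sg Hsg. apply (discrete_max_principle (4 * n) (fun i => v i - sg * e i)
      (fun i => row_weight t (beta * step x (i - 1)) (q (i - 1)%nat))
      (fun i => row_weight t (beta * step x i) (q (i + 1)%nat))
      (fun i => row_diag t (beta * step x (i - 1)) (beta * step x i) (q i))).
    - intros i Hi.
      pose proof (step_pos (i - 1) ltac:(lia)) as P1. pose proof (step_pos i ltac:(lia)) as P2.
      assert (Z1 : 0 < beta * step x (i - 1)) by (apply Rmult_lt_0_compat; assumption).
      assert (Z2 : 0 < beta * step x i) by (apply Rmult_lt_0_compat; assumption).
      pose proof (hyp_d_pos _ Z1). pose proof (hyp_d_pos _ Z2).
      pose proof (Hq (i - 1)%nat ltac:(lia)) as Q1. pose proof (Hq i ltac:(lia)) as Q.
      pose proof (Hq (i + 1)%nat ltac:(lia)) as Q2.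
      split; [apply Rlt_le, row_weight_pos; tauto|]. split; [apply Rlt_le, row_weight_pos; tauto|].
      split.
      + pose proof (row_sum_le t _ _ (q (i - 1)%nat) (q i) (q (i + 1)%nat) kappa Z1 Z2 Ht) as RS.
        assert (RS' := RS ltac:(tauto) ltac:(tauto) ltac:(tauto)).
        assert (0 < kappa * (hyp_d (beta * step x (i - 1)) + hyp_d (beta * step x i))) by nra. lra.
      + match goal with |- ?L <= 0 => replace L with
          (row_at t beta x q v i - sg * row_at t beta x q e i) by (unfold row_at, row; ring) end.
        specialize (Rv i Hi). specialize (Hr i Hi). apply Rabs_le_between in Hr.
        destruct Hsg as [-> | ->]; lra.
    - rewrite H0. specialize (Vpos 0%nat). lra.
    - rewrite HN. specialize (Vpos (4 * n)%nat). lra. }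
  intros i Hi. fold (v i).
  pose proof (Main 1 (or_introl eq_refl) i Hi). pose proof (Main (-1) (or_intror eq_refl) i Hi).
  apply Rabs_le_between. lra.
Qed.

End Stability.

(** * The scheme and its exact linearisation *)

Definition scheme (f : R -> R -> R) (t gamma beta : R) (x u : nat -> R) (i : nat) : R :=
  let w j := u j - f (x j) (u j) / gamma in
  let d1 := hyp_d (beta * step x (i - 1)) in let d2 := hyp_d (beta * step x i) in
  hyp_s (beta * step x (i - 1)) * (u (i - 1)%nat - u i) + hyp_s (beta * step x i) * (u (i + 1)%nat - u i)
  - (u i - w i) * (d1 + d2)
  + (1 - t) * (d1 * (w (i - 1)%nat - w i) + d2 * (w (i + 1)%nat - w i)).

(** Since ((1 - t) cosh z + t) / sinh z = [hyp_s z] + (1 - t) [hyp_d z] and f / gamma = u - w, the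
    bracket of [T] is the expression estimated in [truncation_error] with tau = 1 - t. *)
Lemma T_scheme (f : R -> R -> R) (t gamma eps : R) (N : nat) (x u : nat -> R) (i : nat) :
  (1 <= i < N)%nat -> 0 < gamma ->
  0 < sqrt gamma / eps * step x (i - 1) -> 0 < sqrt gamma / eps * step x i ->
  T f t gamma eps N x u i =
  gamma / row_d (sqrt gamma / eps) x i * scheme f t gamma (sqrt gamma / eps) x u i.
Proof.
  intros Hi Hg Z1 Z2. unfold T.
  replace (i =? 0)%nat with false by (symmetry; apply Nat.eqb_neq; lia).
  replace (i =? N)%nat with false by (symmetry; apply Nat.eqb_neq; lia).
  cbv zeta. fold (step x (i - 1)). fold (step x i).
  set (z1 := sqrt gamma / eps * step x (i - 1)) in *. set (z2 := sqrt gamma / eps * step x i) in *.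
  unfold scheme, row_d. fold z1 z2.
  pose proof (sinh_pos z1 Z1). pose proof (sinh_pos z2 Z2).
  fold (hyp_d z1) (hyp_d z2). f_equal.
  replace (((1 - t) * cosh z1 + t) / sinh z1) with (hyp_s z1 + (1 - t) * hyp_d z1)
    by (unfold hyp_s, hyp_d; field; lra).
  replace (((1 - t) * cosh z2 + t) / sinh z2) with (hyp_s z2 + (1 - t) * hyp_d z2)
    by (unfold hyp_s, hyp_d; field; lra).
  field. lra.
Qed.

Lemma scheme_difference (f : R -> R -> R) (t gamma beta : R) (x u v q : nat -> R) (i : nat) :
  0 < gamma ->
  (forall j, (i - 1 <= j <= i + 1)%nat -> f (x j) (u j) - f (x j) (v j) = gamma * q j * (u j - v j)) ->
  scheme f t gamma beta x u i - scheme f t gamma beta x v i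
  = row_at t beta x q (fun j => u j - v j) i.
Proof.
  intros Hg Hq.
  pose proof (Hq (i - 1)%nat ltac:(lia)) as A. pose proof (Hq i ltac:(lia)) as B.
  pose proof (Hq (i + 1)%nat ltac:(lia)) as C.
  unfold scheme, row_at, row, row_weight, row_diag.
  replace (f (x (i - 1)%nat) (u (i - 1)%nat)) with
    (f (x (i - 1)%nat) (v (i - 1)%nat) + gamma * q (i - 1)%nat * (u (i - 1)%nat - v (i - 1)%nat)) by lra.
  replace (f (x i) (u i)) with (f (x i) (v i) + gamma * q i * (u i - v i)) by lra.
  replace (f (x (i + 1)%nat) (u (i + 1)%nat)) with
    (f (x (i + 1)%nat) (v (i + 1)%nat) + gamma * q (i + 1)%nat * (u (i + 1)%nat - v (i + 1)%nat)) by lra.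
  field. lra.
Qed.

(** The bounds on f_y hold for all values of y, so q is controlled whatever the size of the discrete
    solution. *)
Lemma difference_quotients (f : R -> R -> R) (m gamma : R) (x u v : nat -> R) (N : nat) :
  0 < m <= gamma ->
  (forall s v1 v2, unit_itv s -> v1 <= v2 -> m * (v2 - v1) <= f s v2 - f s v1 <= gamma * (v2 - v1)) ->
  (forall j, (j <= N)%nat -> unit_itv (x j)) ->
  exists q, forall j, (j <= N)%nat -> m / gamma <= q j <= 1 /\
    f (x j) (u j) - f (x j) (v j) = gamma * q j * (u j - v j).
Proof.
  intros Hmg Hf Hx.
  (* Where the two values coincide, any number in [m / gamma, 1] satisfies the identity; 1 is
     taken. *)
  exists (fun j => if Req_EM_T (u j) (v j) then 1 else (f (x j) (u j) - f (x j) (v j)) / (gamma * (u j - v j))).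
  intros j Hj. destruct Req_EM_T as [E|E].
  - rewrite E. split. split. apply Rmult_le_reg_r with gamma. lra. field_simplify; lra. lra. ring.
  - split. 2: field; split; lra.
    assert (P : exists D U, 0 < D /\ m * D <= U <= gamma * D /\
      (f (x j) (u j) - f (x j) (v j)) / (gamma * (u j - v j)) = U / (gamma * D)).
    { destruct (Rlt_dec (v j) (u j)) as [L|L].
      - exists (u j - v j), (f (x j) (u j) - f (x j) (v j)).
        split. lra. split. apply Hf. apply Hx, Hj. lra. reflexivity.
      - exists (v j - u j), (f (x j) (v j) - f (x j) (u j)).
        split. lra. split. apply Hf. apply Hx, Hj. lra. field. repeat split; lra. }
    destruct P as (D & U & PD & PU & ->).
    assert (0 < gamma * D) by nra.
    split; apply Rmult_le_reg_r with (gamma * D); try lra;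
      replace (U / (gamma * D) * (gamma * D)) with U by (field; lra).
    + replace (m / gamma * (gamma * D)) with (m * D) by (field; lra). lra.
    + lra.
Qed.

(** * Convergence *)

Lemma ln_ge_1 (x : R) : 4 <= x -> 1 <= ln x.
Proof.
  intros Hx. rewrite <- (ln_exp 1). apply ln_le. apply exp_pos. pose proof exp_le_3. lra.
Qed.

Lemma ln_le_id (x : R) : 0 < x -> ln x <= x.
Proof.
  intros Hx. pose proof (exp_ineq1_le (ln x)). rewrite exp_ln in H by exact Hx. lra.
Qed.

Lemma sq_exp_neg_le (u : R) : 0 <= u -> u ^ 2 * exp (- u) <= 2.
Proof.
  intros Hu. pose proof (exp_ge_quadratic u Hu). pose proof (exp_pos (- u)).
  assert (J : exp u * exp (- u) = 1) by (rewrite <- exp_plus, <- exp_0; f_equal; ring).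
  assert (u ^ 2 / 2 * exp (- u) <= exp u * exp (- u)) by (apply Rmult_le_compat_r; lra).
  lra.
Qed.

(** With the logarithmic value of [lambda] the layer exponential has decayed to exactly 1 / N^2 at
    the transition point. With the value 1 / 4, u^2 exp (- u) <= 2 at u = a / 4 gives 32 eps^2 /
    m. *)
Lemma lambda_facts (m eps : R) (N : nat) : 0 < m -> 0 < eps -> 4 <= INR N ->
  0 < lambda m eps N <= 1 / 4 /\
  sqrt m / eps * lambda m eps N <= 2 * ln (INR N) /\
  (exp (- (sqrt m / eps * lambda m eps N)) <= 1 / INR N ^ 2 \/
   exp (- (sqrt m / eps * lambda m eps N)) <= 32 / m * eps ^ 2).
Proof.
  intros Hm He HN. pose proof (ln_ge_1 _ HN) as Hl.
  assert (Hs : 0 < sqrt m) by (apply sqrt_lt_R0, Hm).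
  assert (Hse : 0 < sqrt m / eps) by (apply Rdiv_lt_0_compat; assumption).
  assert (E : sqrt m / eps * (2 * eps * ln (INR N) / sqrt m) = 2 * ln (INR N)) by (field; lra).
  unfold lambda. split; [split|split].
  - apply Rmin_glb_lt. apply Rdiv_lt_0_compat; nra. lra.
  - apply Rmin_r.
  - rewrite <- E. apply Rmult_le_compat_l. lra. apply Rmin_l.
  - unfold Rmin. destruct Rle_dec.
    + left. rewrite E.
      replace (- (2 * ln (INR N))) with (- (ln (INR N) + ln (INR N))) by ring.
      rewrite exp_Ropp, exp_plus, exp_ln by lra. apply Req_le. field. lra.
    + right. set (u := sqrt m / eps * (1 / 4)).
      assert (Hu : 0 < u) by (unfold u; lra).
      pose proof (sq_exp_neg_le u ltac:(lra)) as Q.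
      apply Rmult_le_reg_l with (u ^ 2). nra.
      replace (u ^ 2 * (32 / m * eps ^ 2)) with 2. exact Q.
      unfold u. replace ((sqrt m / eps * (1 / 4)) ^ 2) with (sqrt m ^ 2 / eps ^ 2 / 16) by (field; lra).
      rewrite pow2_sqrt by lra. field. lra.
Qed.

(** Rows with two fine cells carry the layer term (H / eps)^2. In all others the layer exponential
    is already at most a multiple of the larger of 1 / N^2 and eps^2, and no layer term arises. *)
Lemma residual_bound (f : R -> R -> R) (m gamma t C : R) :
  (forall p : R * R, continuous (fun p : R * R => f (clamp (fst p)) (snd p)) p) ->
  0 < m <= gamma -> 0 <= t <= 1 -> 0 < C ->
  exists K, 0 < K /\ forall eps n x y y1 w1 w2, 0 < eps < 1 -> (0 < n)%nat ->
    let lam := lambda m eps (4 * n) in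
    let H := 4 * lam / INR (4 * n) in
    let mu := m / gamma / 64 * (sqrt m / eps) in
    shishkin_mesh n lam H x ->
    apriori_bounds f m gamma C eps y y1 w1 w2 ->
    forall i, (1 <= i < 4 * n)%nat ->
      Rabs (scheme f t gamma (sqrt gamma / eps) x (fun j => y (x j)) i)
      <= K * row_d (sqrt gamma / eps) x i *
         (1 / INR (4 * n) ^ 2 + (H / eps) ^ 2 * (decay_left mu x i + decay_right mu x i)).
Proof.
  intros Cf Hmg Ht HC.
  assert (Hm : 0 < m) by lra. assert (Hg : 0 < gamma) by lra.
  assert (Hkap : 0 < m / gamma <= 1).
  { split. apply Rdiv_lt_0_compat; lra. apply Rmult_le_reg_r with gamma. lra. field_simplify; lra. }
  set (e8 := exp 8). assert (He8 : 0 < e8) by apply exp_pos.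
  assert (H32 : 0 < 32 / m) by (apply Rdiv_lt_0_compat; lra).
  (* [e8] pays for one fine cell, since a H <= 8; 1 + 32 / m covers both alternatives of
     [lambda_facts]. *)
  set (K0 := 2 * e8 * (1 + 32 / m)).
  assert (HK0 : 0 < K0) by (unfold K0; nra).
  set (Kf := 12 * C * (1 + e8)).
  (* In units of 1 / N^2, 64 bounds the difference of neighbouring cells, 196 = (7 + 7)^2 bounds (h
     + k)^2, and 260 is their sum. *)
  set (Kc := 3 * C * 64 + 2 * C * (2 * C * (1 + K0) + 196) + 3 * C * (1 + K0) * 260).
  assert (HKf : 0 < Kf) by (unfold Kf; nra).
  assert (HCK : 0 < C * K0) by nra.
  assert (HCCK : 0 < C * (C * (1 + K0))) by (apply Rmult_lt_0_compat; nra).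
  assert (HKc : 0 < Kc) by (unfold Kc; nra).
  exists (Kf + Kc). split. lra.
  intros eps n x y y1 w1 w2 He Hn lam H mu Hx Hap i Hi.
  assert (HN4 : 4 <= INR (4 * n)).
  { rewrite mult_INR. simpl. pose proof (le_INR 1 n Hn) as L. simpl in L. lra. }
  set (N := INR (4 * n)) in *.
  destruct (lambda_facts m eps (4 * n) Hm ltac:(lra) HN4) as (Hlam & HaL & Hg0).
  fold lam N in Hlam, HaL, Hg0.
  set (a := sqrt m / eps) in *.
  assert (Ha : 0 < a) by (apply Rdiv_lt_0_compat; [apply sqrt_lt_R0|]; lra).
  assert (HH : 0 < H) by (apply Rdiv_lt_0_compat; lra).
  assert (HHN : H <= 1 / N) by (apply Rmult_le_compat_r; [apply Rlt_le, Rinv_0_lt_compat|]; lra).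
  assert (HaH : a * H <= 8).
  { replace (a * H) with (4 * (a * lam) / N) by (unfold H; field; lra).
    pose proof (ln_le_id N ltac:(lra)).
    apply Rmult_le_reg_r with N. lra. field_simplify; lra. }
  assert (Hmu : 0 < mu <= a).
  { unfold mu. fold a. nra. }
  set (A := 1 / N ^ 2).
  assert (HN2 : 0 < N ^ 2) by nra.
  assert (HA : 0 < A) by (apply Rdiv_lt_0_compat; lra).
  assert (He2 : 0 < eps ^ 2) by nra.
  pose proof (sm_incr _ _ _ _ Hx) as Inc. pose proof (sm_step _ _ _ _ Hx) as Stp.
  set (h := step x (i - 1)). set (k := step x i).
  assert (Eh : h = x i - x (i - 1)%nat).
  { unfold h, step. replace (i - 1 + 1)%nat with i by lia. reflexivity. }
  assert (Ek : k = x (i + 1)%nat - x i) by reflexivity.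
  assert (Xl : x i - h = x (i - 1)%nat) by lra. assert (Xr : x i + k = x (i + 1)%nat) by lra.
  assert (Ph : 0 < h).
  { unfold h, step. pose proof (Inc (i - 1)%nat ltac:(lia)). lra. }
  assert (Pk : 0 < k) by (unfold k, step; pose proof (Inc i ltac:(lia)); lra).
  pose proof (shishkin_mesh_unit _ _ _ _ Hx) as Ubnd. unfold unit_itv in Ubnd.
  pose proof (Ubnd (i - 1)%nat ltac:(lia)) as Ul. pose proof (Ubnd (i + 1)%nat ltac:(lia)) as Ur.
  set (beta := sqrt gamma / eps).
  assert (Hb : 0 < beta) by (apply Rdiv_lt_0_compat; [apply sqrt_lt_R0|]; lra).
  assert (Pz : 0 < beta * h) by (apply Rmult_lt_0_compat; lra).
  assert (PZ : 0 < beta * k) by (apply Rmult_lt_0_compat; lra).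
  assert (Pd : 0 < row_d beta x i).
  { unfold row_d. fold h k. pose proof (hyp_d_pos _ Pz). pose proof (hyp_d_pos _ PZ). lra. }
  assert (PL : 0 < decay_left mu x i) by apply exp_pos.
  assert (PR : 0 < decay_right mu x i) by apply exp_pos.
  set (S := decay_left mu x i + decay_right mu x i) in *.
  set (B := (H / eps) ^ 2).
  assert (HB : 0 <= B) by apply pow2_ge_0.
  assert (Finish : forall M, 0 <= M <= Kf + Kc -> forall r, r <= row_d beta x i * (M * (A + B * S)) ->
     r <= (Kf + Kc) * row_d beta x i * (A + B * S)).
  { intros M HM r Hr. eapply Rle_trans. exact Hr.
    assert (0 <= B * S) by (apply Rmult_le_pos; unfold S; lra).
    replace ((Kf + Kc) * row_d beta x i * (A + B * S)) with
      (row_d beta x i * ((Kf + Kc) * (A + B * S))) by ring.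
    apply Rmult_le_compat_l. lra. apply Rmult_le_compat_r; lra. }
  pose proof (fun E => truncation_by_derivatives f m gamma C eps (x i) h k (1 - t) E y y1 w1 w2
    Cf Hg ltac:(lra) HC Ph Pk ltac:(lra) ltac:(lra) ltac:(lra) Hap) as T1.
  pose proof (fun E => truncation_by_reduced_slope f m gamma C eps (x i) h k (1 - t) E y y1 w1 w2
    Hg ltac:(lra) HC Ph Pk ltac:(lra) ltac:(lra) ltac:(lra) Hap) as T2.
  cbv zeta in T1, T2. rewrite Xl, Xr in T1, T2. fold beta a in T1, T2.
  unfold scheme. fold h k.
  change (hyp_d (beta * h) + hyp_d (beta * k)) with (row_d beta x i) in T1, T2.
  (* The split is by cell sizes, not by index: on the uniform mesh, [lambda] = 1 / 4, every row is
     of the first kind. *)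
  destruct (classic (h = H /\ k = H)) as [[Ehh Ekk]|Coarse].
  { apply (Finish Kf). lra.
    eapply Rle_trans.
    { apply (T1 (e8 * layer a (x i))). intros s Hs. eapply Rle_trans.
      apply (layer_shift a (x i) s H). lra. apply Rabs_le_between; lra.
      apply Rmult_le_compat_r. apply Rlt_le, layer_pos. apply exp_le. exact HaH. }
    apply Rmult_le_compat_l. lra. rewrite Ehh, Ekk.
    replace (H - H) with 0 by ring. rewrite Rabs_R0.
    (* mu <= a, so the layer function lies below the slower exponentials of the stability
       estimate. *)
    assert (LS : layer a (x i) <= S).
    { pose proof (Ubnd i ltac:(lia)). unfold layer, S, decay_left, decay_right.
      apply Rplus_le_compat; apply exp_le; nra. }
    assert (H2 : H ^ 2 <= A).
    { unfold A. replace (1 / N ^ 2) with ((1 / N) ^ 2) by (field; lra). apply pow_incr; lra. }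
    assert (BE : H ^ 2 * (layer a (x i) / eps ^ 2) <= B * S).
    { replace (H ^ 2 * (layer a (x i) / eps ^ 2)) with (B * layer a (x i)) by (unfold B; field; lra).
      apply Rmult_le_compat_l; assumption. }
    replace (3 * C * (1 + e8 * layer a (x i) / eps ^ 2) * (0 + (H + H) ^ 2)) with
      (12 * C * (H ^ 2 + e8 * (H ^ 2 * (layer a (x i) / eps ^ 2)))) by (field; lra).
    unfold Kf. rewrite (Rmult_assoc (12 * C)). apply Rmult_le_compat_l. lra.
    assert (0 <= B * S) by (apply Rmult_le_pos; unfold S; lra).
    assert (e8 * (H ^ 2 * (layer a (x i) / eps ^ 2)) <= e8 * (B * S)) by (apply Rmult_le_compat_l; lra).
    assert (0 <= e8 * A) by (apply Rmult_le_pos; lra). lra. }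
  assert (G1 : (n <= i <= 3 * n)%nat).
  { destruct (Nat.lt_ge_cases i n) as [F|G1]; [|destruct (Nat.lt_ge_cases (3 * n) i) as [F|G2]; [|lia]].
    - exfalso. apply Coarse. split; apply (sm_left _ _ _ _ Hx); lia.
    - exfalso. apply Coarse. split; apply (sm_right _ _ _ _ Hx); lia. }
  apply (Finish Kc); [lra|].
  set (g0 := exp (- (a * lam))) in *.
  assert (HE : forall s, x (i - 1)%nat <= s <= x (i + 1)%nat -> layer a s <= 2 * e8 * g0).
  { intros s Hs.
    (* At i = n the stencil reaches one fine cell into the layer. *)
    assert (Sl : lam - H <= x (i - 1)%nat).
    { destruct (Nat.eq_dec i n) as [->|].
      - pose proof (sm_left _ _ _ _ Hx (n - 1)%nat ltac:(lia)) as Q.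
        replace (n - 1 + 1)%nat with n in Q by lia.
        pose proof (sm_ge _ _ _ _ Hx n ltac:(lia)). lra.
      - pose proof (sm_ge _ _ _ _ Hx (i - 1)%nat ltac:(lia)). lra. }
    assert (Sr : x (i + 1)%nat <= 1 - lam + H).
    { destruct (Nat.eq_dec i (3 * n)) as [->|].
      - pose proof (sm_right _ _ _ _ Hx (3 * n)%nat ltac:(lia)) as Q.
        pose proof (sm_le _ _ _ _ Hx (3 * n)%nat ltac:(lia)). lra.
      - pose proof (sm_le _ _ _ _ Hx (i + 1)%nat ltac:(lia)). lra. }
    unfold layer, e8, g0. rewrite Rmult_assoc, <- exp_plus.
    assert (exp (- a * s) <= exp (8 + - (a * lam))) by (apply exp_le; nra).
    assert (exp (- a * (1 - s)) <= exp (8 + - (a * lam))) by (apply exp_le; nra).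
    lra. }
  assert (Sm : Rabs (k - h) <= 64 * A).
  { rewrite Ek, Eh. unfold A. replace (64 * (1 / N ^ 2)) with (64 / N ^ 2) by (field; lra).
    apply (sm_smooth _ _ _ _ Hx). exact Hi. }
  assert (Sq : (h + k) ^ 2 <= 196 * A).
  { replace (196 * A) with ((14 / N) ^ 2) by (unfold A; field; lra).
    apply pow_incr. split. lra.
    pose proof (Stp (i - 1)%nat ltac:(lia)) as Q1. pose proof (Stp i ltac:(lia)) as Q2.
    fold (step x (i - 1)) in Q1. fold (step x i) in Q2. fold h in Q1. fold k in Q2. fold N in Q1, Q2. lra. }
  pose proof (Rabs_pos (k - h)). pose proof (pow2_ge_0 (h + k)).
  assert (HBS : 0 <= B * S) by (apply Rmult_le_pos; unfold S; lra).
  assert (Pg0 : 0 < g0) by apply exp_pos.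
  (* Used with r the larger of 1 / N^2 and eps^2, which differs between the two cases below. *)
  assert (Ecmp : forall r, A <= r -> eps ^ 2 <= r -> 2 * e8 * g0 <= K0 * r).
  { intros r R1 R2. unfold K0. rewrite (Rmult_assoc (2 * e8)). apply Rmult_le_compat_l. lra.
    assert (32 / m * eps ^ 2 <= 32 / m * r) by (apply Rmult_le_compat_l; lra).
    assert (0 <= 32 / m * r) by (apply Rmult_le_pos; lra).
    destruct Hg0 as [Q|Q]; [fold A in Q|]; lra. }
  destruct (Rle_dec (eps ^ 2) A) as [Small|Large].
  - eapply Rle_trans. apply (T2 (2 * e8 * g0)). exact HE.
    apply Rmult_le_compat_l. lra.
    pose proof (Ecmp A ltac:(lra) Small) as E.
    assert (I1 : 3 * C * Rabs (k - h) <= 3 * C * (64 * A)) by (apply Rmult_le_compat_l; lra).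
    assert (I2 : 2 * C * (2 * C * (eps ^ 2 + 2 * e8 * g0) + (h + k) ^ 2)
       <= 2 * C * (2 * C * ((1 + K0) * A) + 196 * A)).
    { apply Rmult_le_compat_l. lra. apply Rplus_le_compat. apply Rmult_le_compat_l; lra. exact Sq. }
    apply Rle_trans with (Kc * A). 2: apply Rmult_le_compat_l; lra.
    assert (0 <= 3 * C * (1 + K0) * 260 * A).
    { apply Rmult_le_pos; [apply Rmult_le_pos; [apply Rmult_le_pos|]|]; lra. }
    unfold Kc. lra.
  - eapply Rle_trans. apply (T1 (2 * e8 * g0)). exact HE.
    apply Rmult_le_compat_l. lra.
    pose proof (Ecmp (eps ^ 2) ltac:(lra) ltac:(lra)) as E.
    assert (E' : 2 * e8 * g0 / eps ^ 2 <= K0).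
    { apply Rmult_le_reg_r with (eps ^ 2). exact He2.
      replace (2 * e8 * g0 / eps ^ 2 * eps ^ 2) with (2 * e8 * g0) by (field; lra). exact E. }
    assert (I1 : 3 * C * (1 + 2 * e8 * g0 / eps ^ 2) * (Rabs (k - h) + (h + k) ^ 2)
       <= 3 * C * (1 + K0) * (260 * A)).
    { apply Rmult_le_compat; try lra.
      - apply Rmult_le_pos. lra. assert (0 < 2 * e8 * g0 / eps ^ 2) by (apply Rdiv_lt_0_compat; nra). lra.
      - apply Rmult_le_compat_l; lra. }
    apply Rle_trans with (Kc * A). 2: apply Rmult_le_compat_l; lra.
    assert (0 <= 2 * C * (2 * C * (1 + K0) + 196) * A).
    { apply Rmult_le_pos; lra. }
    assert (0 <= 3 * C * 64 * A) by (apply Rmult_le_pos; lra).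
    unfold Kc. lra.
Qed.

Theorem theorem5p1 :
  forall (f : R -> R -> R) (k : nat) (m gamma t : R),
    (2 <= k)%nat ->
    Ck_slab k f ->
    0 < m ->
    (forall x v : R, 0 <= x <= 1 -> m <= partial_y f x v) ->
    (forall x v : R, 0 <= x <= 1 -> partial_y f x v <= gamma) ->
    0 <= t <= 1 ->
    exists C : R, 0 < C /\
      forall (eps : R) (N : nat) (y : R -> R) (ybar : nat -> R),
        0 < eps < 1 ->
        (0 < N)%nat ->
        Nat.divide 4 N ->
        bvp_solution f eps y ->
        discrete_solution f t gamma eps N (mesh m eps N) ybar ->
        forall i : nat, (i <= N)%nat ->
          Rabs (y (mesh m eps N i) - ybar i) <= C * error_rate N i.
Proof.
  intros f k m gamma t Hk HC Hm Hlo Hhi Ht.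
  assert (Hmg : m <= gamma) by (eapply Rle_trans; [apply (Hlo 0 0)|apply Hhi]; lra).
  assert (Hg : 0 < gamma) by lra.
  destruct (apriori k f m gamma Hk HC Hm Hlo Hhi) as (Hinc & Cf & C & HCp & Hap).
  destruct (residual_bound f m gamma t C Cf (conj Hm Hmg) Ht HCp) as (K & HK & Hres).
  set (kappa := m / gamma).
  assert (Hkap : 0 < kappa <= 1).
  { unfold kappa. split. apply Rdiv_lt_0_compat; lra.
    apply Rmult_le_reg_r with gamma. lra. field_simplify; lra. }
  assert (Hsm : 0 < sqrt m) by (apply sqrt_lt_R0, Hm).
  assert (Hsg : 0 < sqrt gamma) by (apply sqrt_lt_R0, Hg).
  assert (Hsmg : sqrt m <= sqrt gamma) by (apply sqrt_le_1_alt, Hmg).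
  set (rho := kappa / 64 * sqrt m).
  assert (Hrho : 0 < rho) by (unfold rho; apply Rmult_lt_0_compat; lra).
  (* [K3] counts the two exponentials and the constant 8 / kappa of the discrete barrier. *)
  set (K3 := 2 + 8 / kappa).
  assert (HK3 : 0 < K3).
  { unfold K3. assert (0 < 8 / kappa) by (apply Rdiv_lt_0_compat; lra). lra. }
  set (V := 2 * K / kappa). assert (HV : 0 < V) by (apply Rdiv_lt_0_compat; lra).
  (* Both come from (H / eps)^2 = 16 (lambda / eps)^2 / N^2: [Cm] by u^2 exp (- u) <= 2 at u = mu
     lambda = rho lambda / eps, and [Cl] by m (lambda / eps)^2 <= 4 ln^2 N. *)
  set (Cm := 32 / rho ^ 2 * K3). set (Cl := 64 / m * K3).
  assert (HCm : 0 < Cm) by (apply Rmult_lt_0_compat; [apply Rdiv_lt_0_compat; nra|exact HK3]).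
  assert (HCl : 0 < Cl) by (apply Rmult_lt_0_compat; [apply Rdiv_lt_0_compat; lra|exact HK3]).
  exists (V * (1 + Cm + Cl)). split. apply Rmult_lt_0_compat; lra.
  intros eps N y ybar He HN [n En] Hsol Hdis i Hi.
  assert (EN : N = (4 * n)%nat) by lia. clear En. subst N.
  assert (Hn : (0 < n)%nat) by lia.
  assert (HN4 : 4 <= INR (4 * n)).
  { rewrite mult_INR. simpl. pose proof (le_INR 1 n Hn) as L. simpl in L. lra. }
  set (ye := fun s => y (clamp s)).
  assert (Hes : extended_solution f eps ye (Derive y)) by (apply bvp_extended_solution; [lra|exact Hsol]).
  destruct (Hap eps ye (Derive y) He Hes) as (w1 & w2 & Hab).
  destruct (lambda_facts m eps (4 * n) Hm ltac:(lra) HN4) as (Hlam & HaL & _).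
  set (lam := lambda m eps (4 * n)) in *. set (H := 4 * lam / INR (4 * n)).
  set (x := mesh m eps (4 * n)).
  assert (Hx : shishkin_mesh n lam H x) by (apply psi_shishkin_mesh; assumption).
  set (a := sqrt m / eps) in *.
  assert (Ha : 0 < a) by (apply Rdiv_lt_0_compat; lra).
  set (beta := sqrt gamma / eps).
  assert (Hb : 0 < beta) by (apply Rdiv_lt_0_compat; lra).
  (* Chosen so that theta beta is kappa / 64 times a; m <= gamma then gives theta <= kappa / 64. *)
  set (theta := kappa / 64 * (sqrt m / sqrt gamma)).
  assert (Hth : 0 < theta <= kappa / 64).
  { assert (0 < sqrt m / sqrt gamma <= 1).
    { split. apply Rdiv_lt_0_compat; lra. apply Rmult_le_reg_r with (sqrt gamma). lra. field_simplify; lra. }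
    unfold theta. nra. }
  assert (Hmu : theta * beta = kappa / 64 * a).
  { unfold theta, beta, a. field. lra. }
  pose proof (Hres eps n x ye (Derive y) w1 w2 He Hn Hx Hab) as Res. clear Hres.
  fold kappa a beta lam H in Res. rewrite <- Hmu in Res.
  pose proof (shishkin_mesh_unit _ _ _ _ Hx) as Ubnd.
  destruct (difference_quotients f m gamma x (fun j => ye (x j)) ybar (4 * n)) as [q Hq]; auto.
  assert (Yx : forall j, (j <= 4 * n)%nat -> ye (x j) = y (x j)).
  { intros j Hj. unfold ye. rewrite clamp_id; auto. }
  assert (HH : 0 < H) by (apply Rdiv_lt_0_compat; lra).
  assert (Pln : 0 < ln (INR (4 * n)) <= INR (4 * n)).
  { pose proof (ln_ge_1 _ HN4). pose proof (ln_le_id (INR (4 * n)) ltac:(lra)). lra. }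
  assert (HaH : a * H <= 8).
  { replace (a * H) with (4 * (a * lam) / INR (4 * n)) by (unfold H; field; lra).
    apply Rmult_le_reg_r with (INR (4 * n)). lra. field_simplify; lra. }
  set (e := fun j => ye (x j) - ybar j).
  set (A := 1 / INR (4 * n) ^ 2). set (B := (H / eps) ^ 2).
  assert (HN2 : 0 < INR (4 * n) ^ 2) by (apply pow_lt; lra).
  assert (HA : 0 < A) by (apply Rdiv_lt_0_compat; lra).
  assert (HB : 0 <= B) by apply pow2_ge_0.
  assert (Rows : forall j, (1 <= j < 4 * n)%nat -> Rabs (row_at t beta x q e j)
     <= K * row_d beta x j * (A + B * (decay_left (theta * beta) x j + decay_right (theta * beta) x j))).
  { intros j Hj.
    assert (P1 : 0 < beta * step x (j - 1)).
    { apply Rmult_lt_0_compat. exact Hb. apply (step_pos _ _ _ _ Hx). lia. }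
    assert (P2 : 0 < beta * step x j).
    { apply Rmult_lt_0_compat. exact Hb. apply (step_pos _ _ _ _ Hx). lia. }
    pose proof (hyp_d_pos _ P1). pose proof (hyp_d_pos _ P2).
    pose proof (T_scheme f t gamma eps (4 * n) x ybar j Hj Hg P1 P2) as TS.
    fold x in Hdis. rewrite (Hdis j ltac:(lia)) in TS. fold beta in TS.
    assert (Z : scheme f t gamma beta x ybar j = 0).
    { symmetry in TS. apply Rmult_integral in TS. destruct TS as [TS|TS]. 2: exact TS.
      assert (0 < gamma / row_d beta x j).
      { apply Rdiv_lt_0_compat. exact Hg. unfold row_d. lra. }
      lra. }
    pose proof (scheme_difference f t gamma beta x (fun j => ye (x j)) ybar q j Hg) as SD.
    rewrite Z, Rminus_0_r in SD. unfold e. rewrite <- SD. apply Res. exact Hj.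
    intros l Hl. apply Hq. lia. }
  assert (E0 : e 0%nat = 0).
  { pose proof (Hdis 0%nat ltac:(lia)) as D. unfold T in D. simpl in D.
    unfold e. rewrite (sm_0 _ _ _ _ Hx), (es_0 _ _ _ _ Hes). lra. }
  assert (E1 : e (4 * n)%nat = 0).
  { pose proof (Hdis (4 * n)%nat ltac:(lia)) as D. unfold T in D.
    replace (4 * n =? 0)%nat with false in D by (symmetry; apply Nat.eqb_neq; lia).
    rewrite Nat.eqb_refl in D.
    unfold e. rewrite (sm_N _ _ _ _ Hx), (es_1 _ _ _ _ Hes). lra. }
  pose proof (error_le_barrier n lam H x a beta kappa theta t q Hx Hb Hkap Hth Hmu HaH Ht
    (fun j Hj => proj1 (Hq j Hj)) A B K e ltac:(lra) HB ltac:(lra) E0 E1 Rows i Hi) as Err.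
  unfold e in Err. rewrite Yx in Err by exact Hi. fold V in Err.
  eapply Rle_trans. exact Err. rewrite (Rmult_assoc V (1 + Cm + Cl)). apply Rmult_le_compat_l. lra.
  assert (Mu0 : 0 < theta * beta) by (apply Rmult_lt_0_compat; lra).
  set (mu := theta * beta) in *. set (G := exp (- (mu * lam))).
  assert (PG : 0 < G) by apply exp_pos.
  assert (H8 : 0 < 8 / kappa) by (apply Rdiv_lt_0_compat; lra).
  pose proof (Ubnd i Hi) as Ui. unfold unit_itv in Ui.
  unfold error_rate.
  (* N is a multiple of 4, so the truncating divisions in [error_rate] are exact. *)
  replace (4 * n / 4)%nat with n by (rewrite Nat.mul_comm, Nat.div_mul; lia).
  replace (3 * (4 * n) / 4)%nat with (3 * n)%nat
    by (replace (3 * (4 * n))%nat with (3 * n * 4)%nat by lia; rewrite Nat.div_mul; lia).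
  assert (Coarse : (n <= i <= 3 * n)%nat ->
     A + B * (decay_left mu x i + decay_right mu x i + 8 / kappa * G) <= (1 + Cm + Cl) * A).
  { intros Ci.
    assert (D1 : decay_left mu x i <= G).
    { apply exp_le. pose proof (sm_ge _ _ _ _ Hx i ltac:(lia)). nra. }
    assert (D2 : decay_right mu x i <= G).
    { apply exp_le. pose proof (sm_le _ _ _ _ Hx i ltac:(lia)). nra. }
    (* Here the logarithm disappears: (lambda / eps)^2 exp (- rho lambda / eps) is bounded
       independently of eps and N. *)
    assert (BG : B * G <= 32 / rho ^ 2 * A).
    { assert (Er : mu * lam = rho * (lam / eps)) by (rewrite Hmu; unfold rho, a; field; lra).
      pose proof (sq_exp_neg_le (mu * lam) ltac:(nra)) as Q. fold G in Q.
      assert (Rp : 0 < rho ^ 2) by (apply pow_lt; exact Hrho).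
      apply Rmult_le_reg_l with (rho ^ 2). exact Rp.
      replace (rho ^ 2 * (B * G)) with (16 * A * ((mu * lam) ^ 2 * G))
        by (rewrite Er; unfold A, B, H; field; lra).
      replace (rho ^ 2 * (32 / rho ^ 2 * A)) with (16 * A * 2) by (field; lra).
      apply Rmult_le_compat_l; lra. }
    assert (B * (decay_left mu x i + decay_right mu x i + 8 / kappa * G) <= B * (K3 * G)).
    { apply Rmult_le_compat_l. exact HB. unfold K3. lra. }
    assert (K3 * (B * G) <= K3 * (32 / rho ^ 2 * A)) by (apply Rmult_le_compat_l; lra).
    assert (0 <= Cl * A) by (apply Rmult_le_pos; lra).
    unfold Cm. lra. }
  destruct ((n <=? i) && (i <=? 3 * n))%nat%bool eqn:Eb.
  - fold A. apply Coarse. apply andb_prop in Eb. destruct Eb as [B1 B2].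
    apply Nat.leb_le in B1. apply Nat.leb_le in B2. lia.
  (* In the layers the exponentials are only bounded by 1, and a lambda <= 2 ln N leaves the factor
     ln^2 N. *)
  - assert (D1 : decay_left mu x i <= 1) by (apply exp_le_1; nra).
    assert (D2 : decay_right mu x i <= 1) by (apply exp_le_1; nra).
    assert (D3 : G <= 1) by (apply exp_le_1; nra).
    pose proof (ln_ge_1 _ HN4) as L1.
    set (l := ln (INR (4 * n))) in *.
    assert (L2 : 1 <= l ^ 2) by nra.
    replace (l ^ 2 / INR (4 * n) ^ 2) with (l ^ 2 * A) by (unfold A; field; lra).
    assert (BB : B <= 64 / m * (l ^ 2 * A)).
    { apply Rmult_le_reg_l with m. exact Hm.
      replace (m * B) with (16 * A * (a * lam) ^ 2).
      2: { unfold a. replace ((sqrt m / eps * lam) ^ 2) with (sqrt m ^ 2 * (lam / eps) ^ 2) by (field; lra).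
           rewrite pow2_sqrt by lra. unfold A, B, H. field. lra. }
      replace (m * (64 / m * (l ^ 2 * A))) with (16 * A * (2 * l) ^ 2) by (field; lra).
      apply Rmult_le_compat_l. lra. apply pow_incr. split. 2: exact HaL. nra. }
    assert (B * (decay_left mu x i + decay_right mu x i + 8 / kappa * G) <= B * K3).
    { apply Rmult_le_compat_l. exact HB. unfold K3.
      assert (8 / kappa * G <= 8 / kappa * 1) by (apply Rmult_le_compat_l; lra). lra. }
    assert (B * K3 <= 64 / m * (l ^ 2 * A) * K3) by (apply Rmult_le_compat_r; lra).
    assert (1 * A <= l ^ 2 * A) by (apply Rmult_le_compat_r; lra).
    assert (0 <= Cm * (l ^ 2 * A)) by (apply Rmult_le_pos; lra).
    unfold Cl. lra.
Qed.
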